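(* Let $h=(h_1,h_2)$ with $h_1,h_2>0$, let $a\in C^\infty(\mathbb T^1)$ be real-valued, $a_0=\int_0^1a(s)\,ds$, and consider the operators on $H^{-\infty}_{L_h}(\Omega)$ $$P=\frac{\partial}{\partial x_1}+a(x_1)\frac{\partial}{\partial x_2},\qquad P_0=\frac{\partial}{\partial x_1}+a_0\frac{\partial}{\partial x_2}.$$ Let $A(x_1)=\int_0^{x_1}a(s)\,ds-x_1a_0$ and $$\Psi_aw(x_1,x_2)=\sum_{\xi_2\in\mathbb Z}e^{(\log h_2+2\pi i\xi_2)A(x_1)}\,\mathcal F_2w(x_1,\xi_2)\,u_{\xi_2}(x_2).$$ Then $$\Psi_a\circ P=P_0\circ\Psi_a.$$ Moreover, $P$ is globally $L_h$-hypoelliptic if and only if $P_0$ is globally $L_h$-hypoelliptic.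
   Context: $\Omega=(0,1)^2$ and $L_h=\partial_{x_1}^2+\partial_{x_2}^2$ on $\Omega$ with boundary conditions (BC), for $j=1,2$: $h_jf|_{x_j=0}=f|_{x_j=1}$ and $h_j\,\partial_{x_j}f|_{x_j=0}=\partial_{x_j}f|_{x_j=1}$, and domain $\mathrm{Dom}(L_h)=\{f\in L^2(\Omega):L_hf\in L^2(\Omega),\ f\text{ satisfies (BC)}\}$. Write $h^x=h_1^{x_1}h_2^{x_2}$. For $\xi\in\mathbb Z^2$, $u_\xi(x)=h^xe^{2\pi ix\cdot\xi}$ and $v_\xi(x)=h^{-x}e^{2\pi ix\cdot\xi}$ are biorthogonal systems of eigenfunctions of $L_h$ and its adjoint $L_h^*$, with eigenvalues $\lambda_\xi=(\log h_1+2\pi i\xi_1)^2+(\log h_2+2\pi i\xi_2)^2$ and $\overline{\lambda_\xi}$. Weight: $\langle\xi\rangle=(1+|\lambda_\xi|^2)^{1/4}$. $H^\infty_{L_h}(\overline\Omega)=\bigcap_{k\ge1}\mathrm{Dom}(L_h^k)$ with seminorms $\max_{j\le k}\|L_h^j\varphi\|_{L^2(\Omega)}$ (also written $H^\infty_{L_h}(\Omega)$); $H^\infty_{L_h^*}(\overline\Omega)$ likewise; $H^{-\infty}_{L_h}(\Omega)$ is the space of continuous linear functionals on $H^\infty_{L_h^*}(\overline\Omega)$, containing $H^\infty_{L_h}(\overline\Omega)$ via $\langle\psi,\varphi\rangle=\int_\Omega\psi\varphi\,dx$. The $L_h$-Fourier transform is $\widehat f(\xi)=\int_\Omega f\overline{v_\xi}\,dx$,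 $\widehat w(\xi)=\langle w,\overline{v_\xi}\rangle$ for distributions. Standing fact: it is a bijective homeomorphism from $H^\infty_{L_h}(\overline\Omega)$ onto the rapidly decaying sequences $\mathcal S(\mathbb Z^2)$ and from $H^{-\infty}_{L_h}(\Omega)$ onto the sequences of moderate (polynomial) growth $\mathcal S'(\mathbb Z^2)$, both measured by $\langle\xi\rangle$ (so $H^\infty_{L_h}(\overline\Omega)=\{h^xg:g\in C^\infty(\mathbb T^2)\}$). Derivatives and multiplication by $b\in C^\infty(\mathbb T^2)$ (in particular $b(x)=a(x_1)$) act on $H^{-\infty}_{L_h}(\Omega)$ by duality: $\langle\partial_{x_j}w,\varphi\rangle=-\langle w,\partial_{x_j}\varphi\rangle$, $\langle bw,\varphi\rangle=\langle w,b\varphi\rangle$. One-variable objects: for $j=1,2$, $u_{\xi_j}(x_j)=h_j^{x_j}e^{2\pi ix_j\xi_j}$, $v_{\xi_j}(x_j)=h_j^{-x_j}e^{2\pi ix_j\xi_j}$, $\xi_j\in\mathbb Z$; $L_j=-i\,d/dx_j$ on $(0,1)$ with boundary condition $h_jf(0)=f(1)$ and domain $\{f\in L^2((0,1)):L_jf\in L^2((0,1)),\ h_jf(0)=f(1)\}$; $L_j^*$ its adjoint; $H^\infty_{L_j}((0,1))=\bigcap_k\mathrm{Dom}(L_j^k)$, $H^\infty_{L_j^*}((0,1))$ likewise, and $H^{-\infty}_{L_j}((0,1))$ the continuous dual of $H^\infty_{L_j^*}((0,1))$. Partial Fourier coefficient with respect to $x_2$: for $f\in L^1(\Omega)$, $\mathcal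 F_2f(x_1,\xi_2)=\int_0^1f(x_1,x_2)\overline{v_{\xi_2}(x_2)}\,dx_2$; for $w\in H^{-\infty}_{L_h}(\Omega)$, $\mathcal F_2w(\cdot,\xi_2)\in H^{-\infty}_{L_1}((0,1))$ is $\langle\mathcal F_2w(\cdot,\xi_2),\varphi\rangle=\langle w,\varphi\times v_{-\xi_2}\rangle$, $(\varphi\times v_{-\xi_2})(x)=\varphi(x_1)v_{-\xi_2}(x_2)$. The operator $\Psi_a$ is characterized by $\mathcal F_2(\Psi_aw)(x_1,\xi_2)=e^{(\log h_2+2\pi i\xi_2)A(x_1)}\mathcal F_2w(x_1,\xi_2)$ for all $\xi_2\in\mathbb Z$ (product of a distribution with a smooth periodic function when $w$ is a distribution). An operator $Q$ on $H^{-\infty}_{L_h}(\Omega)$ is globally $L_h$-hypoelliptic if $w\in H^{-\infty}_{L_h}(\Omega)$ and $Qw\in H^\infty_{L_h}(\overline\Omega)$ imply $w\in H^\infty_{L_h}(\overline\Omega)$. *)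

(* Defs.v *)
From HB Require Import structures.
From mathcomp Require Export all_boot all_order all_algebra.
From mathcomp Require Export all_classical all_reals all_analysis.
From mathcomp Require Export complex.
From mathcomp.analysis.showcase Require summability.

Set Implicit Arguments.
Unset Strict Implicit.
Unset Printing Implicit Defensive.

Import Order.TTheory GRing.Theory Num.Theory numFieldNormedType.Exports.

Local Open Scope classical_set_scope.
Local Open Scope ring_scope.
Local Open Scope complex_scope.

Definition cexp (R : realType) (z : R[i]) : R[i] :=
  (expR (complex.Re z))%:C * (cos (complex.Im z) +i* sin (complex.Im z)).

(* Unordered sum over Z: limit of the finite partial sums along the directed
   set of finite subsets of int. *)
Definition csummableZ (R : realType) (F : int -> R[i]) : Prop :=
  cvg (summability.partial_sum (fun k => complex.Re (F k))
         @ summability.totally) /\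
  cvg (summability.partial_sum (fun k => complex.Im (F k))
         @ summability.totally).

Definition csumZ (R : realType) (F : int -> R[i]) : R[i] :=
  summability.sum (fun k => complex.Re (F k) : R) +i*
  summability.sum (fun k => complex.Im (F k) : R).

(* Elements of L^2 are represented by functions, two of which stand for the
   same element when they agree almost everywhere on D; their values outside D
   are irrelevant. An unbounded operator is given by its graph. *)
Section L2.
Context d (T : measurableType d) (R : realType).
Variables (mu : {measure set T -> \bar R}) (D : set T).
Implicit Types (f g u v : T -> R[i]) (G : (T -> R[i]) -> (T -> R[i]) -> Prop).

Definition cint f : R[i] :=
  (\int[mu]_(x in D) complex.Re (f x)) +i* (\int[mu]_(x in D) complex.Im (f x)).

Definition L2 f : Prop :=
  [/\ measurable_fun D (fun x => complex.Re (f x)),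
      measurable_fun D (fun x => complex.Im (f x)) &
      mu.-integrable D (fun x => (ComplexField.Normc.normc (f x) ^+ 2)%:E)].

Definition L2norm f : R :=
  Num.sqrt (\int[mu]_(x in D) (ComplexField.Normc.normc (f x) ^+ 2)).

Definition dom G : set (T -> R[i]) := [set f | exists g, G f g].

Definition app G f : T -> R[i] := xget (fun=> 0) [set g | G f g].

Definition adjoint G f g : Prop :=
  [/\ L2 f, L2 g & forall u v, G u v ->
      cint (fun x => v x * (f x)^*) = cint (fun x => u x * (g x)^*)].

Definition dom_pow G (k : nat) : set (T -> R[i]) :=
  [set f | forall j, (j < k)%N -> dom G (iter j (app G) f)].

Definition Hinfty G : set (T -> R[i]) :=
  \bigcap_(k in [set k | (1 <= k)%N]) dom_pow G k.

Definition Hseminorm G (k : nat) f : R :=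
  \big[Num.max/0]_(j < k.+1) L2norm (iter j (app G) f).

(* Continuous linear functionals on Hinfty G. A functional is a total map of
   which only the values on Hinfty G matter. *)
Definition Hdual G (w : (T -> R[i]) -> R[i]) : Prop :=
  (forall (c : R[i]) f g, Hinfty G f -> Hinfty G g ->
     w (fun x => c * f x + g x) = c * w f + w g) /\
  (exists (k : nat) (B : R), forall f, Hinfty G f ->
     `|w f| <= (B * Hseminorm G k f)%:C).

End L2.

Section Square.
Variable R : realType.
Implicit Types (f g theta phi psi : R * R -> R[i]).

Definition leb1 : {measure set (measurableTypeR R) -> \bar R} :=
  @lebesgue_measure R.

Definition leb2 :
    {measure set (measurableTypeR R * measurableTypeR R) -> \bar R} :=
  (@lebesgue_measure R \x @lebesgue_measure R)%E.

Definition Omega : set (R * R) := `]0, 1[%classic `*` `]0, 1[%classic.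

Definition int_Omega f : R[i] := cint leb2 Omega f.

(* false and true index the variables x_1 and x_2. *)
Definition dir (j : bool) : R * R := if j then (0, 1) else (1, 0).

Definition pderiv (j : bool) f : R * R -> R[i] := fun x =>
  ('D_(dir j) (fun y => complex.Re (f y)) x) +i*
  ('D_(dir j) (fun y => complex.Im (f y)) x).

Definition Cn (n : nat) f : Prop :=
  forall s : seq bool, (size s <= n)%N ->
    let g := foldr pderiv f s in
    [/\ continuous (fun x => complex.Re (g x)),
        continuous (fun x => complex.Im (g x)) &
        (size s < n)%N -> forall j x,
          derivable (fun y => complex.Re (g y)) x (dir j) /\
          derivable (fun y => complex.Im (g y)) x (dir j)].

Definition smooth f : Prop := forall n, Cn n f.

Definition laplacian f : R * R -> R[i] := fun x =>
  pderiv false (pderiv false f) x + pderiv true (pderiv true f) x.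

Definition BC (h1 h2 : R) f : Prop :=
  forall t : R, 0 <= t <= 1 ->
    [/\ h1%:C * f (0, t) = f (1, t),
        h1%:C * pderiv false f (0, t) = pderiv false f (1, t),
        h2%:C * f (t, 0) = f (t, 1) &
        h2%:C * pderiv true f (t, 0) = pderiv true f (t, 1)].

(* L_h f = g. For f in L^2 with L_h f in L^2 the traces in (BC) only exist in
   the weak sense: the boundary terms in Green's formula
     int (theta L_h f - f L_h theta) = 0
   have to vanish for all theta smooth up to the boundary that satisfy the
   dual condition, which is (BC) with 1/h_j in place of h_j. Taking theta with
   compact support in Omega, g is the distributional Laplacian of f; if f is
   smooth up to the boundary, the identity amounts to (BC) for f. Testing with
   all such theta, also near the corners, excludes functions with a
   logarithmic singularity at the corners, which satisfy (BC) on the open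
   sides but are not in the span of the eigenfunctions u_xi. *)
Definition Lh (h1 h2 : R) f g : Prop :=
  [/\ L2 leb2 Omega f, L2 leb2 Omega g &
      forall theta, smooth theta -> BC h1^-1 h2^-1 theta ->
        int_Omega (fun x => f x * laplacian theta x) =
        int_Omega (fun x => g x * theta x)].

Definition Lh_adj (h1 h2 : R) := adjoint leb2 Omega (Lh h1 h2).

Definition Hinf (h1 h2 : R) : set (R * R -> R[i]) := Hinfty (Lh h1 h2).

Definition Hinf_adj (h1 h2 : R) : set (R * R -> R[i]) :=
  Hinfty (Lh_adj h1 h2).

Definition functional := (R * R -> R[i]) -> R[i].
Implicit Types w : functional.

Definition Hminf (h1 h2 : R) w : Prop := Hdual leb2 Omega (Lh_adj h1 h2) w.

Definition eqHminf (h1 h2 : R) w w' : Prop :=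
  forall phi, Hinf_adj h1 h2 phi -> w phi = w' phi.

Definition embed psi : functional := fun phi =>
  int_Omega (fun x => psi x * phi x).

Definition in_Hinf (h1 h2 : R) w : Prop :=
  exists2 psi, Hinf h1 h2 psi & eqHminf h1 h2 w (embed psi).

Definition operator_on_Hminf (h1 h2 : R) (Q : functional -> functional) :=
  forall w, Hminf h1 h2 w -> Hminf h1 h2 (Q w).

Definition globally_hypoelliptic (h1 h2 : R) (Q : functional -> functional) :=
  forall w, Hminf h1 h2 w -> in_Hinf h1 h2 (Q w) -> in_Hinf h1 h2 w.

(* Elements of Hinf_adj are classes modulo a.e. equality, so they are
   differentiated weakly; it suffices to test with compactly supported C^1
   functions. *)
Definition weak_pderiv (j : bool) phi psi : Prop :=
  [/\ L2 leb2 Omega phi, L2 leb2 Omega psi &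
      forall theta, Cn 1 theta -> closure [set x | theta x != 0] `<=` Omega ->
        int_Omega (fun x => phi x * pderiv j theta x) =
        - int_Omega (fun x => psi x * theta x)].

Definition wpderiv (j : bool) phi : R * R -> R[i] :=
  xget (fun=> 0) [set psi | weak_pderiv j phi psi].

Definition dist_deriv (j : bool) w : functional := fun phi =>
  - w (wpderiv j phi).

Definition dist_mul (T : Type) (b : T -> R[i]) (w : (T -> R[i]) -> R[i]) :
  (T -> R[i]) -> R[i] :=
  fun phi : T -> R[i] => w (fun x => b x * phi x).

(* The vector field d/dx_1 + b(x_1) d/dx_2. *)
Definition vfield (b : R -> R) w : functional := fun phi =>
  dist_deriv false w phi +
  dist_mul (fun x : R * R => (b x.1)%:C) (dist_deriv true w) phi.

Definition smooth_periodic (a : R -> R) : Prop :=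
  (forall (n : nat) (x : R), derivable (derive1n n a) x 1) /\
  (forall x : R, a (x + 1) = a x).

Definition mean (a : R -> R) : R := \int[leb1]_(s in `[0, 1]) a s.

(* Only used for x in (0,1). *)
Definition primA (a : R -> R) (x : R) : R :=
  (\int[leb1]_(s in `[0, x]) a s) - x * mean a.

Definition u1 (h : R) (k : int) (x : R) : R[i] :=
  (h `^ x)%:C * cexp ((2 * pi * x * k%:~R) *i).

Definition v1 (h : R) (k : int) (x : R) : R[i] :=
  (h `^ (- x))%:C * cexp ((2 * pi * x * k%:~R) *i).

(* Partial Fourier coefficient of w in x_2, a functional in x_1; v_(-k) is the
   complex conjugate of v_k and the pairing is bilinear. *)
Definition F2 (h2 : R) w (k : int) : (R -> R[i]) -> R[i] :=
  fun phi : R -> R[i] => w (fun x => phi x.1 * v1 h2 (- k) x.2).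

(* The distribution W(x_1) u(x_2). *)
Definition tensor (W : (R -> R[i]) -> R[i]) (u : R -> R[i]) : functional :=
  fun phi => W (fun x1 => cint leb1 `]0, 1[ (fun x2 => phi (x1, x2) * u x2)).

Definition Psi_term (h2 : R) (a : R -> R) w (k : int) : functional :=
  tensor
    (dist_mul (fun x1 => cexp ((ln h2 +i* (2 * pi * k%:~R)) * (primA a x1)%:C))
              (F2 h2 w k))
    (u1 h2 k).

Definition Psi (h2 : R) (a : R -> R) w : functional := fun phi =>
  csumZ (fun k => Psi_term h2 a w k phi).

Definition Psi_converges (h1 h2 : R) (a : R -> R) w : Prop :=
  forall phi, Hinf_adj h1 h2 phi ->
    csummableZ (fun k => Psi_term h2 a w k phi).

End Square.

(* Main.v *)
From mathcomp Require Import finmap.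
Require Import Defs.
From mathcomp Require Import ring lra measurable_realfun.

Set Implicit Arguments.
Unset Strict Implicit.
Unset Printing Implicit Defensive.

Import Order.TTheory GRing.Theory Num.Theory numFieldNormedType.Exports.

Local Open Scope classical_set_scope.
Local Open Scope ring_scope.

(** Every element of the common domain of the powers of L_h^* is almost
    everywhere equal to a smooth function f on the plane that is multiplied by
    1/h_j when x_j increases by 1, and all such functions belong to that
    domain. A distribution w is determined by its values on these functions,
    and on them the operators of the theorem are transposes of explicit maps:
    P w is f |-> w (D_a f) with D_a f = - (d_1 f + a(x_1) d_2 f), P_0 w is
    f |-> w (D_(a_0) f), and Psi_a w is f |-> w (T f), where
    T f (x) = f (x_1, x_2 - A(x_1)). As A' = a - a_0, the chain rule gives
    D_a T = T D_(a_0), and this is the identity of operators. The inverse of T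
    is the same map for - a, and T preserves the integral over a period, so
    Psi_a and Psi_(-a) are inverse to each other and map H^oo to itself. Hence
    hypoellipticity passes from P to P_0 and back.

    The description of the domain is elliptic regularity on the torus
    ([regularity]): a sequence of functions, each of which is the weak
    Laplacian of the one before, has Fourier coefficients of rapid decay after
    division by the multiplier, so that their sum is smooth, and it is the
    given function because it has the same integrals against cut-off
    functions ([recon], [fundamental_ae]). It is [HinfP] for an abstract
    operator, which covers L_h and its adjoint.

    Continuity of a distribution means a bound by finitely many norms of the
    powers of the Laplacian. An energy estimate with the weight h^(2x), which
    makes the boundary terms cancel ([W_grad], [sob_laps]), replaces them by
    weighted Sobolev norms, and these are stable under derivatives, under
    multiplication by smooth functions of x_1 and under T ([sob_mulfst],
    [sob_shear]).

    That Psi_a is the transpose of T rests on the Fourier series in x_2: the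
    k-th term of Psi_a w at f is w (T (pi_k f)), where pi_k f is the k-th term
    of the series of f ([Psi_termE]). Two integrations by parts bound pi_k f
    by a multiple of 1/(1+k^2), the partial sums converge uniformly
    ([fsum_unif]), and as pi_k commutes with the derivatives both statements
    hold in all Sobolev norms ([sob_family]); hence the series converges
    absolutely and its sum is w (T f) ([sum_fproj]).

    The analysis is done for real functions; complex ones are treated through
    their real and imaginary parts. *)

(** * Integrals and derivatives in one variable *)

Section OneVar.
Variable R : realType.
Notation mu := (@lebesgue_measure R).
Implicit Types (q F G : R -> R).

Definition I01 q : R := \int[mu]_(t in `]0, 1[) q t.

Definition int01 q := mu.-integrable `]0, 1[ (EFin \o q).

Lemma dcst (c x : R) : is_derive x (1:R) (fun=> c) 0.
Proof. exact: is_derive_cst. Qed.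

Lemma did (x : R) : is_derive x (1:R) (fun t => t) 1.
Proof. exact: is_derive_id. Qed.

Lemma dD F G x f g : is_derive x (1:R) F f -> is_derive x (1:R) G g ->
  is_derive x (1:R) (fun t => F t + G t) (f + g).
Proof. exact: is_deriveD. Qed.

Lemma dB F G x f g : is_derive x (1:R) F f -> is_derive x (1:R) G g ->
  is_derive x (1:R) (fun t => F t - G t) (f - g).
Proof. exact: is_deriveB. Qed.

Lemma dM F G x f g : is_derive x (1:R) F f -> is_derive x (1:R) G g ->
  is_derive x (1:R) (fun t => F t * G t) (f * G x + F x * g).
Proof.
move=> dF dG; have := is_deriveM dF dG.
by rewrite /GRing.scale /= addrC [G x * f]mulrC.
Qed.

Lemma dZ c F x f : is_derive x (1:R) F f ->
  is_derive x (1:R) (fun t => c * F t) (c * f).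
Proof. exact: is_deriveZ. Qed.

Lemma dcomp F G x f g : is_derive (G x) (1:R) F f -> is_derive x (1:R) G g ->
  is_derive x (1:R) (fun t => F (G t)) (f * g).
Proof. exact: is_derive1_comp. Qed.

Lemma derive_continuous F q : (forall x : R, is_derive x (1:R) F (q x)) -> continuous F.
Proof.
move=> dF x; apply: differentiable_continuous; apply/derivable1_diffP.
by have [] := dF x.
Qed.

Lemma cont_within q (A : set R) : continuous q -> {within A, continuous q}.
Proof. exact: continuous_subspaceT. Qed.

Lemma cont_int_seg q a b : continuous q -> mu.-integrable `[a, b] (EFin \o q).
Proof.
move=> cq; apply: continuous_compact_integrable; first exact: segment_compact.
exact: cont_within.
Qed.

Lemma cont_int01 q : continuous q -> int01 q.
Proof.
move=> cq; apply: (@integrableS _ _ _ mu `[0, 1]) => //.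
  exact: subset_itv_oo_cc.
exact: cont_int_seg.
Qed.

Lemma I01_cc q : continuous q -> I01 q = \int[mu]_(t in `[0, 1]) q t.
Proof.
move=> cq; rewrite /I01 Rintegral_itv_obnd_cbnd; last exact: cont_int01.
rewrite Rintegral_itv_bndo_bndc //.
apply: (@integrableS _ _ _ mu `[0, 1]) => //; last exact: cont_int_seg.
by apply: subset_itvl; rewrite bnd_simp.
Qed.

Lemma int_seg_FTC F q a b : a < b -> continuous q ->
  (forall x : R, is_derive x (1:R) F (q x)) ->
  \int[mu]_(t in `[a, b]) q t = F b - F a.
Proof.
move=> ab cq dF; rewrite /Rintegral (@continuous_FTC2 _ q F) //.
- exact: cont_within.
- have cF := derive_continuous dF.
  split; first by move=> x _; have [] := dF x.
  + by apply: cvg_at_right_filter; exact: cF.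
  + by apply: cvg_at_left_filter; exact: cF.
- by move=> x _; rewrite derive1E; have [_ ->] := dF x.
Qed.

Lemma I01E F q : continuous q -> (forall x : R, is_derive x (1:R) F (q x)) ->
  I01 q = F 1 - F 0.
Proof. by move=> cq dF; rewrite I01_cc // (int_seg_FTC _ cq dF). Qed.

(** The integral from a base point is a primitive only to the right of that
    point. The base point here depends on x and stays below min x 0;
    subtracting the value at 0 makes the choices agree. *)
Lemma primitive_exists q : continuous q ->
  exists F, forall x : R, is_derive x (1:R) F (q x).
Proof.
move=> cq.
pose G (a x : R) : R := \int[mu]_(t in `[a, x]) q t.
have dG (a x : R) : a < x -> is_derive x (1:R) (G a) (q x).
  move=> ax; have xx : x < x + 1 by rewrite ltrDl.
  have [d e] := @continuous_FTC1_closed R q a x _ xx (cont_int_seg _ _ cq) ax (cq x).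
  by apply: (DeriveDef d); rewrite -derive1E; exact: e.
have GB (a b x : R) : a <= b -> b < x -> G a x - G a b = G b x.
  move=> ab bx; rewrite /G (Rintegral_itvB (cont_int_seg _ _ cq)) ?bnd_simp //; last exact: ltW.
  rewrite Rintegral_itv_obnd_cbnd //.
  apply: (@integrableS _ _ _ mu `[b, x]) => //; last exact: cont_int_seg.
  by apply: subset_itvr; rewrite bnd_simp.
pose F x := G (Num.min x 0 - 1) x - G (Num.min x 0 - 1) 0.
exists F => x.
pose a := Num.min x 0 - 2.
apply: (@near_eq_is_derive _ _ _ (fun y => G a y - G a 0)).
  near=> y.
  have xy : x - 1 < y.
    by near: y; apply: lt_nbhsr; rewrite gtrDl ltrN10.
  have m0 : Num.min x 0 <= x /\ Num.min x 0 <= 0 by rewrite !ge_min !lexx orbT.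
  have my : Num.min y 0 <= y /\ Num.min y 0 <= 0 by rewrite !ge_min !lexx orbT.
  have H : a <= Num.min y 0 - 1.
    by rewrite /a; have [] : Num.min y 0 = y \/ Num.min y 0 = 0; [rewrite /Num.min; case: ifP; auto| |]; lra.
  rewrite /F -(GB a (Num.min y 0 - 1) y) // -?(GB a (Num.min y 0 - 1) 0) //; lra.
rewrite -[q x]subr0; apply: dB (dcst _ _).
apply: dG; rewrite /a; have : Num.min x 0 <= x by rewrite ge_min lexx.
lra.
Unshelve. all: by end_near. Qed.

Implicit Types (f g : R -> R).

Lemma derive0_cst F : (forall x : R, is_derive x (1:R) F 0) -> forall x y, F x = F y.
Proof. by move=> dF x y; apply: is_derive_0_is_cst. Qed.

Lemma derive_shift F q c : (forall x : R, is_derive x (1:R) F (q x)) ->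
  forall x : R, is_derive x (1:R) (fun t => F (t + c)) (q (x + c)).
Proof.
move=> dF x.
have := @dcomp F (fun t => t + c) _ _ _ (dF (x + c)) (dD (did x) (dcst c x)).
by rewrite addr0 mulr1.
Qed.

Lemma cont_shift q c : continuous q -> continuous (fun t => q (t + c)).
Proof.
move=> cq x; apply: (@continuous_comp _ _ _ (fun t => t + c) q); last exact: cq.
by apply: continuousD; [exact: cvg_id|exact: cvg_cst].
Qed.

(** A primitive of a 1-periodic function increases by the same amount over
    every interval of length 1. *)
Lemma I01_shift q c : continuous q -> (forall x, q (x + 1) = q x) ->
  I01 (fun t => q (t + c)) = I01 q.
Proof.
move=> cq pq; have [F dF] := primitive_exists cq.
rewrite (I01E (@cont_shift q c cq) (@derive_shift F q c dF)) (I01E cq dF).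
have H x : is_derive x (1:R) (fun t => F (t + 1) - F t) 0.
  rewrite -[0](subrr (q x)) -{1}(pq x); apply: dB (dF x).
  exact: (@derive_shift F q 1 dF).
have /= := derive0_cst H c 0.
by rewrite !add0r [1 + c]addrC.
Qed.

Lemma I01_parts F G f g : continuous f -> continuous g ->
  (forall x : R, is_derive x (1:R) F (f x)) -> (forall x : R, is_derive x (1:R) G (g x)) ->
  I01 (fun t => F t * g t) = F 1 * G 1 - F 0 * G 0 - I01 (fun t => f t * G t).
Proof.
move=> cf cg dF dG.
have cF := derive_continuous dF; have cG := derive_continuous dG.
have c1 : continuous (fun t => F t * g t) by move=> x; apply: continuousM; [exact: cF|exact: cg].
have c2 : continuous (fun t => f t * G t) by move=> x; apply: continuousM; [exact: cf|exact: cG].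
have d x : is_derive x (1:R) (fun t => F t * G t) (F x * g x + f x * G x).
  by rewrite addrC; exact: dM.
have c x : {for x, continuous (fun t => F t * g t + f t * G t)}.
  by apply: continuousD; [exact: c1|exact: c2].
rewrite -(I01E c d) /I01 RintegralD //; [|exact: cont_int01|exact: cont_int01].
by rewrite addrK.
Qed.

Lemma I01D f g : int01 f -> int01 g -> I01 (fun t => f t + g t) = I01 f + I01 g.
Proof. by move=> *; rewrite /I01 RintegralD. Qed.

Lemma I01B f g : int01 f -> int01 g -> I01 (fun t => f t - g t) = I01 f - I01 g.
Proof. by move=> *; rewrite /I01 RintegralB. Qed.

Lemma I01Z c f : int01 f -> I01 (fun t => c * f t) = c * I01 f.
Proof. by move=> *; rewrite /I01 RintegralZl. Qed.

Lemma I01_le f g : int01 f -> int01 g -> (forall x, 0 < x < 1 -> f x <= g x) ->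
  I01 f <= I01 g.
Proof.
by move=> cf cg fg; apply: le_Rintegral.
Qed.

Lemma eq_I01 f g : (forall x, 0 < x < 1 -> f x = g x) -> I01 f = I01 g.
Proof.
by move=> fg; apply: eq_Rintegral => x; rewrite inE/= in_itv /=; exact: fg.
Qed.

Lemma I01_cst c : I01 (fun=> c) = c.
Proof.
have d x : is_derive x (1:R) (fun x => c * x) c by have := dZ c (did x); rewrite mulr1.
have cc : continuous (fun _ : R => c) by move=> x; exact: cvg_cst.
by rewrite (I01E cc d) mulr1 mulr0 subr0.
Qed.

Lemma I01_norm f M : int01 f -> (forall x, 0 < x < 1 -> `|f x| <= M) -> `|I01 f| <= M.
Proof.
move=> cf H; apply: (le_trans (le_normr_Rintegral _ cf)) => //.
rewrite -[leRHS]I01_cst; apply: I01_le => //.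
- exact: integrable_norm.
- by apply: cont_int01 => x; exact: cvg_cst.
Qed.

End OneVar.

(** * Integrals over the unit square *)

Section TwoVar.
Variable R : realType.
Notation mu := (@lebesgue_measure R).
Notation T := (measurableTypeR R).
Implicit Types (f g : R * R -> R).

(** The measurable sets are those of the product sigma-algebra; an open set is
    the union of the countably many boxes with rational corners that it
    contains. *)
Lemma open_measurable2 (A : set (R * R)) : open A -> measurable (A : set (T * T)).
Proof.
move=> oA.
pose box (q : (rat * rat) * (rat * rat)) : set (R * R) :=
  `]ratr q.1.1, ratr q.1.2[%classic `*` `]ratr q.2.1, ratr q.2.2[%classic.
have -> : A = \bigcup_(q in [set q | box q `<=` A]) box q.
  apply/seteqP; split=> [[x y] Axy|z [q /= qA]]; last exact: qA.
  have /nbhs_ballP [e /= e0 eA] := open_nbhs_nbhs (conj oA Axy).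
  have rat_around (t : R) : exists p q : rat,
      [/\ t - e < ratr p, ratr p < t, t < ratr q & ratr q < t + e].
    have [p] : exists p : rat, ratr p \in `]t - e, t[ by apply: rat_in_itvoo; rewrite gtrBl.
    have [q] : exists q : rat, ratr q \in `]t, t + e[ by apply: rat_in_itvoo; rewrite ltrDl.
    by rewrite !in_itv /= => /andP[? ?] /andP[? ?]; exists p, q.
  have [p [q [a1 a2 a3 a4]]] := rat_around x; have [r [s [b1 b2 b3 b4]]] := rat_around y.
  exists ((p, q), (r, s)); last by split; rewrite /= in_itv /=; apply/andP.
  move=> [u v] [/= +  +]; rewrite !in_itv /= => /andP[? ?] /andP[? ?]; apply: eA.
  by split; rewrite /ball /= /ball_ ltr_norml; lra.
rewrite bigcup_mkcond; apply: countable_bigcupT_measurable; first exact: countableP.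
move=> q; case: ifPn => // _; apply: measurableX; exact: measurable_itv.
Qed.

Lemma cont2_measurable f (D : set (T * T)) : measurable D -> continuous f ->
  measurable_fun D (f : T * T -> T).
Proof.
move=> mD /continuousP cf; apply: (@measurable_funS _ _ _ _ setT) => //.
apply: (measurability _ (RGenOpens.measurableE R)).
move=> _ [_ [a [b ->] <-]]; rewrite setTI; apply: open_measurable2.
exact/cf/interval_open.
Qed.

Lemma measurable_Omega : measurable (@Omega R : set (T * T)).
Proof. by apply: measurableX; exact: measurable_itv. Qed.

Lemma OmegaP (x y : R) : Omega (x, y) <-> (0 < x < 1) /\ (0 < y < 1).
Proof. by rewrite /Omega /= !in_itv. Qed.

Lemma cont2_bounded f : continuous f -> exists2 M : R, 0 <= M &
  forall x y : R, 0 <= x <= 1 -> 0 <= y <= 1 -> `|f (x, y)| <= M.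
Proof.
move=> cf.
have cS : compact (`[0:R, 1] `*` `[0:R, 1] : set (R * R)).
  by apply: compact_setX; exact: segment_compact.
have cc : {within `[0:R, 1] `*` `[0:R, 1], continuous f} by exact: continuous_subspaceT.
have [M [Mr MP]] := compact_bounded (continuous_compact cc cS).
exists (`|M| + 1); first by rewrite addr_ge0.
move=> x y hx hy; apply: (MP (`|M| + 1)).
  by rewrite (le_lt_trans (ler_norm _)) // ltrDl.
by exists (x, y) => //; split; rewrite /= in_itv.
Qed.

Lemma leb2_Omega : leb2 R (@Omega R) = 1%E.
Proof.
rewrite /leb2 /Omega.
have := @product_measure1E _ _ T T R (@lebesgue_measure R) (@lebesgue_measure R)
  `]0, 1[%classic `]0, 1[%classic (measurable_itv _) (measurable_itv _).
have E : mu (`]0:R, 1:R[%classic) = 1%E.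
  by rewrite lebesgue_measure_itv /= lte_fin ltr01 oppr0 adde0.
by move=> H; apply: (etrans H); rewrite -[RHS]mule1; congr (_ * _)%E; exact: E.
Qed.

Definition intO f := (leb2 R).-integrable (@Omega R) (EFin \o f).

Definition J f : R := \int[leb2 R]_(x in @Omega R) f x.

Lemma bounded_intO f (M : R) : measurable_fun (@Omega R : set (T * T)) (f : T * T -> T) ->
  (forall x, Omega x -> `|f x| <= M) -> intO f.
Proof.
move=> mf fM; apply: measurable_bounded_integrable => //.
- exact: measurable_Omega.
- by rewrite leb2_Omega ltry.
exists M; split; first exact: num_real.
move=> N MN x Ox; apply: (le_trans (fM x Ox)); exact: ltW.
Qed.

Lemma cont_intO f : continuous f -> intO f.
Proof.
move=> cf; have [M M0 fM] := cont2_bounded cf.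
apply: (@bounded_intO _ M); first exact: cont2_measurable measurable_Omega cf.
by move=> [x y] /OmegaP [/andP[? ?] /andP[? ?]]; apply: fM; rewrite !ltW.
Qed.

Lemma JD f g : intO f -> intO g -> J (fun x => f x + g x) = J f + J g.
Proof. by move=> *; rewrite /J RintegralD //; exact: measurable_Omega. Qed.

Lemma JB f g : intO f -> intO g -> J (fun x => f x - g x) = J f - J g.
Proof. by move=> *; rewrite /J RintegralB //; exact: measurable_Omega. Qed.

Lemma JZ c f : intO f -> J (fun x => c * f x) = c * J f.
Proof. by move=> *; rewrite /J RintegralZl //; exact: measurable_Omega. Qed.

Lemma J_le f g : intO f -> intO g -> (forall x, Omega x -> f x <= g x) -> J f <= J g.
Proof. by move=> *; apply: le_Rintegral => //; exact: measurable_Omega. Qed.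

Lemma J_ge0 f : (forall x, Omega x -> 0 <= f x) -> 0 <= J f.
Proof. by move=> *; apply: Rintegral_ge0. Qed.

Lemma eq_J f g : (forall x, Omega x -> f x = g x) -> J f = J g.
Proof. by move=> fg; apply: eq_Rintegral => x; rewrite inE; exact: fg. Qed.

Lemma intO_D f g : intO f -> intO g -> intO (fun x => f x + g x).
Proof. by move=> hf hg; have := integrableD measurable_Omega hf hg. Qed.

Lemma intO_B f g : intO f -> intO g -> intO (fun x => f x - g x).
Proof. by move=> hf hg; have := integrableB measurable_Omega hf hg. Qed.

Lemma intO_Z c f : intO f -> intO (fun x => c * f x).
Proof. by move=> hf; have := integrableZl measurable_Omega c hf. Qed.

Lemma J_norm f : intO f -> `|J f| <= J (fun x => `|f x|).
Proof. by move=> hf; apply: (le_normr_Rintegral _ hf); exact: measurable_Omega. Qed.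

Lemma J_cst c : J (fun=> c) = c.
Proof.
by rewrite /J Rintegral_cst ?leb2_Omega ?mulr1 //; exact: measurable_Omega.
Qed.

Definition slice_int f (x : R) : R := I01 (fun y => f (x, y)).

Lemma fine_I01 (e : R -> \bar R) : mu.-integrable setT (e \_ `]0, 1[ : T -> \bar R) ->
  int01 (fine \o e) /\ fine (\int[mu]_x (e \_ `]0%R, 1%R[) x)%E = I01 (fine \o e).
Proof.
move=> Ie'.
have Ie : mu.-integrable `]0, 1[ (e : T -> \bar R).
  by rewrite -(setTI `]0, 1[%classic); apply/integrable_restrict.
have me : measurable_fun (`]0, 1[%classic : set T) (EFin \o (fine \o e) : T -> \bar R).
  apply/measurable_EFinP; apply: measurableT_comp; first exact: fine_measurable.
  exact: (measurable_int mu Ie).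
split.
  apply: (le_integrable _ me _ Ie) => // x _ /=.
  by case: (e (x : R)) => [r| |] /=; rewrite ?lexx ?normr0 ?leey.
rewrite -integral_mkcond /I01 /Rintegral; congr fine.
apply: ae_eq_integral => //; first exact: (measurable_int mu Ie).
have m01 : measurable (`]0:R, 1:R[%classic : set T) by exact: measurable_itv.
have := integrable_ae m01 Ie.
apply: filterS => x /= H x01; by rewrite fineK // H.
Qed.

Section Fubini.
Variables (f : R * R -> R) (If : intO f).
Let g : T * T -> \bar R := (EFin \o f) \_ (@Omega R).

Let Ig : (leb2 R).-integrable setT g.
Proof. by apply/integrable_restrict; rewrite ?setTI //; exact: measurable_Omega. Qed.

Let gF : fubini_F mu g =
  (fun x => \int[mu]_(y in `]0%R, 1%R[) (f (x, y))%:E)%E \_ `]0, 1[.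
Proof.
apply/funext => x; rewrite /fubini_F [RHS]/patch; case: ifPn => [|xN].
  move=> /set_mem /= x01; rewrite [RHS]integral_mkcond; apply: eq_integral => y _.
  rewrite /g /patch /=.
  suff -> : ((x, y) \in @Omega R) = (y \in `]0%R, 1%R[%classic) by [].
  by apply/idP/idP => [/set_mem [] /= _ h|/set_mem h]; apply/mem_set => //; split.
apply: integral0_eq => y _; rewrite /g /patch ifF //.
by apply/negbTE; apply: contra xN; rewrite !inE => -[].
Qed.

Let gG : fubini_G mu g =
  (fun y => \int[mu]_(x in `]0%R, 1%R[) (f (x, y))%:E)%E \_ `]0, 1[.
Proof.
apply/funext => y; rewrite /fubini_G [RHS]/patch; case: ifPn => [|xN].
  move=> /set_mem /= x01; rewrite [RHS]integral_mkcond; apply: eq_integral => x _.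
  rewrite /g /patch /=.
  suff -> : ((x, y) \in @Omega R) = (x \in `]0%R, 1%R[%classic) by [].
  by apply/idP/idP => [/set_mem [] /= h _|/set_mem h]; apply/mem_set => //; split.
apply: integral0_eq => x _; rewrite /g /patch ifF //.
by apply/negbTE; apply: contra xN; rewrite !inE => -[].
Qed.

Lemma J_fubini : int01 (slice_int f) /\ J f = I01 (slice_int f).
Proof.
have IF := integrable_fubini_F Ig; rewrite gF in IF.
have [h1 h2] := fine_I01 IF; split => //; rewrite -[RHS]h2.
by rewrite -gF (integral12_prod_meas1 Ig) -integral_mkcond.
Qed.

Lemma J_fubini' : J f = I01 (fun y => I01 (fun x => f (x, y))).
Proof.
have IG : mu.-integrable setT (fubini_G mu g).
  apply/integrableP; split; first exact: measurable_fubini_G Ig.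
  apply: (@le_lt_trans _ _ (\int[mu]_y \int[mu]_x `|g (x, y)|)%E); last first.
    by apply/(integrable21ltyP _ _ (measurable_int _ Ig)).
  apply: ge0_le_integral => //.
  - by apply: measurableT_comp => //; exact: measurable_fubini_G Ig.
  - apply: (measurable_fun_fubini_tonelli_G (abse \o g)).
      by apply: measurableT_comp => //; exact: (measurable_int _ Ig).
    by move=> z; exact: abse_ge0.
  - move=> y _; apply: le_abse_integral => //.
    by apply: (measurableT_comp (measurable_int _ Ig)); exact: pair2_measurable.
rewrite gG in IG; have [_ h2] := fine_I01 IG; rewrite -[RHS]h2.
by rewrite -gG (integral21_prod_meas1 Ig) -integral_mkcond.
Qed.

End Fubini.

End TwoVar.

(** * Partial derivatives *)

Section Derivatives.
Variable R : realType.

Lemma is_derive_epsP (V : normedModType R) (f : V -> R) a v (d : R) :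
  is_derive a v f d <-> forall e, 0 < e -> exists2 r, 0 < r &
    forall h : R, `|h| < r -> `|f (h *: v + a) - f a - h * d| <= e * `|h|.
Proof.
split=> [df e e0|H].
  have df1 : h^-1 *: (f (h *: v + a) - f a) @[h --> 0^'] --> d.
    by have [dfa <-] := df; exact: dfa.
  have /cvgrPdist_le /(_ e e0) := df1.
  move=> /nbhs_ballP [r /= r0 rP]; exists r => // h hr.
  have [->|h0] := eqVneq h 0.
    by rewrite scale0r add0r subrr mul0r subr0 normr0 mulr0.
  have := rP h; rewrite /ball /= sub0r normrN => /(_ hr h0) H.
  have -> : f (h *: v + a) - f a - h * d =
      - h * (d - h^-1 *: (f (h *: v + a) - f a)).
    by rewrite /GRing.scale /=; field.
  by rewrite normrM normrN mulrC ler_wpM2r.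
have C : h^-1 *: (f (h *: v + a) - f a) @[h --> 0^'] --> d.
  apply/cvgrPdist_le => e e0; have [r r0 rP] := H e e0.
  apply/nbhs_ballP; exists r => //= h; rewrite /ball /= sub0r normrN => hr h0.
  have -> : d - h^-1 *: (f (h *: v + a) - f a) =
      - h^-1 * (f (h *: v + a) - f a - h * d).
    by rewrite /GRing.scale /=; field.
  rewrite normrM normrN normfV mulrC ler_pdivrMr ?normr_gt0 //; exact: rP.
by split; [apply/cvg_ex; exists d|apply: cvg_lim].
Qed.

Lemma is_derive1_epsP (F : R -> R) (x d : R) :
  is_derive x (1:R) F d <-> forall e, 0 < e -> exists2 r, 0 < r &
    forall h : R, `|h| < r -> `|F (x + h) - F x - h * d| <= e * `|h|.
Proof.
have E h : h *: (1:R) + x = x + h by rewrite /GRing.scale /= mulr1 addrC.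
rewrite is_derive_epsP; split=> H e /H [r r0 rP]; exists r => // h /rP;
  by rewrite E.
Qed.

Lemma MVT_incr (F F' : R -> R) (x h : R) : (forall t : R, is_derive t (1:R) F (F' t)) ->
  exists2 c, `|c - x| <= `|h| & F (x + h) - F x = h * F' c.
Proof.
move=> dF; have cF := derive_continuous dF.
have [h0|h0] := leP 0 h.
  have xh : x <= x + h by rewrite lerDl.
  have [c] := @MVT_segment R F F' x (x + h) xh (fun t _ => dF t) (continuous_subspaceT cF).
  rewrite in_itv /= => /andP[c1 c2] ->; exists c; last by ring.
  by rewrite !ger0_norm ?subr_ge0 //; lra.
have xh : x + h <= x by rewrite gerDl ltW.
have [c] := @MVT_segment R F F' (x + h) x xh (fun t _ => dF t) (continuous_subspaceT cF).
rewrite in_itv /= => /andP[c1 c2] E; exists c; last by rewrite -opprB E; ring.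
by rewrite ler0_norm ?subr_le0 // ltr0_norm //; lra.
Qed.

Implicit Types (f g : R * R -> R).

Definition pder (j : bool) f f' := forall x : R * R, is_derive x (dir R j) f (f' x).

Definition pD (j : bool) f : R * R -> R :=
  locked (fun x : R * R => 'D_(dir R j) f x).

Lemma pDE j f : (fun x : R * R => 'D_(dir R j) f x) = pD j f.
Proof. by rewrite /pD -lock. Qed.

Lemma pderE j f f' : pder j f f' -> pD j f = f'.
Proof. by move=> df; rewrite -pDE; apply/funext => x; have [_ <-] := df x. Qed.

Lemma dir1E (h x y : R) : h *: dir R false + (x, y) = (x + h, y).
Proof.
apply/eqP; rewrite xpair_eqE /= /GRing.scale /=.
by rewrite mulr1 mulr0 add0r addrC !eqxx.
Qed.

Lemma dir2E (h x y : R) : h *: dir R true + (x, y) = (x, y + h).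
Proof.
apply/eqP; rewrite xpair_eqE /= /GRing.scale /=.
by rewrite mulr1 mulr0 add0r addrC !eqxx.
Qed.

Lemma pder1P f f' : pder false f f' <->
  forall x y : R, is_derive x (1:R) (fun t => f (t, y)) (f' (x, y)).
Proof.
split=> [H x y|H [x y]].
  apply/is_derive1_epsP => e e0.
  have /is_derive_epsP /(_ e e0) [r r0 rP] := H (x, y).
  by exists r => // h /rP; rewrite dir1E.
apply/is_derive_epsP => e e0.
have /is_derive1_epsP /(_ e e0) [r r0 rP] := H x y.
by exists r => // h /rP; rewrite dir1E.
Qed.

Lemma pder2P f f' : pder true f f' <->
  forall x y : R, is_derive y (1:R) (fun t => f (x, t)) (f' (x, y)).
Proof.
split=> [H x y|H [x y]].
  apply/is_derive1_epsP => e e0.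
  have /is_derive_epsP /(_ e e0) [r r0 rP] := H (x, y).
  by exists r => // h /rP; rewrite dir2E.
apply/is_derive_epsP => e e0.
have /is_derive1_epsP /(_ e e0) [r r0 rP] := H x y.
by exists r => // h /rP; rewrite dir2E.
Qed.

Lemma pder_eqr j f f' g' : pder j f f' -> (forall x, f' x = g' x) -> pder j f g'.
Proof. by move=> df E x; rewrite -E. Qed.

Lemma pder_cst j (c : R) : pder j (fun=> c) (fun=> 0).
Proof. move=> x; exact: is_derive_cst. Qed.

Lemma pder_add j f f' g g' : pder j f f' -> pder j g g' ->
  pder j (fun x => f x + g x) (fun x => f' x + g' x).
Proof. by move=> df dg x; apply: is_deriveD. Qed.

Lemma pder_mul j f f' g g' : pder j f f' -> pder j g g' ->
  pder j (fun x => f x * g x) (fun x => f' x * g x + f x * g' x).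
Proof.
move=> df dg x; have := is_deriveM (df x) (dg x).
by rewrite /GRing.scale /= addrC [g x * _]mulrC.
Qed.

Lemma cont_add2 f g : continuous f -> continuous g -> continuous (fun x => f x + g x).
Proof. by move=> cf cg x; apply: continuousD; [exact: cf|exact: cg]. Qed.

Lemma cont_sub2 f g : continuous f -> continuous g -> continuous (fun x => f x - g x).
Proof. by move=> cf cg x; apply: continuousB; [exact: cf|exact: cg]. Qed.

Lemma cont_mul2 f g : continuous f -> continuous g -> continuous (fun x => f x * g x).
Proof. by move=> cf cg x; apply: continuousM; [exact: cf|exact: cg]. Qed.

Lemma cont_fst (b : R -> R) : continuous b -> continuous (fun x : R * R => b x.1).
Proof. by move=> cb x; apply: (@continuous_comp _ _ _ fst b); [exact: cvg_fst|exact: cb]. Qed.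

Lemma cont_snd (b : R -> R) : continuous b -> continuous (fun x : R * R => b x.2).
Proof. by move=> cb x; apply: (@continuous_comp _ _ _ snd b); [exact: cvg_snd|exact: cb]. Qed.

Lemma cont_pair f (u v : R * R -> R) : continuous f -> continuous u -> continuous v ->
  continuous (fun x => f (u x, v x)).
Proof.
move=> cf cu cv x; apply: (@continuous2_cvg _ _ _ _ _ _ u v (fun a b => f (a, b))).
- by have := cf (u x, v x); rewrite (_ : (fun z : R * R => f (z.1, z.2)) = f) //; apply/funext => -[].
- exact: cu.
- exact: cv.
Qed.

Lemma cont_slice1 f y : continuous f -> continuous (fun t : R => f (t, y)).
Proof.
move=> cf x; apply: (@continuous2_cvg _ _ _ _ _ _ id (fun=> y) (fun a b => f (a, b))).
- by have := cf (x, y); rewrite (_ : (fun z : R * R => f (z.1, z.2)) = f) //; apply/funext => -[].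
- exact: cvg_id.
- exact: cvg_cst.
Qed.

Lemma cont_slice2 f x : continuous f -> continuous (fun t : R => f (x, t)).
Proof.
move=> cf y; apply: (@continuous2_cvg _ _ _ _ _ _ (fun=> x) id (fun a b => f (a, b))).
- by have := cf (x, y); rewrite (_ : (fun z : R * R => f (z.1, z.2)) = f) //; apply/funext => -[].
- exact: cvg_cst.
- exact: cvg_id.
Qed.

Lemma cont_epsP f (x y : R) : {for (x, y), continuous f} <->
  forall e, 0 < e -> exists2 r, 0 < r &
    forall u v, `|u - x| < r -> `|v - y| < r -> `|f (u, v) - f (x, y)| <= e.
Proof.
split=> [/cvgrPdist_le H e /H|H].
  move=> [[P Q] /= [/nbhs_ballP [r1 /= r10 rP1] /nbhs_ballP [r2 /= r20 rP2]] PQ].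
  exists (Num.min r1 r2); first by rewrite lt_min r10.
  move=> u v; rewrite !lt_min => /andP[u1 u2] /andP[v1 v2].
  rewrite distrC; apply: (PQ (u, v)); split; [apply: rP1|apply: rP2];
    by rewrite /ball /= distrC.
apply/cvgrPdist_le => e /H [r r0 rP].
exists (ball x r, ball y r); first by split; exact: nbhsx_ballx.
move=> [u v] /= [h1 h2]; rewrite distrC; apply: rP; rewrite distrC; [exact: h1|exact: h2].
Qed.

Definition shear (A : R -> R) f : R * R -> R := fun x => f (x.1, x.2 + A x.1).

Lemma pder2_shear A f f2 : pder true f f2 -> pder true (shear A f) (shear A f2).
Proof.
move=> /pder2P df; apply/pder2P => x y; rewrite /shear /=.
exact: (@derive_shift _ (fun t => f (x, t)) (fun t => f2 (x, t)) (A x) (df x) y).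
Qed.

(** The increment in the first variable is treated by the mean value theorem
    at height y + A (x + h), the change of height by the chain rule; thus only
    the first partial derivative has to be continuous. *)
Lemma pder1_shear A A' f f1 f2 : continuous f1 -> pder false f f1 -> pder true f f2 ->
  (forall x : R, is_derive x (1:R) A (A' x)) ->
  pder false (shear A f) (fun x => shear A f1 x + A' x.1 * shear A f2 x).
Proof.
move=> cf1 /pder1P df1 /pder2P df2 dA; apply/pder1P => x y; rewrite /shear /=.
set p := y + A x; apply/is_derive1_epsP => e e0.
have e20 : 0 < e / 2 by rewrite divr_gt0.
have d2 : is_derive x (1:R) (fun t => f (x, y + A t)) (A' x * f2 (x, p)).
  have dyA := dD (dcst y x) (dA x); rewrite add0r in dyA.
  by rewrite mulrC; exact: (@dcomp _ (fun t => f (x, t)) (fun t => y + A t) _ _ _ (df2 x p) dyA).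
have /is_derive1_epsP /(_ _ e20) [r1 r10 r1P] := d2.
have /cont_epsP /(_ _ e20) [r2 r20 r2P] := cf1 (x, p).
have cA : continuous A := derive_continuous dA.
have /cvgrPdist_lt /(_ _ r20) := cA x.
move=> /nbhs_ballP [r3 /= r30 r3P].
exists (Num.min r1 (Num.min r2 r3)); first by rewrite !lt_min r10 r20 r30.
move=> h; rewrite !lt_min => /andP[h1 /andP[h2 h3]].
have [c cx E] := @MVT_incr (fun t => f (t, y + A (x + h))) (fun t => f1 (t, y + A (x + h))) x h (fun t => df1 t _).
have -> : f (x + h, y + A (x + h)) - f (x, p) - h * (f1 (x, p) + A' x * f2 (x, p)) =
   h * (f1 (c, y + A (x + h)) - f1 (x, p)) +
   (f (x, y + A (x + h)) - f (x, p) - h * (A' x * f2 (x, p))).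
  by rewrite mulrBr -E; ring.
apply: (le_trans (ler_normD _ _)).
have -> : e * `|h| = `|h| * (e / 2) + e / 2 * `|h| by field.
apply: lerD; last exact: r1P.
rewrite normrM ler_wpM2l //; apply: r2P; first exact: le_lt_trans cx h2.
rewrite /p opprD addrACA subrr add0r distrC; apply: r3P.
by rewrite /ball /= opprD addNKr normrN.
Qed.

Lemma cont_shear A f : continuous A -> continuous f -> continuous (shear A f).
Proof.
move=> cA cf; apply: cont_pair => //; first by move=> x; exact: cvg_fst.
apply: cont_add2; first by move=> x; exact: cvg_snd.
exact: cont_fst.
Qed.

(** Schwarz's theorem: by the mean value theorem the second difference over a
    square of side r is r^2 times either mixed derivative at some point of the
    square. *)
Lemma pder_comm f f1 f2 f12 f21 : pder false f f1 -> pder true f f2 ->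
  pder true f1 f12 -> pder false f2 f21 -> continuous f12 -> continuous f21 ->
  f12 = f21.
Proof.
move=> /pder1P d1 /pder2P d2 /pder2P d12 /pder1P d21 c12 c21.
apply/funext => -[x y].
apply/eqP; rewrite -subr_eq0 -normr_le0; apply/ler_addgt0Pl => e e0; rewrite addr0.
have e20 : 0 < e / 2 by rewrite divr_gt0.
have /cont_epsP /(_ _ e20) [r1 r10 r1P] := c12 (x, y).
have /cont_epsP /(_ _ e20) [r2 r20 r2P] := c21 (x, y).
(* Half of the minimum, so that the closed square of side r lies in both
   neighbourhoods. *)
pose r := Num.min r1 r2 / 2.
have m0 : 0 < Num.min r1 r2 by rewrite lt_min r10.
have r0 : 0 < r by rewrite divr_gt0.
have rr : r < r1 /\ r < r2.
  have : r < Num.min r1 r2 by rewrite /r; lra.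
  by rewrite lt_min => /andP.
have [c cx E1] := @MVT_incr (fun t => f (t, y + r) - f (t, y)) (fun t => f1 (t, y + r) - f1 (t, y)) x r
  (fun t => dB (d1 t (y + r)) (d1 t y)).
have [c' cy E2] := @MVT_incr (fun t => f1 (c, t)) (fun t => f12 (c, t)) y r (d12 c).
have [d dy E3] := @MVT_incr (fun t => f (x + r, t) - f (x, t)) (fun t => f2 (x + r, t) - f2 (x, t)) y r
  (fun t => dB (d2 (x + r) t) (d2 x t)).
have [d' dx E4] := @MVT_incr (fun t => f2 (t, d)) (fun t => f21 (t, d)) x r (fun t => d21 t d).
have E : f12 (c, c') = f21 (d', d).
  have : r * (r * f12 (c, c')) = r * (r * f21 (d', d)).
    by rewrite -E2 -E1 -E4 -E3; ring.
  by move=> /(mulfI (lt0r_neq0 r0)) /(mulfI (lt0r_neq0 r0)).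
have nr : `|r| = r by rewrite gtr0_norm.
have H1 : `|f12 (c, c') - f12 (x, y)| <= e / 2.
  by apply: r1P; apply: le_lt_trans; [exact: cx|rewrite nr; by case: rr|exact: cy|rewrite nr; by case: rr].
have H2 : `|f21 (d', d) - f21 (x, y)| <= e / 2.
  by apply: r2P; apply: le_lt_trans; [exact: dx|rewrite nr; by case: rr|exact: dy|rewrite nr; by case: rr].
have -> : f12 (x, y) - f21 (x, y) = (f21 (d', d) - f21 (x, y)) - (f12 (c, c') - f12 (x, y)).
  by rewrite E; ring.
apply: (le_trans (ler_normB _ _)); lra.
Qed.

End Derivatives.

Arguments cont_slice1 {R f} y _.
Arguments cont_slice2 {R f} x _.

Ltac gen_pD := repeat match goal with
  |- context [@pD ?R ?j ?f ?x] => generalize (@pD R j f x) end; intros.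

(** * Smooth and quasi-periodic functions *)

Section Smooth.
Variable R : realType.

Fixpoint dC (n : nat) (b : R -> R) : Prop :=
  if n is n'.+1 then
    continuous b /\ exists2 b', (forall x : R, is_derive x (1:R) b (b' x)) & dC n' b'
  else continuous b.

Record Cinf1 b : Prop := Cinf1I { Cinf1_Cn : forall n, dC n b }.

Lemma dC_cont n b : dC n b -> continuous b.
Proof. by case: n => [|n] //= []. Qed.

Lemma dCS n b b' : (forall x : R, is_derive x (1:R) b (b' x)) -> dC n b' -> dC n.+1 b.
Proof. by move=> db h; split; [exact: derive_continuous db|exists b']. Qed.

Lemma derive_unique (b b' b'' : R -> R) : (forall x : R, is_derive x (1:R) b (b' x)) ->
  (forall x : R, is_derive x (1:R) b (b'' x)) -> b' = b''.
Proof. by move=> h1 h2; apply/funext => x; have [_ <-] := h1 x; have [_ <-] := h2 x. Qed.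

Lemma Cinf1_D b : Cinf1 b -> exists2 b', (forall x : R, is_derive x (1:R) b (b' x)) & Cinf1 b'.
Proof.
move=> sb; have [_ [b' db _]] := Cinf1_Cn sb 1%N; exists b' => //; split=> n.
by have [_ [b'' db' +]] := Cinf1_Cn sb n.+1; rewrite (derive_unique db db').
Qed.

(** This spares the computation of higher derivatives for families such as the
    multiples of one exponential, which contain the derivatives of their
    members. *)
Lemma Cinf1_coind (P : (R -> R) -> Prop) :
  (forall b, P b -> exists2 b', (forall x : R, is_derive x (1:R) b (b' x)) & P b') ->
  forall b, P b -> Cinf1 b.
Proof.
move=> H b Pb; split=> n; elim: n b Pb => [|n IH] b /H [b' db Pb'].
  exact: derive_continuous db.
by apply: (dCS db); exact: IH.
Qed.

Lemma dC_le n b : dC n.+1 b -> dC n b.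
Proof.
elim: n b => [|n IH] b; first by case.
by move=> [cb [b' db h]]; split => //; exists b' => //; exact: IH.
Qed.

Lemma dC_add n b1 b2 : dC n b1 -> dC n b2 -> dC n (fun x => b1 x + b2 x).
Proof.
elim: n b1 b2 => [|n IH] b1 b2.
  by move=> c1 c2 x; apply: continuousD; [exact: c1|exact: c2].
move=> [c1 [b1' d1 h1]] [c2 [b2' d2 h2]].
exact: (@dCS _ _ (fun x => b1' x + b2' x) (fun x => dD (d1 x) (d2 x)) (IH _ _ h1 h2)).
Qed.

Lemma dC_mul n b1 b2 : dC n b1 -> dC n b2 -> dC n (fun x => b1 x * b2 x).
Proof.
elim: n b1 b2 => [|n IH] b1 b2.
  by move=> c1 c2 x; apply: continuousM; [exact: c1|exact: c2].
move=> h1' h2'; have [c1 [b1' d1 h1]] := h1'; have [c2 [b2' d2 h2]] := h2'.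
apply: (@dCS _ _ (fun x => b1' x * b2 x + b1 x * b2' x) (fun x => dM (d1 x) (d2 x))).
by apply: dC_add; apply: IH => //; exact: dC_le.
Qed.

Lemma Cinf1_cst (c : R) : Cinf1 (fun=> c).
Proof.
apply: (@Cinf1_coind (fun b => exists c, b = fun=> c)); last by exists c.
by move=> _ [d ->]; exists (fun=> 0); [move=> x; exact: dcst|exists 0].
Qed.

Lemma Cinf1_mul b1 b2 : Cinf1 b1 -> Cinf1 b2 -> Cinf1 (fun x => b1 x * b2 x).
Proof. by move=> [h1] [h2]; split=> n; exact: dC_mul. Qed.

Lemma Cinf1_add b1 b2 : Cinf1 b1 -> Cinf1 b2 -> Cinf1 (fun x => b1 x + b2 x).
Proof. by move=> [h1] [h2]; split=> n; exact: dC_add. Qed.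

Lemma Cinf1_opp b : Cinf1 b -> Cinf1 (fun x => - b x).
Proof.
move=> h; rewrite (_ : (fun x => - b x) = fun x => -1 * b x); last first.
  by apply/funext => x; rewrite mulN1r.
by apply: Cinf1_mul => //; exact: Cinf1_cst.
Qed.

Lemma dexp (c x : R) : is_derive x (1:R) (fun t => expR (c * t)) (c * expR (c * x)).
Proof.
have dc : is_derive x (1:R) (fun t => c * t) c by have := dZ c (did x); rewrite mulr1.
by rewrite mulrC; exact: (@dcomp _ expR (fun t => c * t) _ _ _ (is_derive_expR _) dc).
Qed.

Lemma dcos (c d x : R) : is_derive x (1:R) (fun t => cos (c * t + d)) (- c * sin (c * x + d)).
Proof.
have dc : is_derive x (1:R) (fun t => c * t + d) c.
  by have := dD (dZ c (did x)) (dcst d x); rewrite mulr1 addr0.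
have -> : - c * sin (c * x + d) = - sin (c * x + d) * c by ring.
exact: (@dcomp _ cos (fun t => c * t + d) _ _ _ (is_derive_cos _) dc).
Qed.

Lemma dsin (c d x : R) : is_derive x (1:R) (fun t => sin (c * t + d)) (c * cos (c * x + d)).
Proof.
have dc : is_derive x (1:R) (fun t => c * t + d) c.
  by have := dD (dZ c (did x)) (dcst d x); rewrite mulr1 addr0.
rewrite mulrC.
exact: (@dcomp _ sin (fun t => c * t + d) _ _ _ (is_derive_sin _) dc).
Qed.

Lemma Cinf1_exp (c : R) : Cinf1 (fun x => expR (c * x)).
Proof.
apply: (@Cinf1_coind (fun b => exists d, b = fun x => d * expR (c * x))).
  move=> _ [d ->]; exists (fun x => (d * c) * expR (c * x)); last by exists (d * c).
  by move=> x; rewrite -mulrA; apply: dZ; exact: dexp.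
by exists 1; apply/funext => x; rewrite mul1r.
Qed.

Lemma Cinf1_trig (p q c d : R) : Cinf1 (fun x => p * cos (c * x + d) + q * sin (c * x + d)).
Proof.
apply: (@Cinf1_coind (fun b => exists p q, b = fun x => p * cos (c * x + d) + q * sin (c * x + d))); last by exists p, q.
move=> _ [p' [q' ->]].
exists (fun x => (q' * c) * cos (c * x + d) + (- p' * c) * sin (c * x + d)); last by do 2 eexists.
move=> x; have := dD (dZ p' (dcos c d x)) (dZ q' (dsin c d x)).
by rewrite (_ : (q' * c) * _ + _ = p' * (- c * sin (c * x + d)) + q' * (c * cos (c * x + d))) //; ring.
Qed.

Lemma Cinf1_cos (c d : R) : Cinf1 (fun x => cos (c * x + d)).
Proof.
have := Cinf1_trig 1 0 c d; congr Cinf1; apply/funext => x.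
by rewrite mul1r mul0r addr0.
Qed.

Lemma Cinf1_sin (c d : R) : Cinf1 (fun x => sin (c * x + d)).
Proof.
have := Cinf1_trig 0 1 c d; congr Cinf1; apply/funext => x.
by rewrite mul1r mul0r add0r.
Qed.

Implicit Types (f g : R * R -> R).

Fixpoint rC (n : nat) f : Prop :=
  if n is n'.+1 then
    continuous f /\ forall j, exists2 f', pder j f f' & rC n' f'
  else continuous f.

Record Cinf2 f : Prop := Cinf2I { Cinf2_Cn : forall n, rC n f }.

Lemma rC_cont n f : rC n f -> continuous f.
Proof. by case: n => [|n] //= []. Qed.

Lemma Cinf2_cont f : Cinf2 f -> continuous f.
Proof. by move=> [/(_ 0%N)]. Qed.

Lemma pder_unique j f f' f'' : pder j f f' -> pder j f f'' -> f' = f''.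
Proof. by move=> /pderE <- /pderE. Qed.

Lemma Cinf2_D f : Cinf2 f -> forall j, pder j f (pD j f) /\ Cinf2 (pD j f).
Proof.
move=> sf j; have [_ /(_ j) [f' df _]] := Cinf2_Cn sf 1%N; rewrite (pderE df).
split => //; split=> n; have [_ /(_ j) [f'' df' +]] := Cinf2_Cn sf n.+1;
by rewrite (pder_unique df df').
Qed.

Lemma Cinf2_pD j f : Cinf2 f -> Cinf2 (pD j f).
Proof. by move=> /Cinf2_D/(_ j)[]. Qed.

Lemma Cinf2_pder j f : Cinf2 f -> pder j f (pD j f).
Proof. by move=> /Cinf2_D/(_ j)[]. Qed.

Lemma Cinf2_coind (P : (R * R -> R) -> Prop) :
  (forall f, P f -> continuous f) ->
  (forall f, P f -> forall j, exists2 f', pder j f f' & P f') ->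
  forall f, P f -> Cinf2 f.
Proof.
move=> C H f Pf; split=> n; elim: n f Pf => [|n IH] f Pf; first exact: C.
split; first exact: C.
by move=> j; have [f' df Pf'] := H f Pf j; exists f' => //; exact: IH.
Qed.

Lemma rC_le n f : rC n.+1 f -> rC n f.
Proof.
elim: n f => [|n IH] f; first by case.
by move=> [cb H]; split => // j; have [f' df h] := H j; exists f' => //; exact: IH.
Qed.

Lemma rC_add n f g : rC n f -> rC n g -> rC n (fun x => f x + g x).
Proof.
elim: n f g => [|n IH] f g; first exact: cont_add2.
move=> [cf Hf] [cg Hg]; split; first exact: cont_add2.
move=> j; have [f' df hf] := Hf j; have [g' dg hg] := Hg j.
by exists (fun x => f' x + g' x); [exact: pder_add|exact: IH].
Qed.

Lemma rC_mul n f g : rC n f -> rC n g -> rC n (fun x => f x * g x).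
Proof.
elim: n f g => [|n IH] f g; first exact: cont_mul2.
move=> rf rg; have [cf Hf] := rf; have [cg Hg] := rg; split; first exact: cont_mul2.
move=> j; have [f' df hf] := Hf j; have [g' dg hg] := Hg j.
exists (fun x => f' x * g x + f x * g' x); first exact: pder_mul.
by apply: rC_add; apply: IH => //; exact: rC_le.
Qed.

Lemma Cinf2_cst (c : R) : Cinf2 (fun=> c).
Proof.
apply: (@Cinf2_coind (fun f => exists c, f = fun=> c)); last by exists c.
  by move=> _ [d ->] x; exact: cvg_cst.
by move=> _ [d ->] j; exists (fun=> 0); [exact: pder_cst|exists 0].
Qed.

Lemma pder1_fst (b b' : R -> R) : (forall x : R, is_derive x (1:R) b (b' x)) ->
  pder false (fun x => b x.1) (fun x => b' x.1).
Proof. by move=> db; apply/pder1P => x y; exact: db. Qed.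

Lemma pder2_fst (b : R -> R) : pder true (fun x => b x.1) (fun=> 0).
Proof. by apply/pder2P => x y; exact: (dcst (b x) y). Qed.

Lemma pder2_snd (b b' : R -> R) : (forall x : R, is_derive x (1:R) b (b' x)) ->
  pder true (fun x => b x.2) (fun x => b' x.2).
Proof. by move=> db; apply/pder2P => x y; exact: db. Qed.

Lemma pder1_snd (b : R -> R) : pder false (fun x => b x.2) (fun=> 0).
Proof. by apply/pder1P => x y; exact: (dcst (b y) x). Qed.

Lemma rC_fst n b : dC n b -> rC n (fun x => b x.1).
Proof.
elim: n b => [|n IH] b; first exact: cont_fst.
move=> [cb [b' db h]]; split; first exact: cont_fst.
case; first by exists (fun=> 0); [exact: pder2_fst|case: (Cinf2_cst 0)].
by exists (fun x => b' x.1); [exact: pder1_fst|exact: IH].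
Qed.

Lemma rC_snd n b : dC n b -> rC n (fun x => b x.2).
Proof.
elim: n b => [|n IH] b; first exact: cont_snd.
move=> [cb [b' db h]]; split; first exact: cont_snd.
case; last by exists (fun=> 0); [exact: pder1_snd|case: (Cinf2_cst 0)].
by exists (fun x => b' x.2); [exact: pder2_snd|exact: IH].
Qed.

Lemma rC_shear n A f : dC n A -> rC n f -> rC n (shear A f).
Proof.
elim: n A f => [|n IH] A f; first exact: cont_shear.
move=> dA' [cf H]; have [cA [A' dA h]] := dA'; split; first exact: cont_shear.
have [f1 d1 h1] := H false; have [f2 d2 h2] := H true; case.
  exists (shear A f2); first exact: pder2_shear.
  by apply: IH => //; exact: dC_le.
exists (fun x => shear A f1 x + A' x.1 * shear A f2 x).
  by apply: pder1_shear => //; exact: rC_cont h1.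
apply: rC_add; first by apply: IH => //; exact: dC_le.
apply: (@rC_mul _ (fun x => A' x.1)); first exact: rC_fst.
by apply: IH => //; exact: dC_le.
Qed.

Lemma Cinf2_add f g : Cinf2 f -> Cinf2 g -> Cinf2 (fun x => f x + g x).
Proof. by move=> [hf] [hg]; split=> n; exact: rC_add. Qed.

Lemma Cinf2_mul f g : Cinf2 f -> Cinf2 g -> Cinf2 (fun x => f x * g x).
Proof. by move=> [hf] [hg]; split=> n; exact: rC_mul. Qed.

Lemma Cinf2_fst b : Cinf1 b -> Cinf2 (fun x => b x.1).
Proof. by move=> [h]; split=> n; exact: rC_fst. Qed.

Lemma Cinf2_snd b : Cinf1 b -> Cinf2 (fun x => b x.2).
Proof. by move=> [h]; split=> n; exact: rC_snd. Qed.

Lemma Cinf2_shear A f : Cinf1 A -> Cinf2 f -> Cinf2 (shear A f).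
Proof. by move=> [hA] [hf]; split=> n; exact: rC_shear. Qed.

Lemma Cinf2_scale c f : Cinf2 f -> Cinf2 (fun x => c * f x).
Proof. by move=> hf; apply: Cinf2_mul => //; exact: Cinf2_cst. Qed.

Lemma pD_add j f g : Cinf2 f -> Cinf2 g ->
  pD j (fun x => f x + g x) = fun x => pD j f x + pD j g x.
Proof. by move=> hf hg; apply: pderE; apply: pder_add; exact: Cinf2_pder. Qed.

Lemma pD_mul j f g : Cinf2 f -> Cinf2 g ->
  pD j (fun x => f x * g x) = fun x => pD j f x * g x + f x * pD j g x.
Proof. by move=> hf hg; apply: pderE; apply: pder_mul; exact: Cinf2_pder. Qed.

Lemma pD_cst j (c : R) : pD j (fun _ : R * R => c) = fun=> 0.
Proof. by apply: pderE; exact: pder_cst. Qed.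

Lemma pD_scale j c f : Cinf2 f -> pD j (fun x => c * f x) = fun x => c * pD j f x.
Proof.
move=> hf; rewrite pD_mul //; last exact: Cinf2_cst.
by rewrite pD_cst; apply/funext => x; rewrite mul0r add0r.
Qed.

Lemma pD_comm f j k : Cinf2 f -> pD j (pD k f) = pD k (pD j f).
Proof.
move=> hf.
have E : pD true (pD false f) = pD false (pD true f).
  have h1 := Cinf2_pD false hf; have h2 := Cinf2_pD true hf.
  exact: (pder_comm (Cinf2_pder false hf) (Cinf2_pder true hf) (Cinf2_pder true h1)
    (Cinf2_pder false h2) (Cinf2_cont (Cinf2_pD true h1)) (Cinf2_cont (Cinf2_pD false h2))).
by case: j; case: k; [reflexivity|exact: E|exact: (esym E)|reflexivity].
Qed.

Definition pDs (s : seq bool) f := foldr (@pD R) f s.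

Lemma Cinf2_pDs s f : Cinf2 f -> Cinf2 (pDs s f).
Proof. by move=> hf; elim: s => //= j s IH; exact: Cinf2_pD. Qed.

(** The functions u_xi have the multipliers h_j and the functions v_xi the
    multipliers 1/h_j. *)
Definition QP (c1 c2 : R) f := forall x y,
  f (x + 1, y) = c1 * f (x, y) /\ f (x, y + 1) = c2 * f (x, y).

Definition qper c1 c2 f := Cinf2 f /\ QP c1 c2 f.

Lemma QP_pD c1 c2 j f : Cinf2 f -> QP c1 c2 f -> QP c1 c2 (pD j f).
Proof.
move=> hf qf x y.
have d1 := (pder1P _ _).1 (Cinf2_pder false hf); have d2 := (pder2P _ _).1 (Cinf2_pder true hf).
pose g1 := fun z : R * R => f (z.1 + 1, z.2).
pose g2 := fun z : R * R => f (z.1, z.2 + 1).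
have E1 : g1 = fun z => c1 * f z by apply/funext => -[u v]; rewrite /g1 /=; case: (qf u v).
have E2 : g2 = fun z => c2 * f z by apply/funext => -[u v]; rewrite /g2 /=; case: (qf u v).
have D1 : pder j g1 (fun z => pD j f (z.1 + 1, z.2)).
  case: j; [apply/pder2P|apply/pder1P] => u v; rewrite /g1 /=; first exact: d2.
  exact: (@derive_shift _ (fun t => f (t, v)) (fun t => pD false f (t, v)) 1 (d1^~ v) u).
have D2 : pder j g2 (fun z => pD j f (z.1, z.2 + 1)).
  case: j {D1}; [apply/pder2P|apply/pder1P] => u v; rewrite /g2 /=; last exact: d1.
  exact: (@derive_shift _ (fun t => f (u, t)) (fun t => pD true f (u, t)) 1 (d2 u) v).
have F1 := pderE D1; have F2 := pderE D2.
rewrite E1 pD_scale // in F1; rewrite E2 pD_scale // in F2.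
by split; [have := congr1 (fun F => F (x, y)) F1|have := congr1 (fun F => F (x, y)) F2] => /= ->.
Qed.

Lemma qper_pD c1 c2 j f : qper c1 c2 f -> qper c1 c2 (pD j f).
Proof. by move=> [sf qf]; split; [exact: Cinf2_pD|exact: QP_pD]. Qed.

Lemma qper_add c1 c2 f g : qper c1 c2 f -> qper c1 c2 g -> qper c1 c2 (fun x => f x + g x).
Proof.
move=> [sf qf] [sg qg]; split; first exact: Cinf2_add.
move=> x y; have [-> ->] := qf x y; have [-> ->] := qg x y; split; ring.
Qed.

Lemma qper_mul c1 c2 d1 d2 f g : qper c1 c2 f -> qper d1 d2 g ->
  qper (c1 * d1) (c2 * d2) (fun x => f x * g x).
Proof.
move=> [sf qf] [sg qg]; split; first exact: Cinf2_mul.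
move=> x y; have [-> ->] := qf x y; have [-> ->] := qg x y; split; ring.
Qed.

Lemma qper_scale c1 c2 c f : qper c1 c2 f -> qper c1 c2 (fun x => c * f x).
Proof.
move=> [sf qf]; split; first exact: Cinf2_scale.
move=> x y; have [-> ->] := qf x y; split; ring.
Qed.

Lemma qper_fst b : Cinf1 b -> (forall x, b (x + 1) = b x) -> qper 1 1 (fun x => b x.1).
Proof. by move=> hb pb; split; [exact: Cinf2_fst|move=> x y; rewrite !mul1r /= pb]. Qed.

Lemma qper_shear c1 c2 A f : Cinf1 A -> (forall x, A (x + 1) = A x) ->
  qper c1 c2 f -> qper c1 c2 (shear A f).
Proof.
move=> sA pA [sf qf]; split; first exact: Cinf2_shear.
move=> x y; rewrite /shear /= pA; split; first by have [] := qf x (y + A x).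
by rewrite addrAC; have [] := qf x (y + A x).
Qed.

Lemma pderivE j (f : R * R -> R[i]) : @pderiv R j f =
  fun x => (pD j (fun x => complex.Re (f x)) x +i* pD j (fun x => complex.Im (f x)) x)%C.
Proof. by rewrite -!pDE. Qed.

Lemma foldr_pderiv (f : R * R -> R[i]) s :
  (fun x => complex.Re (foldr (@pderiv R) f s x)) = pDs s (fun x => complex.Re (f x)) /\
  (fun x => complex.Im (foldr (@pderiv R) f s x)) = pDs s (fun x => complex.Im (f x)).
Proof.
by elim: s => //= j s [h1 h2]; rewrite h1 h2 !pDE.
Qed.

Lemma Cn_rC n (f : R * R -> R[i]) : Cn n f ->
  rC n (fun x => complex.Re (f x)) /\ rC n (fun x => complex.Im (f x)).
Proof.
move=> H.
have K m s : (m + size s = n)%N -> rC m (pDs s (fun x => complex.Re (f x))) /\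
                                   rC m (pDs s (fun x => complex.Im (f x))).
  elim: m s => [|m IH] s ms.
    have [] := H s; first by rewrite -ms.
    by have [-> ->] := foldr_pderiv f s.
  have [] := H s; first by rewrite -ms leq_addl.
  have [-> ->] := foldr_pderiv f s => c1 c2 d.
  have sn : (size s < n)%N by rewrite -ms addSnnS leq_addl.
  have {}d j x := d sn j x.
  split; split=> // j.
    exists (pD j (pDs s (fun x => complex.Re (f x)))).
      by move=> x; have [dx _] := d j x; split; rewrite -?pDE.
    by have [] := IH (j :: s); rewrite ?addnS // -ms.
  exists (pD j (pDs s (fun x => complex.Im (f x)))).
    by move=> x; have [_ dx] := d j x; split; rewrite -?pDE.
  by have [] := IH (j :: s); rewrite ?addnS // -ms.
exact: (K n [::] (addn0 n)).
Qed.

Lemma smooth_Cinf2 (f : R * R -> R[i]) : smooth f <->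
  Cinf2 (fun x => complex.Re (f x)) /\ Cinf2 (fun x => complex.Im (f x)).
Proof.
split=> [H|[h1 h2] n s sn g].
  by split; split=> n; have [] := Cn_rC (H n).
have [E1 E2] := foldr_pderiv f s.
rewrite /g E1 E2; split; try by apply: Cinf2_cont; exact: Cinf2_pDs.
move=> _ j x; split.
  by have [] := Cinf2_pder j (Cinf2_pDs s h1) x.
by have [] := Cinf2_pder j (Cinf2_pDs s h2) x.
Qed.

End Smooth.

(** * Green's formula and the energy estimate *)

Section Energy.
Variable R : realType.
Implicit Types (f g : R * R -> R).

Lemma J_pder1 f f' : pder false f f' -> continuous f' ->
  J f' = I01 (fun y => f (1, y) - f (0, y)).
Proof.
move=> /pder1P df cf; rewrite (J_fubini' (cont_intO cf)); apply: eq_I01 => y _.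
by rewrite (I01E (cont_slice1 y cf) (df^~ y)).
Qed.

Lemma J_pder2 f f' : pder true f f' -> continuous f' ->
  J f' = I01 (fun x => f (x, 1) - f (x, 0)).
Proof.
move=> /pder2P df cf; rewrite (J_fubini (cont_intO cf)).2; apply: eq_I01 => x _.
by rewrite /slice_int (I01E (cont_slice2 x cf) (df x)).
Qed.

Lemma J_pder_edge j f f' : pder j f f' -> continuous f' ->
  (forall t, 0 <= t <= 1 -> if j then f (t, 1) = f (t, 0) else f (1, t) = f (0, t)) ->
  J f' = 0.
Proof.
move=> df cf H; case: j df H => df H; [rewrite (J_pder2 df cf)|rewrite (J_pder1 df cf)];
  rewrite -[RHS](I01_cst (0 : R)); apply: eq_I01 => t /andP[t0 t1];
  by rewrite H ?subrr // !ltW.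
Qed.

Lemma J_pD_per j f : qper 1 1 f -> J (pD j f) = 0.
Proof.
move=> [sf qf]; apply: (J_pder_edge (Cinf2_pder j sf)); first exact: Cinf2_cont (Cinf2_pD _ _).
move=> t _; have := qf t 0; have := qf 0 t; rewrite !add0r !mul1r => -[h1 _] [_ h2].
by case: j.
Qed.

(** For fixed x_1 the shear is a translation in x_2. *)
Lemma J_shear A f : continuous A -> continuous f ->
  (forall x y, f (x, y + 1) = f (x, y)) -> J (shear A f) = J f.
Proof.
move=> cA cf pf; rewrite (J_fubini (cont_intO (cont_shear cA cf))).2.
rewrite (J_fubini (cont_intO cf)).2; apply: eq_I01 => x _.
exact: (@I01_shift R (fun t => f (x, t)) (A x) (cont_slice2 x cf) (pf x)).
Qed.

Definition lap f : R * R -> R := fun x => pD false (pD false f) x + pD true (pD true f) x.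

Definition rBC (h1 h2 : R) f := forall t, 0 <= t <= 1 ->
  [/\ h1 * f (0, t) = f (1, t), h1 * pD false f (0, t) = pD false f (1, t),
      h2 * f (t, 0) = f (t, 1) & h2 * pD true f (t, 0) = pD true f (t, 1)].

Lemma QP_rBC h1 h2 f : qper h1 h2 f -> rBC h1 h2 f.
Proof.
move=> hf t _; have [_ qf] := hf.
have [_ q1] := qper_pD false hf; have [_ q2] := qper_pD true hf.
have := qf 0 t; have := qf t 0; have := q1 0 t; have := q2 t 0.
by rewrite !add0r => -[_ ->] [-> _] [_ ->] [-> _].
Qed.

Lemma Green_dir j f g : Cinf2 f -> Cinf2 g ->
  (forall t, 0 <= t <= 1 -> let p := if j then (t, 0) else (0, t) in
     let q := if j then (t, 1) else (1, t) in
     f q * pD j g q = f p * pD j g p /\ pD j f q * g q = pD j f p * g p) ->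
  J (fun x => f x * pD j (pD j g) x) = J (fun x => pD j (pD j f) x * g x).
Proof.
move=> sf sg B.
have rp := @Cinf2_pD R j; have sf' := rp _ sf; have sg' := rp _ sg.
have c1 : continuous (fun x => f x * pD j (pD j g) x) by apply: Cinf2_cont; apply: Cinf2_mul => //; exact: rp.
have c2 : continuous (fun x => pD j (pD j f) x * g x) by apply: Cinf2_cont; apply: Cinf2_mul => //; exact: rp.
apply/eqP; rewrite -subr_eq0 -JB; [|exact: cont_intO..].
apply/eqP; apply: (@J_pder_edge j (fun x => f x * pD j g x + -1 * (pD j f x * g x))).
- apply: (pder_eqr (pder_add (pder_mul (Cinf2_pder j sf) (Cinf2_pder j sg'))
    (pder_mul (pder_cst j (-1)) (pder_mul (Cinf2_pder j sf') (Cinf2_pder j sg))))) => x.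
  by gen_pD; ring.
- exact: cont_sub2.
- by move=> t /B; case: j {B rp sf' sg' c1 c2} => /= -[-> ->].
Qed.

(** The boundary terms on opposite sides cancel because the multipliers of f
    and g are inverse to each other. *)
Lemma Green h1 h2 f g : 0 < h1 -> 0 < h2 -> Cinf2 f -> Cinf2 g ->
  rBC h1 h2 f -> rBC h1^-1 h2^-1 g ->
  J (fun x => f x * lap g x) = J (fun x => lap f x * g x).
Proof.
move=> h10 h20 sf sg bf bg.
have rp j (h : R * R -> R) : Cinf2 h -> Cinf2 (pD j (pD j h)) by move=> hh; do 2 apply: Cinf2_pD.
have c j : intO (fun x => f x * pD j (pD j g) x).
  by apply: cont_intO; apply: Cinf2_cont; apply: Cinf2_mul => //; exact: rp.
have d j : intO (fun x => pD j (pD j f) x * g x).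
  by apply: cont_intO; apply: Cinf2_cont; apply: Cinf2_mul => //; exact: rp.
have -> : J (fun x => f x * lap g x) = J (fun x => f x * pD false (pD false g) x + f x * pD true (pD true g) x).
  by apply: eq_J => x _; rewrite mulrDr.
have -> : J (fun x => lap f x * g x) = J (fun x => pD false (pD false f) x * g x + pD true (pD true f) x * g x).
  by apply: eq_J => x _; rewrite mulrDl.
rewrite !JD //; congr (_ + _); apply: Green_dir => // t t01 /=.
  have [<- <- _ _] := bf t t01; have [<- <- _ _] := bg t t01.
  by split; field; exact: lt0r_neq0.
have [_ _ <- <-] := bf t t01; have [_ _ <- <-] := bg t t01.
by split; field; exact: lt0r_neq0.
Qed.

Lemma lap_qper c1 c2 f : qper c1 c2 f -> qper c1 c2 (lap f).
Proof. by move=> hf; apply: qper_add; do 2 apply: qper_pD. Qed.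

Lemma lap_Cinf2 f : Cinf2 f -> Cinf2 (lap f).
Proof. by move=> hf; apply: Cinf2_add; do 2 apply: Cinf2_pD. Qed.

Lemma lap_pD j f : Cinf2 f -> lap (pD j f) = pD j (lap f).
Proof.
move=> sf; have r i (h : R * R -> R) : Cinf2 h -> Cinf2 (pD i h) by exact: Cinf2_pD.
have rr i : Cinf2 (pD i (pD i f)) by exact: (r i _ (r i _ sf)).
rewrite /lap (pD_add j (rr false) (rr true)); apply/funext => x.
rewrite (pD_comm false j sf) (pD_comm true j sf).
rewrite (pD_comm false j (r false _ sf)) (pD_comm true j (r true _ sf)).
reflexivity.
Qed.

Definition laps n f := iter n lap f.

Lemma laps_qper c1 c2 n f : qper c1 c2 f -> qper c1 c2 (laps n f).
Proof. by move=> hf; elim: n => //= n; exact: lap_qper. Qed.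

Lemma laps_pD j n f : Cinf2 f -> laps n (pD j f) = pD j (laps n f).
Proof.
move=> sf; elim: n => //= n ->; apply: lap_pD.
by elim: n => //= n; exact: lap_Cinf2.
Qed.

Variables (h1 h2 : R) (h1_gt0 : 0 < h1) (h2_gt0 : 0 < h2).
Let l1 := ln h1.
Let l2 := ln h2.

(** The weight h^(2x). It turns products of two functions with multipliers 1/h
    into periodic functions, whose derivatives integrate to 0. *)
Definition om : R * R -> R := fun x => expR (2 * l1 * x.1) * expR (2 * l2 * x.2).

Lemma om_gt0 x : 0 < om x.
Proof. by rewrite mulr_gt0 // expR_gt0. Qed.

Lemma exp_ln2 (h x : R) : 0 < h -> expR (2 * ln h * (x + 1)) = h ^+ 2 * expR (2 * ln h * x).
Proof.
move=> h0; rewrite mulrDr mulr1 expRD mulrC; congr (_ * _).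
by rewrite (_ : 2 * ln h = ln h + ln h) ?expRD ?lnK ?expr2 //; ring.
Qed.

Lemma om_qper : qper (h1 ^+ 2) (h2 ^+ 2) om.
Proof.
split; first by apply: Cinf2_mul; [apply: (@Cinf2_fst R (fun t => expR (2 * l1 * t)))|apply: (@Cinf2_snd R (fun t => expR (2 * l2 * t)))]; exact: Cinf1_exp.
by move=> x y; rewrite /om /= !exp_ln2 //; split; ring.
Qed.

Lemma pder_om : pder false om (fun x => 2 * l1 * om x) /\ pder true om (fun x => 2 * l2 * om x).
Proof.
split; [apply: (pder_eqr (pder_mul (pder1_fst (@dexp R (2 * l1))) (pder1_snd (fun t => expR (2 * l2 * t)))))|
        apply: (pder_eqr (pder_mul (pder2_fst (fun t => expR (2 * l1 * t))) (pder2_snd (@dexp R (2 * l2)))))] => x;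
by rewrite /om; ring.
Qed.

Notation V := (qper h1^-1 h2^-1).

Definition W f := J (fun x => om x * f x ^+ 2).

Lemma W_int f : continuous f -> intO (fun x => om x * f x ^+ 2).
Proof.
move=> cf; apply: cont_intO; apply: cont_mul2; first exact: Cinf2_cont om_qper.1.
exact: cont_mul2.
Qed.

Lemma W_ge0 f : 0 <= W f.
Proof. by apply: J_ge0 => x _; rewrite mulr_ge0 ?sqr_ge0 // ltW // om_gt0. Qed.

Lemma W_le f g c : continuous f -> continuous g ->
  (forall x, Omega x -> f x ^+ 2 <= c * g x ^+ 2) -> W f <= c * W g.
Proof.
move=> cf cg H; rewrite -JZ; last exact: W_int.
apply: J_le; [exact: W_int|by apply: intO_Z; exact: W_int|].
move=> x Ox; rewrite [leRHS]mulrCA ler_wpM2l //; first by rewrite ltW // om_gt0.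
exact: H.
Qed.

Lemma W_scale c f : continuous f -> W (fun x => c * f x) = c ^+ 2 * W f.
Proof. by move=> cf; rewrite -JZ; [apply: eq_J => x _; ring|exact: W_int]. Qed.

Lemma W_add f g : continuous f -> continuous g ->
  W (fun x => f x + g x) <= 2 * (W f + W g).
Proof.
move=> cf cg; have If := W_int cf; have Ig := W_int cg.
rewrite -JD // -JZ; last exact: intO_D.
apply: J_le; first by apply: W_int; exact: cont_add2.
  by apply: intO_Z; exact: intO_D.
move=> x _; rewrite -mulrDr [leRHS]mulrCA ler_wpM2l //; first by rewrite ltW // om_gt0.
by have := sqr_ge0 (f x - g x); nra.
Qed.

(** The function E j is the derivative of om f (d_j f), which is periodic, so
    its integral is 0. The right side minus the left side plus 2 (E false + E
    true) is the integral of om times a sum of three squares. *)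
Lemma W_grad f : V f ->
  W (pD false f) + W (pD true f) <= W (lap f) + (1 + 4 * (l1 ^+ 2 + l2 ^+ 2)) * W f.
Proof.
move=> hf; have [sf qf] := hf; have [so qo] := om_qper.
have [do1 do2] := pder_om.
have sp j := Cinf2_pD j sf; have spp j := Cinf2_pD j (sp j).
pose E j : R * R -> R := fun x => om x * pD j f x ^+ 2 + om x * f x * pD j (pD j f) x
   + (2 * if j then l2 else l1) * (om x * f x * pD j f x).
have hE j : qper 1 1 (fun x => om x * f x * pD j f x).
  have e1 : h1 ^+ 2 / h1 / h1 = 1 by field; exact: lt0r_neq0.
  have e2 : h2 ^+ 2 / h2 / h2 = 1 by field; exact: lt0r_neq0.
  by have := qper_mul (qper_mul om_qper hf) (qper_pD j hf); rewrite e1 e2.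
have J0 j : J (E j) = 0.
  rewrite -(J_pD_per j (hE j)); congr J; apply/esym/pderE.
  have dom : pder j om (fun x => (2 * if j then l2 else l1) * om x) by case: j.
  apply: (pder_eqr (pder_mul (pder_mul dom (Cinf2_pder j sf)) (Cinf2_pder j (sp j)))) => x.
  by rewrite /E; gen_pD; ring.
have rE j : Cinf2 (E j).
  have r1 : Cinf2 (fun x => om x * pD j f x ^+ 2) by apply: Cinf2_mul => //; exact: Cinf2_mul.
  have r2 : Cinf2 (fun x => om x * f x * pD j (pD j f) x) by apply: Cinf2_mul => //; exact: Cinf2_mul.
  have r3 : Cinf2 (fun x => (2 * if j then l2 else l1) * (om x * f x * pD j f x)).
    by apply: Cinf2_scale; apply: Cinf2_mul => //; exact: Cinf2_mul.
  exact: Cinf2_add (Cinf2_add r1 r2) r3.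
have cE j : intO (E j) by apply: cont_intO; exact: Cinf2_cont.
set K := 1 + _.
have i1 := W_int (Cinf2_cont (sp false)); have i2 := W_int (Cinf2_cont (sp true)).
have i3 := W_int (Cinf2_cont (lap_Cinf2 sf)); have i4 := W_int (Cinf2_cont sf).
have H : J (fun x => om x * pD false f x ^+ 2 + om x * pD true f x ^+ 2 -
     (om x * lap f x ^+ 2 + K * (om x * f x ^+ 2))) <= J (fun x => 2 * (E false x + E true x)).
  apply: J_le.
  - by apply: intO_B; apply: intO_D => //; exact: intO_Z.
  - by apply: intO_Z; exact: intO_D.
  move=> x _; rewrite /E /K /lap.
  set a := pD false f x; set b := pD true f x; set c := pD false (pD false f) x.
  set d := pD true (pD true f) x; set o := om x; set u := f x.
  rewrite -subr_ge0.
  set D := (X in 0 <= X).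
  have -> : D = o * ((u + (c + d)) ^+ 2 + (a + 2 * l1 * u) ^+ 2 + (b + 2 * l2 * u) ^+ 2).
    by rewrite /D; ring.
  by rewrite mulr_ge0 ?addr_ge0 ?sqr_ge0 // ltW // om_gt0.
have i34 := intO_Z K i4.
have E1 := JB (intO_D i1 i2) (intO_D i3 i34).
rewrite (JD i1 i2) (JD i3 i34) (JZ K i4) in E1.
have E2 := JZ 2 (intO_D (cE false) (cE true)).
rewrite (JD (cE false) (cE true)) !J0 addr0 mulr0 in E2.
rewrite E1 E2 subr_le0 in H; exact: H.
Qed.

(** The square of a Sobolev norm of order n with weight om, in which a
    derivative may be counted several times. *)
Fixpoint sob n f : R :=
  if n is n'.+1 then sob n' f + sob n' (pD false f) + sob n' (pD true f) else W f.

Ltac gen_sob := repeat match goal with |- context [sob ?n ?f] => generalize (sob n f) end.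
Ltac sob_lra := cbv beta; gen_sob; clear; intros; lra.

Lemma sob_ge0 n f : 0 <= sob n f.
Proof. by elim: n f => [|n IH] f; [exact: W_ge0|rewrite /= !addr_ge0]. Qed.

Lemma sob_leS n f : sob n f <= sob n.+1 f.
Proof. by rewrite /= -addrA lerDl addr_ge0 // sob_ge0. Qed.

Lemma sob_le n m f : (n <= m)%N -> sob n f <= sob m f.
Proof.
move=> /subnKC <-; elim: (m - n)%N => [|k IH]; first by rewrite addn0.
by rewrite addnS; exact: le_trans IH (sob_leS _ _).
Qed.

Lemma sob_pD j n f : sob n (pD j f) <= sob n.+1 f.
Proof.
rewrite /=; have := sob_ge0 n f; have := sob_ge0 n (pD false f); have := sob_ge0 n (pD true f).
by case: j; sob_lra.
Qed.

Lemma sob_add n f g : Cinf2 f -> Cinf2 g ->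
  sob n (fun x => f x + g x) <= 2 * (sob n f + sob n g).
Proof.
elim: n f g => [|n IH] f g sf sg; first by apply: W_add; exact: Cinf2_cont.
rewrite /= !pD_add //; have r j (h : R * R -> R) : Cinf2 h -> Cinf2 (pD j h) by exact: Cinf2_pD.
have := IH _ _ sf sg; have := IH _ _ (r false _ sf) (r false _ sg).
have := IH _ _ (r true _ sf) (r true _ sg); sob_lra.
Qed.

Lemma sob_scale n c f : Cinf2 f -> sob n (fun x => c * f x) = c ^+ 2 * sob n f.
Proof.
elim: n f => [|n IH] f sf; first by apply: W_scale; exact: Cinf2_cont.
by rewrite /= !pD_scale // !IH //; try exact: Cinf2_pD; rewrite !mulrDr.
Qed.

(** The estimate W_grad exchanges a first derivative for a Laplacian, and the
    Laplacian commutes with derivatives, so the powers of the Laplacian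
    control all derivatives. *)
Lemma sob_laps n : exists2 C, 0 <= C & forall f, V f ->
  sob n f <= C * \sum_(j < n.+1) W (laps j f).
Proof.
elim: n => [|n [C C0 H]]; first by exists 1 => // f _; rewrite big_ord1 mul1r.
pose K := 1 + 4 * (l1 ^+ 2 + l2 ^+ 2).
have K0 : 0 <= K by rewrite addr_ge0 // mulr_ge0 // addr_ge0 ?sqr_ge0.
exists (C * (2 + K)); first by rewrite mulr_ge0 // addr_ge0.
move=> f hf /=; have [sf _] := hf.
have h1' := H _ hf; have h2' := H _ (qper_pD false hf); have h3' := H _ (qper_pD true hf).
have S : \sum_(j < n.+1) W (laps j (pD false f)) + \sum_(j < n.+1) W (laps j (pD true f)) <=
   \sum_(j < n.+1) W (laps j.+1 f) + K * \sum_(j < n.+1) W (laps j f).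
  rewrite -big_split /= mulr_sumr -big_split /=; apply: ler_sum => j _.
  by rewrite !laps_pD //; apply: W_grad; exact: laps_qper.
have S1 : \sum_(j < n.+1) W (laps j f) <= \sum_(j < n.+2) W (laps j f).
  by rewrite [leRHS]big_ord_recr /= lerDl W_ge0.
have S2 : \sum_(j < n.+1) W (laps j.+1 f) <= \sum_(j < n.+2) W (laps j f).
  by rewrite [leRHS]big_ord_recl /= lerDr W_ge0.
suff aux (a b c D X Y Z U V' L : R) : 0 <= D -> 0 <= L -> a <= D * X -> b <= D * U ->
    c <= D * V' -> U + V' <= Z + L * X -> X <= Y -> Z <= Y -> a + b + c <= D * (2 + L) * Y.
  exact: (aux _ _ _ _ _ _ _ _ _ _ C0 K0 h1' h2' h3' S S1 S2).
clear; move=> D0 L0 ha hb hc UV XY ZY.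
have KXY : L * X <= L * Y by rewrite ler_wpM2l.
have t1 : D * (U + V') <= D * (Z + L * X) by rewrite ler_wpM2l.
have t2 : D * (X + (Z + L * X)) <= D * ((2 + L) * Y) by rewrite ler_wpM2l //; lra.
lra.
Qed.

Lemma sob_lap n f : Cinf2 f -> sob n (lap f) <= 4 * sob n.+2 f.
Proof.
move=> sf; have r j (h : R * R -> R) : Cinf2 h -> Cinf2 (pD j h) by exact: Cinf2_pD.
apply: le_trans (sob_add n (r false _ (r false _ sf)) (r true _ (r true _ sf))) _.
have := le_trans (sob_pD false n (pD false f)) (sob_pD false n.+1 f).
have := le_trans (sob_pD true n (pD true f)) (sob_pD true n.+1 f).
sob_lra.
Qed.

Lemma W_laps j f : Cinf2 f -> W (laps j f) <= 4 ^+ j * sob (2 * j) f.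
Proof.
suff H n : Cinf2 f -> sob n (laps j f) <= 4 ^+ j * sob (n + 2 * j) f by move=> /(H 0%N).
move=> sf; elim: j n => [|j IH] n /=; first by rewrite muln0 addn0 expr0 mul1r.
have sl : Cinf2 (laps j f) by elim: j {IH} => //= j; exact: lap_Cinf2.
apply: le_trans (sob_lap n sl) _; rewrite exprS -mulrA ler_wpM2l //.
by apply: le_trans (IH n.+2) _; rewrite mulnS addnA addn2.
Qed.

Lemma cont1_bounded (b : R -> R) : continuous b ->
  exists2 M : R, 0 <= M & forall x : R, 0 <= x <= 1 -> `|b x| <= M.
Proof.
move=> /cont_fst /cont2_bounded [M M0 H]; exists M => // x x01.
by apply: (H x 0) => //; rewrite lexx ler01.
Qed.

Lemma sob_mulfst n b : Cinf1 b -> exists2 C, 0 <= C & forall f, Cinf2 f ->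
  sob n (fun x => b x.1 * f x) <= C * sob n f.
Proof.
elim: n b => [|n IH] b sb.
  have [M M0 H] := cont1_bounded (dC_cont (Cinf1_Cn sb 0)).
  exists (M ^+ 2); first exact: sqr_ge0.
  move=> f sf; apply: W_le; last first.
  - move=> [x y] /OmegaP [/andP[x0 x1] _] /=; rewrite exprMn ler_wpM2r ?sqr_ge0 //.
    by rewrite -[b x ^+ 2]real_normK ?num_real // ler_sqr ?nnegrE // H // !ltW.
  - exact: Cinf2_cont.
  - by apply: Cinf2_cont; apply: Cinf2_mul => //; exact: Cinf2_fst.
have [b' db sb'] := Cinf1_D sb.
have [C C0 HC] := IH _ sb; have [C' C'0 HC'] := IH _ sb'.
exists (C + 2 * C' + 2 * C + C); first by rewrite !addr_ge0 // mulr_ge0.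
move=> f sf /=; have sbf := Cinf2_fst sb; have sbf' := Cinf2_fst sb'.
have r j := Cinf2_pD j sf.
have E1 : pD true (fun x : R * R => b x.1 * f x) = fun x => b x.1 * pD true f x.
  apply: pderE; apply: (pder_eqr (pder_mul (pder2_fst b) (Cinf2_pder true sf))) => x.
  by rewrite mul0r add0r.
rewrite (pderE (pder_mul (pder1_fst db) (Cinf2_pder false sf))) E1.
have := sob_add n (Cinf2_mul sbf' sf) (Cinf2_mul sbf (r false)).
have := HC _ sf; have := HC _ (r false); have := HC _ (r true); have := HC' _ sf.
have := sob_ge0 n (pD true f); have := sob_ge0 n (pD false f); have := sob_ge0 n f.
suff aux (a b1 c d e p q r' D D' : R) : 0 <= D -> 0 <= D' -> 0 <= p -> 0 <= q -> 0 <= r' ->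
    d <= D' * p -> e <= D * r' -> c <= D * q -> a <= D * p -> b1 <= 2 * (d + c) ->
    a + b1 + e <= (D + 2 * D' + 2 * D + D) * (p + q + r').
  by move=> p0 q0 r0 d0 e0 c0 a0 b0; exact: (aux _ _ _ _ _ _ _ _ _ _ C0 C'0 p0 q0 r0 d0 e0 c0 a0 b0).
clear; move=> D0 D'0 p0 q0 r0.
have := mulr_ge0 D0 p0; have := mulr_ge0 D0 q0; have := mulr_ge0 D0 r0.
have := mulr_ge0 D'0 p0; have := mulr_ge0 D'0 q0; have := mulr_ge0 D'0 r0.
lra.
Qed.

(** The function om f^2 is periodic, so its integral is invariant under the
    shear, and the weight at the sheared point differs from om by a bounded
    factor. Derivatives of a sheared function are sheared derivatives, with A'
    as a coefficient. *)
Lemma sob_shear n A : Cinf1 A -> exists2 C, 0 <= C & forall f, V f ->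
  sob n (shear A f) <= C * sob n f.
Proof.
move=> sA; have cA : continuous A := dC_cont (Cinf1_Cn sA 0).
elim: n => [|n [C C0 H]].
  have cE : continuous (fun x => expR (- (2 * l2) * A x)).
    move=> x; apply: (@continuous_comp _ _ _ (fun x => - (2 * l2) * A x) expR); last exact: continuous_expR.
    by apply: continuousM; [exact: cvg_cst|exact: cA].
  have [M M0 HM] := cont1_bounded cE.
  exists M => // f [sf qf].
  pose F : R * R -> R := fun x => om x * f x ^+ 2.
  have cF : continuous F by apply: cont_mul2; [exact: Cinf2_cont om_qper.1|apply: cont_mul2; exact: Cinf2_cont].
  rewrite [X in X <= _]/= [sob 0 f]/=; have <- : J (shear A F) = W f.
    apply: J_shear => // x y; rewrite /F; have [_ ->] := om_qper.2 x y; have [_ ->] := qf x y.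
    by field; exact: lt0r_neq0.
  rewrite -JZ; last by apply: cont_intO; exact: cont_shear.
  apply: J_le.
  - by apply: W_int; apply: cont_shear => //; exact: Cinf2_cont.
  - by apply: intO_Z; apply: cont_intO; exact: cont_shear.
  move=> [x y] /OmegaP [/andP[x0 x1] _]; rewrite /shear /F /=.
  have -> : om (x, y) = expR (- (2 * l2) * A x) * om (x, y + A x).
    by rewrite /om /= [RHS]mulrCA -[X in _ = _ * X]expRD; congr (_ * _); congr expR; ring.
  rewrite -mulrA ler_wpM2r //; first by rewrite mulr_ge0 ?sqr_ge0 // ltW // om_gt0.
  by apply: le_trans (ler_norm _) _; apply: HM; rewrite !ltW.
have [A' dA sA'] := Cinf1_D sA; have [D D0 HD] := sob_mulfst n sA'.
exists (C + 2 * (C + D * C) + C); first by rewrite !addr_ge0 // mulr_ge0 // addr_ge0 // mulr_ge0.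
move=> f hf /=; have [sf _] := hf; have r j := qper_pD j hf.
have rs j := (r j).1.
rewrite (pderE (pder2_shear A (Cinf2_pder true sf))).
rewrite (pderE (pder1_shear (Cinf2_cont (rs false)) (Cinf2_pder false sf) (Cinf2_pder true sf) dA)).
have sT j := Cinf2_shear sA (rs j).
have b0 := sob_add n (sT false) (Cinf2_mul (Cinf2_fst sA') (sT true)).
have d0 := HD _ (sT true).
have a0 := H _ hf; have c0 := H _ (r false); have e0 := H _ (r true).
have p0 := sob_ge0 n f; have q0 := sob_ge0 n (pD false f); have r0 := sob_ge0 n (pD true f).
suff aux (a b1 c d e p q r' L L' : R) : 0 <= L -> 0 <= L' -> 0 <= p -> 0 <= q -> 0 <= r' ->
    d <= L' * e -> e <= L * r' -> c <= L * q -> a <= L * p -> b1 <= 2 * (c + d) ->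
    a + b1 + e <= (L + 2 * (L + L' * L) + L) * (p + q + r').
  exact: (aux _ _ _ _ _ _ _ _ _ _ C0 D0 p0 q0 r0 d0 e0 c0 a0 b0).
clear; move=> L0 L'0 p0 q0 r0 d0 e0.
have : L' * e <= L' * (L * r') by rewrite ler_wpM2l.
have LL := mulr_ge0 L'0 L0.
have := mulr_ge0 L0 p0; have := mulr_ge0 L0 q0; have := mulr_ge0 L0 r0.
have := mulr_ge0 LL p0; have := mulr_ge0 LL q0; have := mulr_ge0 LL r0.
move: d0 e0; lra.
Qed.

End Energy.

(** * Symmetric sums over the integers *)

Section Fourier1.
Variable R : realType.
Notation mu := (@lebesgue_measure R).
Notation T := (measurableTypeR R).
Implicit Types (q H : R -> R) (F : int -> R).

Definition tends0 (u : nat -> R) :=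
  forall e, 0 < e -> exists N, forall n, (N <= n)%N -> `|u n| <= e.

Lemma tends0_cvg (u : nat -> R) : u @ \oo --> (0 : R) -> tends0 u.
Proof.
move=> /cvgr0Pnorm_le H e e0; have [N _ NP] := H e e0.
by exists N => n Nn; apply: NP.
Qed.

Lemma tends0_le (u v : nat -> R) : (forall n, `|u n| <= v n) -> tends0 v -> tends0 u.
Proof.
move=> uv H e /H [N NP]; exists N => n /NP h.
by apply: le_trans (uv n) _; apply: le_trans (ler_norm _) h.
Qed.

Lemma tends0_zero (c : R) (u : nat -> R) : (forall n, `|c| <= u n) -> tends0 u -> c = 0.
Proof.
move=> cu H; apply/eqP; rewrite -normr_le0; apply/ler_addgt0Pl => e /H [N NP].
by rewrite addr0; apply: le_trans (cu N) _; apply: le_trans (ler_norm _) (NP N (leqnn _)).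
Qed.

Lemma tends0_scale c (u : nat -> R) : tends0 u -> tends0 (fun n => c * u n).
Proof.
move=> H e e0; have c0 : 0 < `|c| + 1 by rewrite ltr_wpDl.
have [N NP] := H (e / (`|c| + 1)) (divr_gt0 e0 c0).
exists N => n /NP h; rewrite normrM.
apply: (@le_trans _ _ ((`|c| + 1) * (e / (`|c| + 1)))).
  by apply: ler_pM => //; rewrite lerDl.
by rewrite mulrC divfK // lt0r_neq0.
Qed.

Lemma tends0_add (u v : nat -> R) : tends0 u -> tends0 v -> tends0 (fun n => u n + v n).
Proof.
move=> Hu Hv e e0; have e2 : 0 < e / 2 by rewrite divr_gt0.
have [N NP] := Hu _ e2; have [M MP] := Hv _ e2; exists (maxn N M) => n.
rewrite geq_max => /andP[/NP h1 /MP h2]; apply: le_trans (ler_normD _ _) _.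
by rewrite [leRHS]splitr lerD.
Qed.

Definition sZ (N : nat) F : R :=
  F 0 + \sum_(i < N) (F (Posz i.+1) + F (- Posz i.+1)).

Lemma sZS N F : sZ N.+1 F = sZ N F + (F (Posz N.+1) + F (- Posz N.+1)).
Proof. by rewrite /sZ big_ord_recr /= addrA. Qed.

Lemma sZ0 F : sZ 0 F = F 0.
Proof. by rewrite /sZ big_ord0 addr0. Qed.

Lemma eq_sZ N F G : F =1 G -> sZ N F = sZ N G.
Proof. by move=> E; elim: N => [|N IH]; rewrite ?sZ0 ?sZS ?IH !E. Qed.

Lemma sZD N F G : sZ N (fun k => F k + G k) = sZ N F + sZ N G.
Proof. elim: N => [|N IH]; rewrite ?sZ0 ?sZS //= IH; ring. Qed.

Lemma sZM N c F : sZ N (fun k => c * F k) = c * sZ N F.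
Proof. elim: N => [|N IH]; rewrite ?sZ0 ?sZS //= IH; ring. Qed.

Lemma sZ_odd N F : (forall k, F (- k) = - F k) -> sZ N F = 0.
Proof.
move=> h; elim: N => [|N IH]; last by rewrite sZS IH h add0r subrr.
rewrite sZ0; have := h 0; rewrite oppr0 => h0; lra.
Qed.

Lemma sZ_diff_le N M F G : (forall k, `|F k| <= G k) ->
  `|sZ (M + N) F - sZ M F| <= sZ (M + N) G - sZ M G.
Proof.
move=> h; elim: N => [|N IH]; first by rewrite addn0 !subrr normr0.
rewrite addnS !sZS.
set a := F _; set b := F _; set c := G _; set d := G _.
have ha : `|a| <= c by exact: h.
have hb : `|b| <= d by exact: h.
have -> : sZ (M + N) F + (a + b) - sZ M F = (sZ (M + N) F - sZ M F) + (a + b) by ring.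
apply: le_trans (ler_normD _ _) _.
apply: le_trans (lerD IH (le_trans (ler_normD a b) (lerD ha hb))) _.
by rewrite addrAC.
Qed.

Lemma sZ_norm N F G : (forall k, `|F k| <= G k) -> `|sZ N F| <= sZ N G.
Proof.
move=> h; have := sZ_diff_le N 0 h; rewrite add0n !sZ0 => h1.
have -> : sZ N F = (sZ N F - F 0) + F 0 by ring.
apply: le_trans (ler_normD _ _) _.
by apply: le_trans (lerD h1 (h 0)) _; rewrite subrK.
Qed.

Definition wt (k : int) : R := (1 + k%:~R ^+ 2)^-1.

Lemma wt_den_gt0 (k : int) : 0 < 1 + (k%:~R : R) ^+ 2.
Proof. by rewrite ltr_pwDl // sqr_ge0. Qed.

Lemma wt_gt0 k : 0 < wt k.
Proof. by rewrite invr_gt0 wt_den_gt0. Qed.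

Lemma wtN k : wt (- k) = wt k.
Proof. by rewrite /wt mulrNz sqrrN. Qed.

(** The bound telescopes because 2/(1+n^2) <= 4/(n(n+1)). *)
Lemma sZ_wt_le N : sZ N wt <= 5 - 4 / N.+1%:R.
Proof.
have aux (n : R) : 1 <= n ->
    5 - 4 / n + ((1 + n ^+ 2)^-1 + (1 + n ^+ 2)^-1) <= 5 - 4 / (n + 1).
  move=> n1; have -> : 5 - 4 / n = 5 - 4 / (n + 1) - 4 / (n * (n + 1)).
    by field; apply/andP; split; apply: lt0r_neq0; lra.
  have n2 : 0 < n * (n + 1) by rewrite mulr_gt0 //; lra.
  have n3 : 0 < 1 + n ^+ 2 by rewrite ltr_pwDl // sqr_ge0.
  suff : 2 / (1 + n ^+ 2) <= 4 / (n * (n + 1)) by lra.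
  by rewrite ler_pdivrMr // mulrAC ler_pdivlMr //; nra.
elim: N => [|N IH].
  rewrite sZ0 /wt mulr0z expr0n addr0 invr1; lra.
rewrite sZS wtN; apply: le_trans (lerD IH (lexx _)) _.
have -> : N.+2%:R = N.+1%:R + 1 :> R by rewrite -addn1 natrD.
by apply: aux; rewrite ler1n.
Qed.

Lemma sZ_wt_nd : {homo (fun N => sZ N wt) : n m / (n <= m)%N >-> n <= m}.
Proof.
apply: homo_leq => [//|a b c|n]; first exact: le_trans.
by rewrite sZS lerDl addr_ge0 // ltW // wt_gt0.
Qed.

Definition swt : R := lim ((fun N => sZ N wt) @ \oo).

Lemma sZ_wt_cvg : (fun N => sZ N wt) @ \oo --> swt.
Proof.
apply: nondecreasing_is_cvgn; first exact: sZ_wt_nd.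
exists 5 => _ [N _ <-]; apply: le_trans (sZ_wt_le N) _.
by rewrite gerDl oppr_le0 divr_ge0.
Qed.

Lemma sZ_wt_lim N : sZ N wt <= swt.
Proof.
apply: nondecreasing_cvgn_le; first exact: sZ_wt_nd.
exact: cvgP sZ_wt_cvg.
Qed.

Lemma tail_tends0 : tends0 (fun N => swt - sZ N wt).
Proof.
apply: tends0_cvg; rewrite -(subrr swt); apply: cvgB; first exact: cvg_cst.
exact: sZ_wt_cvg.
Qed.

Lemma sZ_cauchy M N (c : R) F : (forall k, `|F k| <= c * wt k) -> (M <= N)%N ->
  `|sZ N F - sZ M F| <= c * (swt - sZ M wt).
Proof.
move=> h /subnKC <-; apply: le_trans (sZ_diff_le (N - M) M h) _.
have c0 : 0 <= c.
  have := le_trans (normr_ge0 _) (h 0); by rewrite pmulr_lge0 // wt_gt0.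
by rewrite !sZM -mulrBr ler_wpM2l // lerB // sZ_wt_lim.
Qed.

Lemma sin_per (x : R) (n : nat) : sin (x + 2 * pi * n%:R) = sin x.
Proof.
have -> : 2 * pi * n%:R = (pi *+ 2) *+ n :> R.
  by rewrite -[RHS]mulr_natr -[pi *+ 2]mulr_natl.
exact: (periodicn (@sinD2pi R) n x).
Qed.

Lemma sin_perZ (x : R) (k : int) : sin (x + 2 * pi * k%:~R) = sin x.
Proof.
case: (intP k) => [|n|n]; first by rewrite mulr0 addr0.
  exact: sin_per.
by rewrite mulrNz mulrN -(sin_per (x - _) n.+1) subrK.
Qed.

Lemma cos_perZ (x : R) (k : int) : cos (x + 2 * pi * k%:~R) = cos x.
Proof. by rewrite -!sinDpihalf addrAC sin_perZ. Qed.

Lemma I01_cos_int (k : int) (d : R) : k != 0 ->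
  I01 (fun t => cos (2 * pi * k%:~R * t + d)) = 0.
Proof.
move=> k0; set c := 2 * pi * k%:~R.
have c0 : c != 0 by rewrite !mulf_neq0 ?pnatr_eq0 ?intr_eq0 // lt0r_neq0 // pi_gt0.
have D x : is_derive x (1:R) (fun t => c^-1 * sin (c * t + d)) (cos (c * x + d)).
  by have := dZ c^-1 (dsin c d x); rewrite mulrA mulVf // mul1r.
have C : continuous (fun t => cos (c * t + d)) := dC_cont (Cinf1_Cn (Cinf1_cos c d) 0).
by rewrite (I01E C D) mulr1 mulr0 addrC [c + d]addrC sin_perZ add0r addrC subrr.
Qed.

End Fourier1.

(** * Fourier coefficients and Bessel's inequality *)

Section Fourier2.
Variable R : realType.
Notation mu := (@lebesgue_measure R).
Notation T := (measurableTypeR R).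
Implicit Types (q H : R -> R).

(** The phase d makes the cosine coefficient, the sine coefficient and the
    k-th term of the Fourier series at a point instances of one integral. *)
Definition fcoef q (k : int) (d : R) := I01 (fun t => q t * cos (2 * pi * k%:~R * t + d)).

Lemma cont_cosl (c d : R) : continuous (fun t => cos (c * t + d)).
Proof. exact: dC_cont (Cinf1_Cn (Cinf1_cos c d) 0). Qed.

Lemma cont_sinl (c d : R) : continuous (fun t => sin (c * t + d)).
Proof. exact: dC_cont (Cinf1_Cn (Cinf1_sin c d) 0). Qed.

Arguments cont_cosl : clear implicits.
Arguments cont_sinl : clear implicits.

Lemma cont_mul1 q H : continuous q -> continuous H -> continuous (fun t => q t * H t).
Proof. by move=> c1 c2 x; apply: continuousM; [exact: c1|exact: c2]. Qed.

Lemma cont_sub1 q H : continuous q -> continuous H -> continuous (fun t => q t - H t).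
Proof. by move=> c1 c2 x; apply: continuousB; [exact: c1|exact: c2]. Qed.

Lemma fcoef_bound q k d (M : R) : continuous q -> (forall t : R, 0 < t < 1 -> `|q t| <= M) -> `|fcoef q k d| <= M.
Proof.
move=> cq H; apply: I01_norm.
  by apply: cont_int01; apply: cont_mul1 => //; exact: cont_cosl.
move=> t t01; rewrite normrM; apply: le_trans (H t t01).
by rewrite ler_piMr // cos_max.
Qed.

Lemma fcoef_parts q q' q'' (k : int) d : k != 0 ->
  (forall x : R, is_derive x (1:R) q (q' x)) -> (forall x : R, is_derive x (1:R) q' (q'' x)) ->
  continuous q'' -> q 0 = q 1 -> q' 0 = q' 1 ->
  fcoef q k d = - (2 * pi * k%:~R) ^- 2 * fcoef q'' k d.
Proof.
move=> k0 dq dq' cq'' e e'; rewrite /fcoef; set c := 2 * pi * k%:~R.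
have c0 : c != 0 by rewrite !mulf_neq0 ?pnatr_eq0 ?intr_eq0 // lt0r_neq0 // pi_gt0.
have cq' := derive_continuous dq'; have cq := derive_continuous dq.
have DG (x : R) : is_derive x (1:R) (fun t => c^-1 * sin (c * t + d)) (cos (c * x + d)).
  by have := dZ c^-1 (dsin c d x); rewrite mulrA mulVf // mul1r.
have DH (x : R) : is_derive x (1:R) (fun t => - c ^- 2 * cos (c * t + d)) (c^-1 * sin (c * x + d)).
  have := dZ (- c ^- 2) (dcos c d x); rewrite mulrA mulNr mulrN opprK.
  by rewrite (_ : c ^- 2 * c = c^-1) //; field.
have per (f : R -> R) : f = sin \/ f = cos -> f (c * 1 + d) = f (c * 0 + d).
  by rewrite mulr1 mulr0 add0r addrC => -[] ->; [exact: sin_perZ|exact: cos_perZ].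
rewrite (I01_parts cq' (cont_cosl c d) dq DG).
have cG : continuous (fun t => c^-1 * sin (c * t + d)) := derive_continuous DG.
rewrite (I01_parts cq'' cG dq' DH).
rewrite (per sin) ?(per cos); [|by right|by left].
rewrite -e -e' !subrr !sub0r opprK -I01Z; last first.
  by apply: cont_int01; apply: cont_mul1 => //; exact: cont_cosl.
by apply: eq_I01 => t _; rewrite mulrCA.
Qed.

(** Two integrations by parts, without boundary terms because q and q' agree
    at both ends, produce the factor (2 pi k)^-2. *)
Lemma fcoef_decay q q' q'' (k : int) (d M0 M2 : R) :
  (forall x : R, is_derive x (1:R) q (q' x)) -> (forall x : R, is_derive x (1:R) q' (q'' x)) ->
  continuous q'' -> q 0 = q 1 -> q' 0 = q' 1 ->
  (forall t : R, 0 < t < 1 -> `|q t| <= M0) -> (forall t : R, 0 < t < 1 -> `|q'' t| <= M2) ->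
  `|fcoef q k d| <= 2 * (M0 + M2) * wt R k.
Proof.
move=> dq dq' cq'' e e' h0 h2.
have half : 0 < (2^-1 : R) < 1 by apply/andP; split; lra.
have M00 : 0 <= M0 := le_trans (normr_ge0 _) (h0 _ half).
have M20 : 0 <= M2 := le_trans (normr_ge0 _) (h2 _ half).
have cq' := derive_continuous dq'; have cq := derive_continuous dq.
have [->|k0] := eqVneq k 0.
  apply: le_trans (fcoef_bound _ _ cq h0) _.
  rewrite /wt mulr0z expr0n addr0 invr1 mulr1; lra.
rewrite (fcoef_parts d k0 dq dq') // normrM.
apply: (@le_trans _ _ (`|- (2 * pi * k%:~R) ^- 2| * M2)).
  by rewrite ler_wpM2l //; exact: fcoef_bound.
have k2 : 1 <= (k%:~R : R) ^+ 2.
  rewrite -rmorphXn /= -[1]/(1%:~R) ler_int -gtz0_ge1 lt_def sqr_ge0 andbT.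
  by rewrite expf_neq0.
have p2 : 1 <= (2 * pi : R) ^+ 2.
  have : 2 <= pi :> R := pi_ge2 R.
  by move=> h; rewrite expr_ge1 //; nra.
rewrite normrN normfV ger0_norm ?sqr_ge0 // exprMn /wt.
set a := (2 * pi) ^+ 2 in p2 *; set b := k%:~R ^+ 2 in k2 *.
have h : (a * b)^-1 <= 2 / (1 + b).
  rewrite ler_pdivlMr; last lra.
  rewrite mulrC ler_pdivrMr; nra.
apply: (@le_trans _ _ (2 / (1 + b) * M2)); first by rewrite ler_wpM2r.
have w0 : 0 <= (1 + b)^-1 by rewrite invr_ge0; lra.
by have := mulr_ge0 w0 M00; lra.
Qed.

Lemma odd2R n : (2 * n + 1)%:R = 2 * n%:R + 1 :> R.
Proof. by rewrite addn1 -natr1 natrM. Qed.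

(** Multiplication by sin (pi u) makes the sum of cosines telescope. *)
Lemma Dirichlet (u : R) N :
  sin (pi * u) * sZ N (fun k => cos (2 * pi * k%:~R * u)) = sin ((2 * N + 1)%:R * pi * u).
Proof.
elim: N => [|N IH].
  by rewrite sZ0 mulr0z mulr0 mul0r cos0 mulr1 muln0 add0n mul1r.
rewrite sZS mulrDr IH mulrNz mulrN mulNr cosN.
have -> : (2 * N.+1 + 1)%:R * pi * u = 2 * pi * (Posz N.+1)%:~R * u + pi * u.
  by rewrite -[(Posz N.+1)%:~R]/(N.+1%:R) !odd2R -natr1; ring.
have -> : (2 * N + 1)%:R * pi * u = 2 * pi * (Posz N.+1)%:~R * u - pi * u.
  by rewrite -[(Posz N.+1)%:~R]/(N.+1%:R) !odd2R -natr1; ring.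
rewrite sinB sinD; ring.
Qed.

(** The numerator of the Dirichlet kernel centred at y. For fixed y these
    functions are orthogonal on (0,1). *)
Definition osin (y : R) (n : nat) (t : R) := sin ((2 * n + 1)%:R * pi * (t - y)).

Lemma cont_osin y n : continuous (osin y n).
Proof.
have := cont_sinl ((2 * n + 1)%:R * pi) (- ((2 * n + 1)%:R * pi * y)).
by rewrite (_ : (fun t => sin _) = osin y n) //; apply/funext => t; rewrite /osin mulrBr.
Qed.

Lemma osin_norm y n t : `|osin y n t| <= 1.
Proof. exact: sin_max. Qed.

Lemma osin_orth_lt y n m : (n < m)%N -> I01 (fun t => osin y n t * osin y m t) = 0.
Proof.
move=> nm.
pose k1 : int := (m - n)%N; pose k2 : int := (m + n + 1)%N.
have e1 : I01 (fun t => cos (2 * pi * k1%:~R * t + (- (2 * pi * k1%:~R * y)))) = 0.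
  by apply: I01_cos_int; rewrite /k1 eqz_nat -lt0n subn_gt0.
have e2 : I01 (fun t => cos (2 * pi * k2%:~R * t + (- (2 * pi * k2%:~R * y)))) = 0.
  by apply: I01_cos_int; rewrite /k2 eqz_nat addn1.
have -> : I01 (fun t => osin y n t * osin y m t) =
   I01 (fun t => 2^-1 * (cos (2 * pi * k1%:~R * t + (- (2 * pi * k1%:~R * y)))
      - cos (2 * pi * k2%:~R * t + (- (2 * pi * k2%:~R * y))))).
  apply: eq_I01 => t _; rewrite /osin -!mulrBr.
  set a := (2 * n + 1)%:R * pi * (t - y); set b := (2 * m + 1)%:R * pi * (t - y).
  have -> : 2 * pi * k1%:~R * (t - y) = b - a.
    rewrite /k1 -[_%:~R]/((m - n)%N%:R) natrB ?(ltnW nm) // /a /b !odd2R; ring.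
  have -> : 2 * pi * k2%:~R * (t - y) = b + a.
    rewrite /k2 -[_%:~R]/((m + n + 1)%N%:R) 2!natrD /a /b !odd2R; ring.
  by rewrite cosB cosD; field.
have i1 := cont_int01 (cont_cosl (2 * pi * k1%:~R) (- (2 * pi * k1%:~R * y))).
have i2 := cont_int01 (cont_cosl (2 * pi * k2%:~R) (- (2 * pi * k2%:~R * y))).
have i12 := cont_int01 (cont_sub1 (cont_cosl (2 * pi * k1%:~R) (- (2 * pi * k1%:~R * y)))
  (cont_cosl (2 * pi * k2%:~R) (- (2 * pi * k2%:~R * y)))).
have E1 := I01Z 2^-1 i12; have E2 := I01B i1 i2; cbv beta in E1, E2.
by rewrite E1 E2 e1 e2 subrr mulr0.
Qed.

Lemma osin_sq y n : I01 (fun t => osin y n t * osin y n t) = 2^-1.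
Proof.
pose k2 : int := (n + n + 1)%N.
have e2 : I01 (fun t => cos (2 * pi * k2%:~R * t + (- (2 * pi * k2%:~R * y)))) = 0.
  by apply: I01_cos_int; rewrite /k2 eqz_nat addn1.
have -> : I01 (fun t => osin y n t * osin y n t) =
   I01 (fun t => 2^-1 * (1 - cos (2 * pi * k2%:~R * t + (- (2 * pi * k2%:~R * y))))).
  apply: eq_I01 => t _; rewrite /osin -!mulrBr.
  set a := (2 * n + 1)%:R * pi * (t - y).
  have -> : 2 * pi * k2%:~R * (t - y) = a + a.
    rewrite /k2 -[_%:~R]/((n + n + 1)%N%:R) 2!natrD /a !odd2R; ring.
  by have := cos2Dsin2 a; rewrite cosD; move: (cos a) (sin a) => c s E; lra.
have c1 : continuous (fun _ : R => 1 : R) by move=> x; exact: cvg_cst.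
have i2 := cont_int01 (cont_cosl (2 * pi * k2%:~R) (- (2 * pi * k2%:~R * y))).
have i12 := cont_int01 (cont_sub1 c1 (cont_cosl (2 * pi * k2%:~R) (- (2 * pi * k2%:~R * y)))).
have E1 := I01Z 2^-1 i12; have E2 := I01B (cont_int01 c1) i2; cbv beta in E1, E2.
by rewrite E1 E2 e2 I01_cst subr0 mulr1.
Qed.

Lemma osin_orth y n m : n != m -> I01 (fun t => osin y n t * osin y m t) = 0.
Proof.
rewrite neq_ltn => /orP[|nm]; first exact: osin_orth_lt.
by rewrite -(osin_orth_lt y nm); apply: eq_I01 => t _; rewrite mulrC.
Qed.

Lemma m01 : measurable (`]0:R, 1:R[%classic : set T).
Proof. exact: measurable_itv. Qed.

Lemma int01D (f g : R -> R) : int01 f -> int01 g -> int01 (fun t => f t + g t).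
Proof. by move=> hf hg; have := integrableD m01 hf hg. Qed.

Lemma int01Z (c : R) (f : R -> R) : int01 f -> int01 (fun t => c * f t).
Proof. by move=> hf; have := integrableZl m01 c hf. Qed.

Lemma int01_ext (f g : R -> R) : (forall t, f t = g t) -> int01 f -> int01 g.
Proof. by move=> /funext ->. Qed.

Lemma bounded_int01 (f : R -> R) (M : R) :
  measurable_fun (`]0, 1[%classic : set T) (f : T -> T) ->
  (forall x : R, 0 < x < 1 -> `|f x| <= M) -> int01 f.
Proof.
move=> mf fM; apply: measurable_bounded_integrable => //.
  by rewrite /= lebesgue_measure_itv /= lte_fin ltr01 oppr0 adde0 ltry.
exists M; split; first exact: num_real.
move=> N MN x /=; rewrite in_itv /= => x01; apply: le_trans (fM x x01) _; exact: ltW.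
Qed.

(** Bessel's inequality makes the squares of these coefficients summable. *)
Lemma Bessel (y : R) H (M : R) : measurable_fun (`]0, 1[%classic : set T) (H : T -> T) ->
  (forall x : R, 0 < x < 1 -> `|H x| <= M) ->
  tends0 (fun n => I01 (fun t => H t * osin y n t)).
Proof.
move=> mH bH.
have mosin n : measurable_fun (`]0, 1[%classic : set T) (osin y n : T -> T).
  apply: (@measurable_funS _ _ _ _ setT) => //.
  by apply: continuous_measurable_fun; exact: cont_osin.
have iHosin n : int01 (fun t => H t * osin y n t).
  apply: (@bounded_int01 _ M); first exact: (measurable_funM mH (mosin n)).
  move=> x x01; rewrite normrM; apply: le_trans (bH x x01).
  by rewrite ler_piMr // osin_norm.
have iHH : int01 (fun t => H t * H t).
  apply: (@bounded_int01 _ (M * M)); first exact: (measurable_funM mH mH).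
  by move=> x x01; rewrite normrM ler_pM // bH.
have ipp n m : int01 (fun t => osin y n t * osin y m t).
  by apply: cont_int01; apply: cont_mul1; exact: cont_osin.
pose a n := I01 (fun t => H t * osin y n t).
(* The residual after n terms of the orthogonal expansion of H. *)
pose r n t := H t - \sum_(i < n) 2 * a i * osin y i t.
have rS n t : r n.+1 t = r n t - 2 * a n * osin y n t.
  by rewrite /r big_ord_recr /= opprD addrA.
have irp n m : int01 (fun t => r n t * osin y m t).
  elim: n => [|n IH].
    by apply: int01_ext (iHosin m) => t; rewrite /r big_ord0 subr0.
  apply: int01_ext (int01D IH (int01Z (- (2 * a n)) (ipp n m))) => t.
  by rewrite rS; ring.
have irr n : int01 (fun t => r n t * r n t).
  elim: n => [|n IH].
    by apply: int01_ext iHH => t; rewrite /r big_ord0 subr0.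
  apply: int01_ext (int01D IH (int01D (int01Z (- (4 * a n)) (irp n n)) (int01Z (4 * a n ^+ 2) (ipp n n)))) => t.
  by rewrite rS; ring.
have rosin n m : (n <= m)%N -> I01 (fun t => r n t * osin y m t) = a m.
  elim: n => [|n IH] nm.
    by apply: eq_I01 => t _; rewrite /r big_ord0 subr0.
  have E := I01D (irp n m) (int01Z (- (2 * a n)) (ipp n m)); cbv beta in E.
  have -> : I01 (fun t => r n.+1 t * osin y m t) =
     I01 (fun t => r n t * osin y m t + - (2 * a n) * (osin y n t * osin y m t)).
    by apply: eq_I01 => t _; rewrite rS; ring.
  have n_m : n != m by rewrite neq_ltn nm.
  rewrite E (IH (ltnW nm)) (I01Z _ (ipp n m)) (osin_orth y n_m) mulr0 addr0.
  reflexivity.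
have rr n : I01 (fun t => r n.+1 t * r n.+1 t) = I01 (fun t => r n t * r n t) - 2 * a n ^+ 2.
  have E := I01D (irr n) (int01D (int01Z (- (4 * a n)) (irp n n)) (int01Z (4 * a n ^+ 2) (ipp n n))).
  have E2 := I01D (int01Z (- (4 * a n)) (irp n n)) (int01Z (4 * a n ^+ 2) (ipp n n)).
  cbv beta in E, E2.
  have -> : I01 (fun t => r n.+1 t * r n.+1 t) = I01 (fun t => r n t * r n t +
     (- (4 * a n) * (r n t * osin y n t) + 4 * a n ^+ 2 * (osin y n t * osin y n t))).
    by apply: eq_I01 => t _; rewrite rS; ring.
  rewrite E E2 (I01Z _ (irp n n)) (I01Z _ (ipp n n)) (rosin _ _ (leqnn n)) osin_sq.
  by move: (I01 _) (a n) => u v; field.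
have ge0 n : 0 <= I01 (fun t => r n t * r n t).
  by apply: Rintegral_ge0 => t _; rewrite -expr2 sqr_ge0.
have sum n : series (fun n => a n ^+ 2) n <= I01 (fun t => H t * H t).
  suff -> : series (fun n => a n ^+ 2) n = 2^-1 * (I01 (fun t => H t * H t) - I01 (fun t => r n t * r n t)).
    have HH0 : 0 <= I01 (fun t => H t * H t).
      by apply: Rintegral_ge0 => t _; rewrite -expr2 sqr_ge0.
    have := ge0 n; move: HH0; generalize (I01 (fun t => r n t * r n t)) (I01 (fun t => H t * H t)) => u v; lra.
  elim: n => [|n IH].
    rewrite /series /= big_geq //.
    have -> : I01 (fun t => r 0%N t * r 0%N t) = I01 (fun t => H t * H t).
      by apply: eq_I01 => t _; rewrite /r big_ord0 subr0.
    by rewrite subrr mulr0.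
  rewrite /series /= big_nat_recr //= -[X in X + _]/(series (fun n => a n ^+ 2) n) IH rr.
  by move: (I01 _) (I01 _) (a n) => u v w; field.
have C : cvgn (series (fun n => a n ^+ 2)).
  apply: nondecreasing_is_cvgn.
    apply: homo_leq => [//|p q s|n]; first exact: le_trans.
    by rewrite /series /= big_nat_recr //= lerDl sqr_ge0.
  by exists (I01 (fun t => H t * H t)) => _ [n _ <-].
have T0 := tends0_cvg (cvg_series_cvg_0 C).
move=> e e0; have [N NP] := T0 _ (mulr_gt0 e0 e0); exists N => n /NP.
rewrite ger0_norm ?sqr_ge0 // -/(a n) => h.
by rewrite -(ler_pXn2r (n := 2)) ?nnegrE ?(ltW e0) // real_normK ?num_real // expr2.
Qed.

End Fourier2.

Arguments cont_cosl {R} c d.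
Arguments cont_sinl {R} c d.

(** * Uniform convergence of Fourier series *)

Section Fourier3.
Variable R : realType.
Notation mu := (@lebesgue_measure R).
Notation T := (measurableTypeR R).
Implicit Types (q H : R -> R).

(** With z = x/2 one has sin z >= z cos z by the mean value theorem, so sin x
    = 2 sin z cos z >= z (1 + cos x) >= z. *)
Lemma sin_ge_half (x : R) : 0 <= x <= pi / 2 -> x / 2 <= sin x.
Proof.
move=> /andP[x0 xp]; pose z := x / 2.
have z0 : 0 <= z by rewrite divr_ge0.
have zp : z <= pi / 2 by rewrite /z; lra.
have ds (t : R) : is_derive t (1:R) sin (cos t) := is_derive_sin t.
have [c cz E] := MVT_incr 0 z ds.
rewrite add0r sin0 subr0 in E.
have [c'|c'|//] := ltrgtP (sin z) (z * cos z).
  have czz : cos z <= cos c.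
    rewrite -(cos_norm c); rewrite subr0 (ger0_norm z0) in cz.
    have pi0 := pi_gt0 R.
    have [-> //|ne] := eqVneq z `|c|.
    rewrite ltW // ltr_cos ?in_itv /= ?normr_ge0 ?z0 /=; [|lra|lra].
    by rewrite lt_neqAle eq_sym ne.
  by move: c'; rewrite E ltNge ler_wpM2l.
all: have cz0 : 0 <= cos z by apply: cos_ge0_pihalf; apply/andP; split => //; lra.
all: have ex : sin x = 2 * (cos z * sin z) by
  rewrite mulr_natl -sin_mulr2n -mulr_natl /z; congr sin; field.
all: have ec : cos x = 2 * cos z ^+ 2 - 1 by
  rewrite mulr_natl -cos_mulr2n -[z *+ 2]mulr_natl /z; congr cos; field.
all: have cx0 : 0 <= cos x by apply: cos_ge0_pihalf; apply/andP; split => //; lra.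
all: have zz : x = 2 * z by rewrite /z; field.
  rewrite ex {1}zz; have := ler_wpM2l cz0 (ltW c'); have : 0 <= z * (2 * cos z ^+ 2 - 1) by rewrite mulr_ge0 // -ec.
  by move: (cos z) (sin z) => a b; nra.
move=> c'; rewrite ex {1}zz c'; have : 0 <= z * (2 * cos z ^+ 2 - 1) by rewrite mulr_ge0 // -ec.
by move: (cos z) => a; nra.
Qed.

(** For t and y in (0,1) the difference u = t - y stays away from 1 and -1,
    where sin (pi u) vanishes as it does at 0. *)
Lemma sin_lower (u m : R) : `|u| <= m -> m < 1 -> (1 - m) * `|u| <= `|sin (pi * u)|.
Proof.
have pi2 := pi_ge2 R.
wlog u0 : u / 0 <= u.
  move=> H um m1; have [/H h|/ltW u0] := leP 0 u; first exact: h.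
  by have := H (- u); rewrite normrN mulrN sinN normrN oppr_ge0; exact.
move=> um m1; rewrite ger0_norm // in um *.
apply: le_trans (ler_norm _).
have [uh|uh] := leP u (1 / 2).
  apply: (@le_trans _ _ (pi * u / 2)); first by nra.
  by apply: sin_ge_half; apply/andP; split; nra.
have -> : sin (pi * u) = sin (pi * (1 - u)).
  by rewrite mulrBr mulr1 sinB sinpi cospi mul0r sub0r mulN1r opprK.
apply: (@le_trans _ _ (pi * (1 - u) / 2)); first by nra.
by apply: sin_ge_half; apply/andP; split; nra.
Qed.

Lemma MVT_between (F F' : R -> R) (x y : R) : (forall t : R, is_derive t (1:R) F (F' t)) ->
  exists2 c : R, (x <= c <= y) || (y <= c <= x) & F y - F x = (y - x) * F' c.
Proof.
move=> dF; have cF := derive_continuous dF.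
have [xy|/ltW xy] := leP x y.
  have [c] := @MVT_segment R F F' x y xy (fun t _ => dF t) (continuous_subspaceT cF).
  by rewrite in_itv /= => cxy ->; exists c; rewrite ?cxy // mulrC.
have [c] := @MVT_segment R F F' y x xy (fun t _ => dF t) (continuous_subspaceT cF).
rewrite in_itv /= => cxy E; exists c; first by rewrite cxy orbT.
by rewrite -opprB E; ring.
Qed.

Lemma int01_sZ N (g : int -> R -> R) : (forall k, int01 (g k)) ->
  int01 (fun t => sZ N (fun k => g k t)) /\
  I01 (fun t => sZ N (fun k => g k t)) = sZ N (fun k => I01 (g k)).
Proof.
move=> ig; elim: N => [|N [IH1 IH2]].
  split; first by apply: int01_ext (ig 0) => t; rewrite sZ0.
  by rewrite sZ0; apply: eq_I01 => t _; rewrite sZ0.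
have i1 := int01D (ig (Posz N.+1)) (ig (- Posz N.+1)).
have E1 := I01D (ig (Posz N.+1)) (ig (- Posz N.+1)).
have i2 := int01D IH1 i1; have E2 := I01D IH1 i1; cbv beta in E2, i2.
split; first by apply: int01_ext i2 => t; rewrite sZS.
rewrite sZS -IH2 -E1 -E2; apply: eq_I01 => t _; by rewrite sZS.
Qed.

Definition fsum q (N : nat) (y : R) := sZ N (fun k => fcoef q k (- (2 * pi * k%:~R * y))).

Lemma sZ_delta N (c : R) : sZ N (fun k : int => if k == 0 then c else 0) = c.
Proof.
elim: N => [|N IH]; first by rewrite sZ0.
by rewrite sZS IH /= !addr0.
Qed.

(** By the Dirichlet kernel the error is the integral of (q t - q y) / sin (pi
    (t - y)) against osin y N. The quotient is bounded because q is Lipschitz,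
    so the integrals tend to 0 by Bessel. *)
Lemma fsum_cvg q q' (y : R) : 0 < y < 1 ->
  (forall x : R, is_derive x (1:R) q (q' x)) -> continuous q' ->
  tends0 (fun N => fsum q N y - q y).
Proof.
move=> /andP[y0 y1] dq cq'.
have cq : continuous q := derive_continuous dq.
pose m := Num.max y (1 - y).
have m1 : m < 1 by rewrite gt_max y1 /=; lra.
have tm (t : R) : 0 < t < 1 -> `|t - y| <= m.
  move=> /andP[t0 t1]; rewrite ler_norml.
  have : y <= m /\ 1 - y <= m by rewrite !le_max !lexx orbT.
  by move=> [? ?]; apply/andP; split; lra.
have [L L0 HL] := cont1_bounded cq'.
have lip (t : R) : 0 < t < 1 -> `|q t - q y| <= L * `|t - y|.
  move=> /andP[t0 t1]; have [c cy E] := MVT_between y t dq.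
  rewrite E normrM mulrC ler_wpM2r // HL //.
  by case/orP: cy => /andP[c1 c2]; apply/andP; split; lra.
pose s (t : R) := sin (pi * (t - y)).
have cs : continuous s.
  have := cont_sinl pi (- (pi * y)); rewrite (_ : (fun t => sin _) = s) //.
  by apply/funext => t; rewrite /s mulrBr.
have s0 (t : R) : 0 < t < 1 -> s t = 0 -> t = y.
  move=> t01 st; have := sin_lower (tm t t01) m1; rewrite -/(s t) st normr0.
  rewrite pmulr_rle0; last by rewrite subr_gt0.
  by rewrite normr_le0 subr_eq0 => /eqP.
(* This equals (q t - q y) / s t, also where s vanishes, and is measurable as
   it stands. *)
pose H (t : R) := (q t - q y) * s t * ((s t * s t) `^ (-1)).
have HE (t : R) : H t = (q t - q y) / s t.
  rewrite /H powR_inv1 -?expr2 ?sqr_ge0 //.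
  by have [->|h] := eqVneq (s t) 0; [rewrite invr0 !mulr0 mul0r|field].
have mH : measurable_fun (`]0, 1[%classic : set T) (H : T -> T).
  have mc (f : R -> R) : continuous f -> measurable_fun setT (f : T -> T).
    exact: continuous_measurable_fun.
  apply: (@measurable_funS _ _ _ _ setT) => //.
  apply: (@measurable_funM _ _ _ setT (fun t => (q t - q y) * s t) (fun t => (s t * s t) `^ (-1))).
    by apply: mc; apply: cont_mul1 => //; apply: cont_sub1 => // x; exact: cvg_cst.
  apply: (measurableT_comp (measurable_powR (-1))).
  by apply: mc; exact: cont_mul1.
have bH (t : R) : 0 < t < 1 -> `|H t| <= L / (1 - m).
  move=> t01; rewrite HE normrM normfV.
  have [st|st] := eqVneq (s t) 0.
    by rewrite (s0 t t01 st) subrr normr0 mul0r divr_ge0 // subr_ge0 ltW.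
  rewrite ler_pdivrMr ?normr_gt0 //.
  apply: le_trans (lip t t01) _.
  have := sin_lower (tm t t01) m1; rewrite -/(s t) => h.
  rewrite -mulrA ler_wpM2l // mulrC ler_pdivlMr ?subr_gt0 // mulrC.
  exact: h.
suff -> : (fun N => fsum q N y - q y) = fun N => I01 (fun t => H t * osin y N t).
  exact: (Bessel y mH bH).
apply/funext => N.
pose d (k : int) := - (2 * pi * k%:~R * y) : R.
pose g (k : int) (t : R) := (q t - q y) * cos (2 * pi * k%:~R * t + d k).
have cqy : continuous (fun t => q t - q y) by apply: cont_sub1 => // x; exact: cvg_cst.
have ig k : int01 (g k) by apply: cont_int01; apply: cont_mul1 => //; exact: cont_cosl.
have [_ E1] := int01_sZ N ig.
have E2 k : I01 (g k) = fcoef q k (d k) + - q y * (if k == 0 then 1 else 0).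
  have i1 : int01 (fun t => q t * cos (2 * pi * k%:~R * t + d k)).
    by apply: cont_int01; apply: cont_mul1 => //; exact: cont_cosl.
  have i2 := cont_int01 (cont_cosl (2 * pi * k%:~R) (d k)).
  have F1 := I01D i1 (int01Z (- q y) i2); have F2 := I01Z (- q y) i2; cbv beta in F1, F2.
  have -> : I01 (g k) = I01 (fun t => q t * cos (2 * pi * k%:~R * t + d k) +
      - q y * cos (2 * pi * k%:~R * t + d k)).
    by apply: eq_I01 => t _; rewrite /g mulrDl.
  rewrite F1 F2; congr (_ + _ * _); have [->|k0] := eqVneq k 0; last exact: I01_cos_int.
  rewrite -[RHS]I01_cst; apply: eq_I01 => t _.
  by rewrite /d !mulr0z !mulr0 !mul0r oppr0 addr0 cos0.
rewrite (eq_sZ N E2) sZD sZM sZ_delta mulr1 in E1.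
rewrite -[LHS]E1; apply: eq_I01 => t t01.
rewrite /g sZM HE /osin -mulrA -Dirichlet -/(s t).
have -> : sZ N (fun k => cos (2 * pi * k%:~R * t + d k)) =
          sZ N (fun k => cos (2 * pi * k%:~R * (t - y))).
  by apply: eq_sZ => k; rewrite /d mulrBr.
have [st|st] := eqVneq (s t) 0.
  by rewrite (s0 t t01 st) subrr !mul0r.
by move: (sZ _ _) (q t) (q y) => u v w; field.
Qed.

(** The terms are bounded by a multiple of the summable sequence wt, so the
    tail of that sequence turns pointwise convergence into a bound that does
    not depend on y. *)
Lemma fsum_unif q q' q'' (M0 M2 y : R) : 0 < y < 1 ->
  (forall x : R, is_derive x (1:R) q (q' x)) -> (forall x : R, is_derive x (1:R) q' (q'' x)) ->
  continuous q'' -> q 0 = q 1 -> q' 0 = q' 1 ->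
  (forall t : R, 0 < t < 1 -> `|q t| <= M0) -> (forall t : R, 0 < t < 1 -> `|q'' t| <= M2) ->
  forall M, `|q y - fsum q M y| <= 2 * (M0 + M2) * (swt R - sZ M (wt R)).
Proof.
move=> y01 dq dq' cq'' e e' h0 h2 M.
have cq' : continuous q' := derive_continuous dq'.
have C := fsum_cvg y01 dq cq'.
have D k : `|fcoef q k (- (2 * pi * k%:~R * y))| <= 2 * (M0 + M2) * wt R k.
  exact: fcoef_decay dq dq' cq'' e e' h0 h2.
apply/ler_addgt0Pl => eps /C [N NP].
have h1 := NP _ (leq_maxl N M).
have h3 := sZ_cauchy D (leq_maxr N M).
have -> : q y - fsum q M y = - (fsum q (maxn N M) y - q y) + (fsum q (maxn N M) y - fsum q M y) by ring.
by apply: le_trans (ler_normD _ _) _; rewrite normrN lerD.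
Qed.

End Fourier3.

(** * Cut-off functions *)

Section Bumps.
Variable R : realType.
Notation T := (measurableTypeR R).
Implicit Types (u t a b : R).

Definition pospow (n : nat) (u : R) : R := Num.max u 0 ^+ n.

Lemma cont_pospow n : continuous (pospow n).
Proof.
have c1 : continuous (fun u : R => Num.max u 0).
  move=> u; apply: (@continuous_max _ _ (fun u : R => u) (fun=> 0)); first exact: cvg_id.
  exact: cvg_cst.
elim: n => [|n IH].
  by rewrite (_ : pospow 0 = fun=> 1); [move=> x; exact: cvg_cst|apply/funext => u; rewrite /pospow expr0].
rewrite (_ : pospow n.+1 = fun u => Num.max u 0 * pospow n u); last by apply/funext => u; rewrite /pospow exprS.
exact: cont_mul1.
Qed.

Lemma pospow_neg n u : u <= 0 -> pospow n.+1 u = 0.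
Proof. by move=> u0; rewrite /pospow max_r // expr0n. Qed.

Lemma dpow n u : is_derive u (1:R) (fun v : R => v ^+ n.+1) (n.+1%:R * u ^+ n).
Proof.
elim: n => [|n IH].
  by have := did u; rewrite expr0 mulr1 (_ : (fun v : R => v ^+ 1) = id).
have h := dM (did u) IH; rewrite (_ : (fun v : R => v ^+ n.+2) = fun v => v * v ^+ n.+1); last first.
  by apply/funext => v; rewrite exprS.
apply: (is_derive_eq h); rewrite -[in RHS]natr1 exprS; ring.
Qed.

Lemma dpospow n u : is_derive u (1:R) (pospow n.+2) (n.+2%:R * pospow n.+1 u).
Proof.
have [u0|u0|u0] := ltrgtP u 0.
- rewrite pospow_neg ?ltW // mulr0.
  refine (near_eq_is_derive _ (dcst 0 u)).
  near=> v; rewrite pospow_neg // ltW //; near: v; exact: lt_nbhsl.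
- have d : is_derive u (1:R) (fun v : R => v ^+ n.+2) (n.+2%:R * pospow n.+1 u).
    by rewrite /pospow max_l ?ltW //; exact: dpow.
  refine (near_eq_is_derive _ d).
  near=> v; rewrite /pospow max_l // ltW //; near: v; exact: lt_nbhsr.
- rewrite u0 pospow_neg // mulr0; apply/is_derive1_epsP => e e0.
  exists (Num.min e 1); first by rewrite lt_min e0 ltr01.
  move=> h; rewrite lt_min => /andP[he h1].
  rewrite add0r mulr0 subr0 (pospow_neg _ (lexx 0)) subr0 /pospow normrX.
  have m : `|Num.max h 0| <= `|h|.
    rewrite /Num.max; case: ifP => _; rewrite ?normr0 //.
  apply: (@le_trans _ _ (`|h| ^+ n.+2)); first by rewrite lerXn2r ?nnegrE.
  rewrite exprS mulrC ler_wpM2r // exprS.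
  apply: (@le_trans _ _ (`|h| * 1)); last by rewrite mulr1 ltW.
  by rewrite ler_wpM2l // exprn_ile1 // ltW.
Unshelve. all: by end_near. Qed.

Lemma dC_pospow n : dC n (pospow n.+1).
Proof.
elim: n => [|n IH]; first exact: cont_pospow.
apply: (@dCS _ _ _ (fun u => n.+2%:R * pospow n.+1 u)); first exact: dpospow.
by apply: dC_mul => //; exact: Cinf1_Cn (Cinf1_cst _) _.
Qed.

Lemma dC_inv n (g : R -> R) : (forall u, 0 < g u) -> dC n g -> dC n (fun u => (g u)^-1).
Proof.
move=> g0; elim: n => [|n IH].
  by move=> cg x; apply: continuousV; [exact: lt0r_neq0|exact: cg].
move=> dg; have dg' := dC_le dg; have [cg [g' dgg hg']] := dg.
apply: (@dCS _ _ _ (fun u => -1 * (g' u * ((g u)^-1 * (g u)^-1)))).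
  move=> x; have := is_deriveV (lt0r_neq0 (g0 x)) (dgg x).
  rewrite /GRing.scale /= => h; apply: (is_derive_eq h).
  by rewrite -exprVn expr2; ring.
apply: dC_mul; first exact: Cinf1_Cn (Cinf1_cst _) _.
by apply: dC_mul => //; apply: dC_mul; exact: IH.
Qed.

Lemma dC_aff n (g : R -> R) c d : dC n g -> dC n (fun u => g (c * u + d)).
Proof.
elim: n g => [|n IH] g.
  move=> cg x; apply: (@continuous_comp _ _ _ (fun u => c * u + d) g); last exact: cg.
  by apply: continuousD; [apply: continuousM; [exact: cvg_cst|exact: cvg_id]|exact: cvg_cst].
move=> [cg [g' dg hg]]; apply: (@dCS _ _ _ (fun u => g' (c * u + d) * c)).
  move=> x; have da := dD (dZ c (did x)) (dcst d x); rewrite mulr1 addr0 in da.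
  exact: (@dcomp _ g (fun u => c * u + d) _ _ _ (dg _) da).
by apply: dC_mul; [exact: IH|exact: Cinf1_Cn (Cinf1_cst _) _].
Qed.

(** Two continuous derivatives suffice for the decay of Fourier coefficients.
    *)
Definition ramp (u : R) := pospow 3 u * (1 + pospow 3 u)^-1.

Lemma pospow_ge0 n u : 0 <= pospow n u.
Proof. by rewrite exprn_ge0 // le_max lexx orbT. Qed.

Lemma dC_ramp : dC 2 ramp.
Proof.
have d := dC_pospow 2; apply: dC_mul => //; apply: dC_inv.
  by move=> u; rewrite ltr_pwDl // pospow_ge0.
by apply: dC_add => //; exact: Cinf1_Cn (Cinf1_cst _) _.
Qed.

Lemma ramp_ge0 u : 0 <= ramp u.
Proof. by rewrite mulr_ge0 ?invr_ge0 ?addr_ge0 ?pospow_ge0. Qed.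

Lemma ramp_le1 u : ramp u <= 1.
Proof.
have h := pospow_ge0 3 u; rewrite /ramp ler_pdivrMr ?ltr_pwDl // mul1r; lra.
Qed.

Lemma ramp_neg u : u <= 0 -> ramp u = 0.
Proof. by move=> u0; rewrite /ramp pospow_neg // mul0r. Qed.

Lemma ramp_near1 u : 1 <= u -> 1 - ramp u <= u^-1.
Proof.
move=> u1; have u0 : 0 < u by lra.
rewrite /ramp /pospow (max_l (ltW u0)).
have h : 0 < 1 + u ^+ 3 by rewrite ltr_pwDl // exprn_ge0 // ltW.
have -> : 1 - u ^+ 3 / (1 + u ^+ 3) = (1 + u ^+ 3)^-1 by field; exact: lt0r_neq0.
rewrite lef_pV2 ?posrE //.
have : u <= u ^+ 3 by rewrite exprS ler_peMr ?(ltW u0) // expr2; nra.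
lra.
Qed.

(** It vanishes outside [a + 1/n, b - 1/n] and tends to 1 on (a, b) as n
    grows. *)
Definition cutoff (a b : R) (n : nat) (t : R) : R :=
  ramp (n%:R * (t - a) - 1) * ramp (n%:R * (b - t) - 1).

Lemma dC_cutoff a b n : dC 2 (cutoff a b n).
Proof.
have h1 := @dC_aff 2 ramp n%:R (- (n%:R * a) - 1) dC_ramp.
have h2 := @dC_aff 2 ramp (- n%:R) (n%:R * b - 1) dC_ramp.
have := dC_mul h1 h2; rewrite (_ : (fun x => _) = cutoff a b n) //.
by apply/funext => t; rewrite /cutoff; congr (ramp _ * ramp _); ring.
Qed.

Lemma cutoff_ge0 a b n t : 0 <= cutoff a b n t.
Proof. by rewrite mulr_ge0 // ramp_ge0. Qed.

Lemma cutoff_le1 a b n t : cutoff a b n t <= 1.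
Proof. by rewrite mulr_ile1 ?ramp_ge0 ?ramp_le1. Qed.

Lemma cutoff_supp a b n t : (t <= a + n%:R^-1) || (b - n%:R^-1 <= t) -> cutoff a b n t = 0.
Proof.
rewrite /cutoff; have [->|n0] := eqVneq n 0%N.
  by move=> _; rewrite mul0r sub0r ramp_neg ?mul0r // lerN10.
have np : 0 < n%:R :> R by rewrite ltr0n lt0n.
move=> /orP[h|h].
  rewrite ramp_neg ?mul0r // subr_le0 -ler_pdivlMl // mulr1; lra.
rewrite [X in _ * X]ramp_neg ?mulr0 // subr_le0 -ler_pdivlMl // mulr1; lra.
Qed.

Lemma cutoff_out a b n t : (t <= a) || (b <= t) -> cutoff a b n t = 0.
Proof.
have h : 0 <= n%:R^-1 :> R by rewrite invr_ge0.
by move=> /orP[?|?]; apply: cutoff_supp; apply/orP; [left|right]; lra.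
Qed.

Lemma ramp_lim (v : R) : 0 < v -> ramp (n%:R * v - 1) @[n --> \oo] --> (1 : R).
Proof.
move=> v0; apply/cvgrPdist_le => e e0.
near=> n; rewrite ger0_norm ?subr_ge0 ?ramp_le1 //.
have n1 : 2 / v + e^-1 / v <= n%:R by near: n; exact: nbhs_infty_ger.
have n2 : 2 + e^-1 <= n%:R * v by rewrite -ler_pdivrMr // mulrDl.
have ei : 0 < e^-1 by rewrite invr_gt0.
have n3 : 1 <= n%:R * v - 1 by lra.
apply: le_trans (ramp_near1 n3) _.
rewrite -[leRHS]invrK lef_pV2 ?posrE //; lra.
Unshelve. all: by end_near. Qed.

Lemma cutoff_lim a b t : a < t < b -> cutoff a b n t @[n --> \oo] --> (1 : R).
Proof.
move=> /andP[ta tb]; rewrite -[1 in X in _ --> X]mulr1.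
by apply: cvgM; apply: ramp_lim; rewrite subr_gt0.
Qed.

End Bumps.

(** * Functions orthogonal to all cut-offs *)

Section Fundamental.
Variable R : realType.
Notation mu := (@lebesgue_measure R).
Notation T := (measurableTypeR R).
Notation L := (leb2 R).
Notation Om := (@Omega R : set (T * T)).
Variable F : R * R -> R.
Hypothesis iF : intO F.
Hypothesis HF : forall (a b c d : R) n, 0 <= a -> b <= 1 -> 0 <= c -> d <= 1 ->
  J (fun x => F x * (cutoff a b n x.1 * cutoff c d n x.2)) = 0.

Let g : T * T -> \bar R := EFin \o F.
Let P (E : set (T * T)) := (\int[L]_(x in E `&` Om) g x = 0)%E.

Let mO : measurable Om := @measurable_Omega R.

Let igS (E : set (T * T)) : measurable E -> L.-integrable (E `&` Om) g.
Proof.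
move=> mE; apply: (@integrableS _ _ _ L Om) => //; first exact: measurableI.
Qed.

Let P_D (X Y : set (T * T)) : measurable X -> measurable Y -> Y `<=` X ->
  P X -> P Y -> P (X `\` Y).
Proof.
move=> mX mY YX pX pY; rewrite /P.
have mXY : measurable (X `\` Y) by exact: measurableD.
have E : X `&` Om = ((X `\` Y) `&` Om) `|` (Y `&` Om).
  apply/seteqP; split=> z /=.
    by have := pselect (Y z); tauto.
  by move=> [[[zX _] zO]|[zY zO]]; split=> //; exact: YX.
move: pX; rewrite /P E integral_setU //=.
- by rewrite pY adde0.
- exact: measurableI.
- exact: measurableI.
- rewrite -E; apply: measurable_funS (measurable_int _ iF) => //.
- by apply/disj_setPS => z /= [[[_ h] _] [h' _]].
Qed.

Let P_U (X : (set (T * T))^nat) : (forall k, measurable (X k)) -> trivIset setT X ->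
  (forall k, P (X k)) -> P (\bigcup_k X k).
Proof.
move=> mX tX pX; rewrite /P setI_bigcupl integral_bigcup.
- rewrite (eq_eseriesr (g := fun=> 0%E)) ?eseries0 // => k _; exact: pX.
- by apply: trivIset_setIr.
- by move=> k; exact: measurableI.
- by rewrite -setI_bigcupl; apply: igS; exact: bigcup_measurable.
Qed.

Let P_rect (a b c d : R) : P (`]a, b[ `*` `]c, d[).
Proof.
pose a' := Num.max a 0; pose b' := Num.min b 1.
pose c' := Num.max c 0; pose d' := Num.min d 1.
pose f n : T * T -> \bar R := fun x => (F x * (cutoff a' b' n x.1 * cutoff c' d' n x.2))%:E.
pose h : T * T -> \bar R := g \_ (`]a, b[ `*` `]c, d[).
have mR : measurable (`]a, b[ `*` `]c, d[ : set (T * T)).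
  by apply: measurableX; exact: measurable_itv.
have mg : measurable_fun Om g by exact: measurable_int iF.
have cb n : continuous (fun x : R * R => cutoff a' b' n x.1 * cutoff c' d' n x.2).
  by apply: cont_mul2; [apply: cont_fst|apply: cont_snd]; exact: dC_cont (dC_cutoff _ _ _).
have b1 n (x : R * R) : `|cutoff a' b' n x.1 * cutoff c' d' n x.2| <= 1.
  have h0 := mulr_ge0 (cutoff_ge0 a' b' n x.1) (cutoff_ge0 c' d' n x.2).
  by rewrite (ger0_norm h0); apply: mulr_ile1; rewrite ?cutoff_ge0 ?cutoff_le1.
have mf n : measurable_fun Om (f n).
  apply/measurable_EFinP; apply: measurable_funM; first by apply/measurable_EFinP.
  exact: cont2_measurable.
have mh : measurable_fun Om h.
  apply: (measurable_restrict g mR mO).1.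
  by apply: (measurable_funS mO _ mg); exact: subIsetl.
have lim : \forall x \ae L, Om x -> f ^~ x @ \oo --> h x.
  apply: aeW => -[x y] /OmegaP [/andP[x0 x1] /andP[y0 y1]].
  have [inR|outR] := pselect ((`]a, b[ `*` `]c, d[) (x, y)).
    rewrite /h patchE mem_set //; apply: cvg_EFin; first by near=> n.
    move: inR => [/=]; rewrite !in_itv /= => /andP[x2 x3] /andP[y2 y3].
    have C : F (x, y) * (cutoff a' b' n x * cutoff c' d' n y) @[n --> \oo] --> F (x, y) * (1 * 1).
      apply: cvgM; first exact: cvg_cst.
      by apply: cvgM; apply: cutoff_lim; rewrite gt_max lt_min; apply/andP; split; apply/andP.
    by rewrite !mulr1 in C; exact: C.
  rewrite /h patchE ifF; last by apply/negP => /set_mem.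
  rewrite (_ : f ^~ (x, y) = fun=> 0%E); first exact: cvg_cst.
  apply/funext => n; rewrite /f /=.
  suff -> : cutoff a' b' n x * cutoff c' d' n y = 0 by rewrite mulr0.
  have [x2|x2] := boolP (a < x < b); last first.
    rewrite cutoff_out ?mul0r //; move: x2; rewrite negb_and -!leNgt => /orP[h2|h2]; apply/orP; [left|right].
      by rewrite le_max h2.
    by rewrite ge_min h2.
  have [y2|y2] := boolP (c < y < d); last first.
    rewrite [X in _ * X]cutoff_out ?mulr0 //; move: y2; rewrite negb_and -!leNgt => /orP[h2|h2]; apply/orP; [left|right].
      by rewrite le_max h2.
    by rewrite ge_min h2.
  by case: outR; split; rewrite /= in_itv.
have dom : \forall x \ae L, forall n, Om x -> (`|f n x| <= `|g x|)%E.
  apply: aeW => x n _; rewrite /f /g /= lee_fin normrM ler_piMr //.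
have ig : L.-integrable Om (fun x => `|g x|)%E by exact: integrable_abse.
have [_ _ C] := dominated_convergence mO mf mh lim ig dom.
have Z n : (\int[L]_(x in Om) f n x = 0)%E.
  have If : L.-integrable Om (f n).
    apply: (le_integrable mO (mf n) _ ig) => x Ox.
    apply: (@le_trans _ _ (`|g x|)%E); last by rewrite abse_id.
    rewrite /f /g /= lee_fin normrM ler_piMr //.
  rewrite -(fineK (integrable_fin_num mO If)).
  have := @HF a' b' c' d' n; rewrite /J /Rintegral => -> //.
  - by rewrite le_max lexx orbT.
  - by rewrite ge_min lexx orbT.
  - by rewrite le_max lexx orbT.
  - by rewrite ge_min lexx orbT.
have C' : (\int[L]_(x in Om) h x = 0)%E.
  apply: (@cvg_unique _ (@ereal_hausdorff R) _ _ _ _ C).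
  rewrite (_ : [sequence _]_n = fun=> 0%E); first exact: cvg_cst.
  by apply/funext => n /=; exact: Z.
by rewrite /P setIC integral_mkcondr; exact: C'.
Unshelve. all: by end_near. Qed.

Let interval_setI (A B : set R) : RGenOpens.G A -> RGenOpens.G B -> RGenOpens.G (A `&` B).
Proof.
move=> [a [b ->]] [c [d ->]]; exists (Num.max a c), (Num.min b d).
apply/seteqP; split=> x /=; rewrite !in_itv /= gt_max lt_min.
  by move=> [/andP[-> ->] /andP[-> ->]].
by move=> /andP[/andP[-> ->] /andP[-> ->]].
Qed.

Let dynkin1 (Q : set (set T)) : Q setT -> (forall a b : R, Q `]a, b[%classic) ->
  (forall S, measurable S -> Q S -> Q (~` S)) ->
  (forall X : (set T)^nat, (forall n, measurable (X n)) -> trivIset setT X ->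
     (forall n, Q (X n)) -> Q (\bigcup_k X k)) ->
  forall S, measurable S -> Q S.
Proof.
move=> QT QI QC QU S mS.
apply: (@dynkin_induction _ T (@RGenOpens.G R) Q) => //.
- exact: RGenOpens.measurableE.
- by move=> _ [a [b ->]]; exact: QI.
- by have := mS; rewrite [X in X S -> _]RGenOpens.measurableE.
Qed.

Let P_sub (X Y : set (T * T)) : X `&` Om = Y `&` Om -> P X -> P Y.
Proof. by rewrite /P => ->. Qed.

Let P_int1 (c d : R) (A : set T) : measurable A -> P (A `*` `]c, d[).
Proof.
have mI : measurable (`]c, d[%classic : set T) by exact: measurable_itv.
move: A; apply: dynkin1.
- apply: P_sub (P_rect 0 1 c d); apply/seteqP; split => -[x y] /=; rewrite !in_itv /=.
    by move=> [[_ ->]].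
  by move=> [[_ h] hO]; have /OmegaP [h1 h2] := hO; do 2 split.
- by move=> a b; exact: P_rect.
- move=> S mS PS.
  have -> : (~` S `*` `]c, d[) = ((setT `*` `]c, d[) `\` (S `*` `]c, d[) : set (T * T)).
    apply/seteqP; split=> -[x y] /=; first by move=> [nS I]; split=> // -[].
    by move=> [[_ I] nS]; split=> // xS; apply: nS.
  apply: P_D => //; [exact: measurableX|exact: measurableX|by move=> [x y] [_ ?]|].
  apply: P_sub (P_rect 0 1 c d); apply/seteqP; split => -[x y] /=; rewrite !in_itv /=.
    by move=> [[_ ->]].
  by move=> [[_ h] hO]; have /OmegaP [h1 h2] := hO; do 2 split.
- move=> X mX tX PX; rewrite setX_bigcupl; apply: P_U.
  + by move=> k; exact: measurableX.
  + move=> i j _ _ [[x y] [[h1 _] [h2 _]]]; apply: tX => //; by exists x.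
  + exact: PX.
Qed.

Let P_int2 (A B : set T) : measurable A -> measurable B -> P (A `*` B).
Proof.
move=> mA; move: B; 
have PT : P (A `*` setT).
  apply: P_sub (P_int1 0 1 mA); apply/seteqP; split => -[x y] /=; rewrite !in_itv /=.
    by move=> [[? _] ?].
  by move=> [[h _] hO]; have /OmegaP [h1 h2] := hO; do 2 split.
apply: dynkin1 => //.
- by move=> a b; exact: P_int1.
- move=> S mS PS.
  have -> : (A `*` ~` S) = ((A `*` setT) `\` (A `*` S) : set (T * T)).
    apply/seteqP; split=> -[x y] /=; first by move=> [nS I]; split=> // -[].
    by move=> [[h I] nS]; split=> // xS; apply: nS.
  by apply: P_D => //; [exact: measurableX|exact: measurableX|move=> [x y] [? _]].
- move=> X mX tX PX; rewrite setX_bigcupr; apply: P_U.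
  + by move=> k; exact: measurableX.
  + move=> i j _ _ [[x y] [[_ h1] [_ h2]]]; apply: tX => //; by exists y.
  + exact: PX.
Qed.

(** Letting n grow, the integrals of F over all rectangles vanish, and the
    sets over which the integral vanishes are closed under proper differences
    and disjoint unions. *)
Lemma fundamental_ae : ae_eq L Om g (fun=> 0%E).
Proof.
apply: integral_ae_eq => //.
move=> E EO mE; rewrite integral0.
have -> : E = E `&` Om by rewrite setIidl.
move: mE {EO}; rewrite measurable_prod_measurableType; move: E.
apply: dynkin_induction.
- by rewrite measurable_prod_measurableType.
- move=> _ _ [A1 mA1 [A2 mA2 <-]] [B1 mB1 [B2 mB2 <-]].
  exists (A1 `&` B1); first exact: measurableI.
  by exists (A2 `&` B2); [exact: measurableI|rewrite setXI].
- by rewrite -setXTT; exact: P_int2.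
- by move=> _ [A mA [B mB <-]]; exact: P_int2.
- move=> S mS PS; rewrite -setTD; apply: P_D => //.
  by rewrite -setXTT; exact: P_int2.
- exact: P_U.
Qed.

End Fundamental.

(** * Double trigonometric series *)

Section Limits.
Variable R : realType.

Lemma tends0_le_lim (u : nat -> R) (l c : R) N0 :
  tends0 (fun n => u n - l) -> (forall n, (N0 <= n)%N -> `|u n| <= c) -> `|l| <= c.
Proof.
move=> H hc; apply/ler_addgt0Pl => e /H [N NP].
have h1 := NP _ (leq_maxl N N0); have h2 := hc _ (leq_maxr N N0).
rewrite (_ : l = - (u (maxn N N0) - l) + u (maxn N N0)); last by ring.
by apply: le_trans (ler_normD _ _) _; rewrite normrN lerD.
Qed.

(** The mean value theorem bounds the difference quotients of u M - u N by eps
    N; M tends to infinity first. *)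
Lemma lim_derive (u u' : nat -> R -> R) (f f' : R -> R) (eps : nat -> R) :
  (forall N (t : R), is_derive t (1:R) (u N) (u' N t)) ->
  (forall N M t, (N <= M)%N -> `|u' M t - u' N t| <= eps N) ->
  (forall t, tends0 (fun N => u N t - f t)) ->
  (forall t N, `|u' N t - f' t| <= eps N) -> tends0 eps ->
  forall t : R, is_derive t (1:R) f (f' t).
Proof.
move=> du cu lu lu' e0 t; apply/is_derive1_epsP => e epos.
have e3 : 0 < e / 3 by rewrite divr_gt0.
have [N NP] := e0 _ e3; have {}NP := NP N (leqnn N).
have eN : eps N <= e / 3 := le_trans (ler_norm _) NP.
have /is_derive1_epsP /(_ _ e3) [r r0 rP] := du N t.
exists r => // h hr; have {}rP := rP h hr.
have key : `|(f (t + h) - u N (t + h)) - (f t - u N t)| <= eps N * `|h|.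
  apply: (@tends0_le_lim (fun M => (u M (t + h) - u N (t + h)) - (u M t - u N t)) _ _ N).
    have L := tends0_add (lu (t + h)) (tends0_scale (-1) (lu t)).
    by move: L; congr tends0; apply/funext => M; ring.
  move=> M NM.
  have D s : is_derive s (1:R) (fun s => u M s - u N s) (u' M s - u' N s).
    exact: dB (du M s) (du N s).
  have [c _ ->] := MVT_incr t h D.
  by rewrite normrM mulrC ler_wpM2r // cu.
have -> : f (t + h) - f t - h * f' t =
  ((f (t + h) - u N (t + h)) - (f t - u N t)) + (u N (t + h) - u N t - h * u' N t)
   + h * (u' N t - f' t) by ring.
apply: le_trans (ler_normD _ _) _; have -> : e * `|h| = (e / 3 * `|h| + e / 3 * `|h|) + `|h| * (e / 3) by field.
apply: lerD.
  apply: le_trans (ler_normD _ _) _; apply: lerD => //.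
  by apply: le_trans key _; rewrite ler_wpM2r.
by rewrite normrM ler_wpM2l // (le_trans (lu' t N)).
Qed.

Lemma lim_cont2 (u : nat -> R * R -> R) (f : R * R -> R) (eps : nat -> R) :
  (forall N, continuous (u N)) -> (forall N z, `|u N z - f z| <= eps N) -> tends0 eps ->
  continuous f.
Proof.
move=> cu lu e0 [x y]; apply/cont_epsP => e epos.
have e3 : 0 < e / 3 by rewrite divr_gt0.
have [N NP] := e0 _ e3; have {}NP := NP N (leqnn N).
have eN : eps N <= e / 3 := le_trans (ler_norm _) NP.
have /cont_epsP /(_ _ e3) [r r0 rP] := cu N (x, y).
exists r => // a b ha hb; have {}rP := rP a b ha hb.
have -> : f (a, b) - f (x, y) = - (u N (a, b) - f (a, b)) + (u N (a, b) - u N (x, y))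
   + (u N (x, y) - f (x, y)) by ring.
have -> : e = (e / 3 + e / 3) + e / 3 by field.
apply: le_trans (ler_normD _ _) _; apply: lerD; last exact: le_trans (lu _ _) eN.
by apply: le_trans (ler_normD _ _) _; apply: lerD => //; rewrite normrN (le_trans (lu _ _)).
Qed.

Lemma cauchy_lim (v : nat -> R) (eps : nat -> R) : tends0 eps ->
  (forall N M, (N <= M)%N -> `|v M - v N| <= eps N) ->
  exists l, forall N, `|v N - l| <= eps N.
Proof.
move=> e0 H.
have C : cvgn v.
  apply: R_complete; apply/cauchyP => e epos.
  have [N NP] := e0 _ (divr_gt0 epos (ltr0n R 2)).
  exists (v N); exists N => // M NM; rewrite /ball /= distrC.
  apply: le_lt_trans (H _ _ NM) _; apply: le_lt_trans (ler_norm _) _.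
  by apply: le_lt_trans (NP _ (leqnn N)) _; lra.
exists (lim (v @ \oo)) => N; rewrite distrC.
apply: (@tends0_le_lim (fun M => v M - v N) _ _ N); last exact: H.
have : tends0 (fun M => v M - lim (v @ \oo)).
  by apply: tends0_cvg; rewrite -(subrr (lim (v @ \oo))); apply: cvgB => //; exact: cvg_cst.
by congr tends0; apply/funext => M; ring.
Qed.

Definition Box (N : nat) (t : int -> int -> R) : R := sZ N (fun k => sZ N (t k)).

Lemma BoxS N t : Box N.+1 t = Box N t + (sZ N (t (Posz N.+1)) + sZ N (t (- Posz N.+1))
   + sZ N.+1 (fun k => t k (Posz N.+1) + t k (- Posz N.+1))).
Proof.
rewrite /Box (@eq_sZ _ N.+1 (fun k => sZ N.+1 (t k)) (fun k => sZ N (t k) + (t k (Posz N.+1) + t k (- Posz N.+1)))).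
  by rewrite sZD sZS !addrA.
by move=> k; rewrite sZS.
Qed.

Lemma Box_le N t u : (forall k l, `|t k l| <= u k l) -> `|Box N.+1 t - Box N t| <= Box N.+1 u - Box N u.
Proof.
move=> h; rewrite !BoxS ![Box N _ + _]addrC !addrK.
apply: le_trans (ler_normD _ _) _; apply: lerD.
  by apply: le_trans (ler_normD _ _) _; apply: lerD; apply: sZ_norm => l.
apply: sZ_norm => k; apply: le_trans (ler_normD _ _) _; exact: lerD.
Qed.

Lemma Box_wt N (c : R) : Box N (fun k l => c * (wt R k * wt R l)) = c * sZ N (wt R) ^+ 2.
Proof.
rewrite /Box (@eq_sZ _ N _ (fun k => (c * sZ N (wt R)) * wt R k)).
  by rewrite sZM expr2 mulrA.
move=> k; rewrite -mulrA [sZ N _ * _]mulrC mulrA -sZM.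
by apply: eq_sZ => l; rewrite mulrA.
Qed.

Lemma sZ_wt_ge0 N : 0 <= sZ N (wt R).
Proof.
have h k : `|wt R k| <= wt R k by rewrite ger0_norm // ltW // wt_gt0.
exact: le_trans (normr_ge0 _) (sZ_norm N h).
Qed.

Lemma Box_cauchy N M (c : R) t : (forall k l, `|t k l| <= c * (wt R k * wt R l)) -> (N <= M)%N ->
  `|Box M t - Box N t| <= c * (swt R ^+ 2 - sZ N (wt R) ^+ 2).
Proof.
move=> h NM.
have c0 : 0 <= c.
  have := le_trans (normr_ge0 _) (h 0 0); by rewrite pmulr_lge0 // mulr_gt0 // wt_gt0.
have K : `|Box M t - Box N t| <= c * (sZ M (wt R) ^+ 2 - sZ N (wt R) ^+ 2).
  rewrite -(subnKC NM); elim: (M - N)%N => [|d IH]; first by rewrite addn0 !subrr normr0 mulr0.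
  have D := Box_le (N + d) h; rewrite !Box_wt -mulrBr in D.
  rewrite addnS -[Box (N + d).+1 t](subrK (Box (N + d) t)) -addrA.
  apply: le_trans (ler_normD _ _) _; apply: le_trans (lerD D IH) _.
  by rewrite -mulrDr addrA subrK.
apply: le_trans K _; rewrite ler_wpM2l // lerD2r ler_sqr ?nnegrE //.
- exact: sZ_wt_lim.
- exact: sZ_wt_ge0.
- exact: le_trans (sZ_wt_ge0 0) (sZ_wt_lim _ _).
Qed.

Lemma box_tail : tends0 (fun N => swt R ^+ 2 - sZ N (wt R) ^+ 2).
Proof.
apply: tends0_cvg; rewrite -(subrr (swt R ^+ 2)); apply: cvgB; first exact: cvg_cst.
by rewrite expr2; apply: cvgM; exact: sZ_wt_cvg.
Qed.

Definition th (k l : int) (z : R * R) : R := 2 * pi * k%:~R * z.1 + 2 * pi * l%:~R * z.2.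

(** The real part of (p - i q) exp (i th). Differentiation acts on the pair
    (p, q) only. *)
Definition tau (k l : int) (p q : R) (z : R * R) : R := p * cos (th k l z) + q * sin (th k l z).

Definition frq (j : bool) (k l : int) : R := 2 * pi * (if j then l else k)%:~R.

Lemma tau_pder j k l p q : pder j (tau k l p q) (tau k l (frq j k l * q) (- frq j k l * p)).
Proof.
case: j; [apply/pder2P|apply/pder1P] => x y; rewrite /tau /th /frq /=.
  set c := 2 * pi * l%:~R; set d := 2 * pi * k%:~R * x.
  have := dD (dZ p (dcos c d y)) (dZ q (dsin c d y)).
  rewrite (_ : (fun t => _) = fun t => p * cos (d + c * t) + q * sin (d + c * t)); last first.
    by apply/funext => t; rewrite addrC [d + _]addrC addrC.
  by move=> h; apply: (is_derive_eq h); rewrite [d + _]addrC; ring.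
set c := 2 * pi * k%:~R; set d := 2 * pi * l%:~R * y.
have h := dD (dZ p (dcos c d x)) (dZ q (dsin c d x)).
by apply: (is_derive_eq h); ring.
Qed.

Lemma tau_Cinf2 k l p q : Cinf2 (tau k l p q).
Proof.
apply: (@Cinf2_coind R (fun f => exists p q, f = tau k l p q)); last by exists p, q.
  move=> _ [p' [q' ->]].
  have c (c d : R) : continuous (fun z : R * R => c * z.1 + d * z.2).
    by apply: cont_add2; apply: cont_mul2; try (by move=> x; exact: cvg_cst); move=> x; [exact: cvg_fst|exact: cvg_snd].
  have ct : continuous (th k l) by exact: c.
  apply: cont_add2; apply: cont_mul2; try (by move=> x; exact: cvg_cst);
   move=> x; apply: continuous_comp; try exact: ct; [exact: continuous_cos|exact: continuous_sin].
move=> _ [p' [q' ->]] j; eexists; [exact: tau_pder|by do 2 eexists].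
Qed.

Lemma tau_qper k l p q : qper 1 1 (tau k l p q).
Proof.
split; first exact: tau_Cinf2.
move=> x y; rewrite !mul1r /tau.
have -> : th k l (x + 1, y) = th k l (x, y) + 2 * pi * k%:~R by rewrite /th /=; ring.
have -> : th k l (x, y + 1) = th k l (x, y) + 2 * pi * l%:~R by rewrite /th /=; ring.
by rewrite !cos_perZ !sin_perZ.
Qed.

Lemma tau_norm k l p q z : `|tau k l p q z| <= `|p| + `|q|.
Proof.
apply: le_trans (ler_normD _ _) _; apply: lerD; rewrite normrM ler_piMr //; [exact: cos_max|exact: sin_max].
Qed.

Definition decay (a : int -> int -> R) := forall m, exists C, forall k l,
  `|a k l| <= C * (wt R k * wt R l) ^+ m.

Lemma wt_le1 k : wt R k <= 1.
Proof. by rewrite /wt invf_le1 ?wt_den_gt0 // lerDl sqr_ge0. Qed.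

Lemma frq_wt j k l : `|frq j k l| * (wt R k * wt R l) <= 2 * pi.
Proof.
have p0 : 0 <= 2 * pi :> R by rewrite mulr_ge0 // pi_ge0.
have kw (i : int) : `|(i%:~R : R)| * wt R i <= 1.
  rewrite /wt ler_pdivrMr ?wt_den_gt0 // mul1r -[X in _ + X]real_normK ?num_real //.
  by have := sqr_ge0 (`|(i%:~R : R)| - 1); nra.
have w0 i : 0 <= wt R i by rewrite ltW // wt_gt0.
rewrite /frq normrM (ger0_norm p0) -mulrA -[leRHS]mulr1 ler_wpM2l //.
case: j.
  by rewrite [wt R k * _]mulrC mulrA mulr_ile1 ?mulr_ge0 // wt_le1.
by rewrite mulrA mulr_ile1 ?mulr_ge0 // wt_le1.
Qed.

Lemma decay_frq j a c : `|c| <= 1 -> decay a -> decay (fun k l => c * frq j k l * a k l).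
Proof.
move=> c1 da m; have [C HC] := da m.+1.
exists (2 * pi * C) => k l; have := HC k l.
have f := frq_wt j k l; have W0 : 0 < wt R k * wt R l by rewrite mulr_gt0 // wt_gt0.
move: f W0; set W := wt R k * wt R l => f W0 h.
have C0 : 0 <= C by have := le_trans (normr_ge0 _) h; rewrite pmulr_lge0 // exprn_gt0.
rewrite -mulrA normrM; apply: (@le_trans _ _ (1 * `|frq j k l * a k l|)).
  by rewrite ler_wpM2r.
rewrite mul1r normrM.
apply: (@le_trans _ _ (`|frq j k l| * (C * W ^+ m.+1))); first by rewrite ler_wpM2l.
have -> : `|frq j k l| * (C * W ^+ m.+1) = (`|frq j k l| * W) * (C * W ^+ m) by rewrite exprS; ring.
by rewrite -[leRHS]mulrA ler_wpM2r // mulr_ge0 // exprn_ge0 // ltW.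
Qed.

Definition tBox a b N z := Box N (fun k l => tau k l (a k l) (b k l) z).

Lemma decay_tau a b : decay a -> decay b -> exists C, forall k l z,
  `|tau k l (a k l) (b k l) z| <= C * (wt R k * wt R l).
Proof.
move=> /(_ 1%N) [C HC] /(_ 1%N) [D HD]; exists (C + D) => k l z.
apply: le_trans (tau_norm _ _ _ _ _) _; rewrite mulrDl; apply: lerD.
  exact: HC.
exact: HD.
Qed.

Lemma qper_sZ c1 c2 N (F : int -> R * R -> R) : (forall k, qper c1 c2 (F k)) ->
  qper c1 c2 (fun z => sZ N (fun k => F k z)).
Proof.
move=> VF; elim: N => [|N IH].
  by rewrite (_ : (fun z => _) = F 0) //; apply/funext => z; rewrite sZ0.
rewrite (_ : (fun z => _) = fun z => sZ N (fun k => F k z) + (F (Posz N.+1) z + F (- Posz N.+1) z)).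
  by apply: qper_add => //; exact: qper_add.
by apply/funext => z; rewrite sZS.
Qed.

Lemma pder_sZ j N (F F' : int -> R * R -> R) : (forall k, pder j (F k) (F' k)) ->
  pder j (fun z => sZ N (fun k => F k z)) (fun z => sZ N (fun k => F' k z)).
Proof.
move=> hF; elim: N => [|N IH].
  rewrite (_ : (fun z => sZ 0 (fun k => F k z)) = F 0); last by apply/funext => z; rewrite sZ0.
  by apply: (pder_eqr (hF 0)) => z; rewrite sZ0.
rewrite (_ : (fun z => sZ N.+1 (fun k => F k z)) =
   fun z => sZ N (fun k => F k z) + (F (Posz N.+1) z + F (- Posz N.+1) z)); last first.
  by apply/funext => z; rewrite sZS.
by apply: (pder_eqr (pder_add IH (pder_add (hF _) (hF _)))) => z; rewrite sZS.
Qed.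

Lemma tBox_qper a b N : qper 1 1 (tBox a b N).
Proof.
apply: (qper_sZ N (F := fun k z => sZ N (fun l => tau k l (a k l) (b k l) z))) => k.
by apply: qper_sZ => l; exact: tau_qper.
Qed.

Lemma tBox_pder a b N j : pder j (tBox a b N)
  (tBox (fun k l => 1 * frq j k l * b k l) (fun k l => - 1 * frq j k l * a k l) N).
Proof.
apply: (pder_sZ N (F := fun k z => sZ N (fun l => tau k l (a k l) (b k l) z))) => k.
apply: pder_sZ => l; apply: (pder_eqr (tau_pder j k l _ _)) => z.
by rewrite mul1r mulN1r.
Qed.

Definition boxlim a b f := exists C, forall N z,
  `|tBox a b N z - f z| <= C * (swt R ^+ 2 - sZ N (wt R) ^+ 2).

Lemma boxlim_exists a b : decay a -> decay b -> exists f, boxlim a b f.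
Proof.
move=> da db; have [C HC] := decay_tau da db.
have H z : {l | forall N, `|tBox a b N z - l| <= C * (swt R ^+ 2 - sZ N (wt R) ^+ 2)}.
  apply: cid; apply: (@cauchy_lim (fun N => tBox a b N z)).
    exact: tends0_scale box_tail.
  by move=> N M NM; apply: Box_cauchy => // k l; exact: HC.
by exists (fun z => sval (H z)), C => N z; exact: (svalP (H z)).
Qed.

(** Each derivative of the limit is the limit for the differentiated
    coefficients, which decay rapidly as well; this closes the coinduction. *)
Lemma boxlim_qper a b f : decay a -> decay b -> boxlim a b f -> qper 1 1 f.
Proof.
move=> da db bf; split; last first.
  have [C HC] := bf; move=> x y; rewrite !mul1r.
  have T := tends0_scale 2 (tends0_scale C box_tail).
  have per z z' : (forall N, tBox a b N z = tBox a b N z') -> f z = f z'.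
    move=> E; apply/eqP; rewrite -subr_eq0; apply/eqP; apply: (tends0_zero _ T) => N.
    have -> : f z - f z' = - (tBox a b N z - f z) + (tBox a b N z' - f z') by rewrite E; ring.
    by apply: le_trans (ler_normD _ _) _; rewrite normrN mulr_natl mulr2n lerD.
  split; apply: per => N; have [_ /(_ x y)] := tBox_qper a b N; rewrite !mul1r => -[] //.
apply: (@Cinf2_coind R (fun f => exists a b, [/\ decay a, decay b & boxlim a b f])); last by exists a, b.
  move=> h [a' [b' [da' db' [C HC]]]].
  apply: (lim_cont2 (u := fun N => tBox a' b' N)) HC _; last exact: tends0_scale box_tail.
  by move=> N; exact: Cinf2_cont (tBox_qper a' b' N).1.
move=> h [a' [b' [da' db' [C HC]]]] j.
pose a2 k l := 1 * frq j k l * b' k l; pose b2 k l := - 1 * frq j k l * a' k l.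
have da2 : decay a2 by apply: decay_frq; rewrite ?normr1.
have db2 : decay b2 by apply: decay_frq; rewrite ?normrN ?normr1.
have [h' [D HD]] := boxlim_exists da2 db2.
exists h'; last by exists a2, b2; split => //; exists D.
have [E HE] := decay_tau da2 db2.
pose eps N := (`|D| + `|E|) * (swt R ^+ 2 - sZ N (wt R) ^+ 2).
have t0 : tends0 eps by exact: tends0_scale box_tail.
have tp N : 0 <= swt R ^+ 2 - sZ N (wt R) ^+ 2.
  rewrite subr_ge0 ler_sqr ?nnegrE ?sZ_wt_ge0 ?sZ_wt_lim //.
  exact: le_trans (sZ_wt_ge0 0) (sZ_wt_lim _ _).
have c1 N M z : (N <= M)%N -> `|tBox a2 b2 M z - tBox a2 b2 N z| <= eps N.
  move=> NM; apply: le_trans (Box_cauchy (c := E) _ NM) _; first by move=> k l; exact: HE.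
  by rewrite ler_wpM2r // (le_trans (ler_norm _)) // lerDr.
have c2 z : tends0 (fun N => tBox a' b' N z - h z).
  by apply: tends0_le (tends0_scale C box_tail) => N; exact: HC.
have c3 z N : `|tBox a2 b2 N z - h' z| <= eps N.
  by apply: le_trans (HD _ _) _; rewrite ler_wpM2r // (le_trans (ler_norm _)) // lerDl.
have PD N := tBox_pder a' b' N j.
case: j @a2 @b2 {da2 db2 HE HD} c1 c3 PD => a2 b2 c1 c3 PD; [apply/pder2P|apply/pder1P] => x y.
  have D2 N (t : R) : is_derive t (1:R) (fun t => tBox a' b' N (x, t)) (tBox a2 b2 N (x, t)).
    by have /pder2P := PD N; exact.
  exact: (@lim_derive _ _ (fun t => h (x, t)) (fun t => h' (x, t)) eps D2
    (fun N M t => c1 N M (x, t)) (fun t => c2 (x, t)) (fun t N => c3 (x, t) N) t0 y).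
have D1 N (t : R) : is_derive t (1:R) (fun t => tBox a' b' N (t, y)) (tBox a2 b2 N (t, y)).
  by have /pder1P := PD N; exact.
exact: (@lim_derive _ _ (fun t => h (t, y)) (fun t => h' (t, y)) eps D1
  (fun N M t => c1 N M (t, y)) (fun t => c2 (t, y)) (fun t N => c3 (t, y) N) t0 x).
Qed.

End Limits.

(** * Fourier inversion almost everywhere *)

Section Recon.
Variable R : realType.
Notation T := (measurableTypeR R).
Notation Om := (@Omega R : set (T * T)).
Implicit Types (F f g : R * R -> R).

Lemma intO_mulc F (c : R * R -> R) : intO F -> continuous c -> intO (fun x => F x * c x).
Proof.
move=> iF cc; have [M M0 HM] := cont2_bounded cc.
have mF : measurable_fun Om F by apply/measurable_EFinP; exact: measurable_int iF.
apply: (le_integrable (@measurable_Omega R) _ _ (intO_Z M iF)).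
  apply/measurable_EFinP; apply: measurable_funM => //.
  exact: cont2_measurable (@measurable_Omega R) cc.
move=> [x y] /OmegaP [/andP[x0 x1] /andP[y0 y1]] /=.
rewrite lee_fin !normrM mulrC (ger0_norm M0) ler_wpM2r // HM // !ltW //.
Qed.

Lemma J_abs_le F (c : R * R -> R) (e : R) : intO F -> continuous c -> 0 <= e ->
  (forall x, Omega x -> `|c x| <= e) -> `|J (fun x => F x * c x)| <= e * J (fun x => `|F x|).
Proof.
move=> iF cc e0 H; have iFc := intO_mulc iF cc.
have iaF : intO (fun x => `|F x|).
  by have := integrable_norm iF.
apply: le_trans (J_norm iFc) _; rewrite -JZ //; apply: J_le.
- by have := integrable_norm iFc.
- exact: intO_Z.
by move=> x Ox; rewrite normrM mulrC ler_wpM2r // H.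
Qed.

Lemma J_sZ N (G : int -> R * R -> R) : (forall k, intO (G k)) ->
  intO (fun x => sZ N (fun k => G k x)) /\ J (fun x => sZ N (fun k => G k x)) = sZ N (fun k => J (G k)).
Proof.
move=> iG; elim: N => [|N [IH1 IH2]].
  have E : (fun x => sZ 0 (fun k => G k x)) = G 0 by apply/funext => x; rewrite sZ0.
  by rewrite E sZ0.
have E : (fun x => sZ N.+1 (fun k => G k x)) = fun x => sZ N (fun k => G k x) + (G (Posz N.+1) x + G (- Posz N.+1) x).
  by apply/funext => x; rewrite sZS.
have i1 := intO_D (iG (Posz N.+1)) (iG (- Posz N.+1)).
rewrite E sZS -IH2 -(JD (iG (Posz N.+1)) (iG (- Posz N.+1))) -(JD IH1 i1).
by split => //; exact: intO_D IH1 i1.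
Qed.

Definition fcos F (k l : int) := J (fun x => F x * cos (th k l x)).
Definition fsin F (k l : int) := J (fun x => F x * sin (th k l x)).

Lemma cont_cos_th k l : continuous (fun x : R * R => cos (th k l x)).
Proof.
have := Cinf2_cont (tau_Cinf2 k l 1 (0 : R)); rewrite (_ : tau k l 1 0 = fun x => cos (th k l x)) //.
by apply/funext => x; rewrite /tau mul1r mul0r addr0.
Qed.

Lemma cont_sin_th k l : continuous (fun x : R * R => sin (th k l x)).
Proof.
have := Cinf2_cont (tau_Cinf2 k l (0 : R) 1); rewrite (_ : tau k l 0 1 = fun x => sin (th k l x)) //.
by apply/funext => x; rewrite /tau mul1r mul0r add0r.
Qed.

Lemma J_tensor (p q : R -> R) : continuous p -> continuous q ->
  J (fun x => p x.1 * q x.2) = I01 p * I01 q.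
Proof.
move=> cp cq; have c := cont_mul2 (cont_fst cp) (cont_snd cq).
rewrite (J_fubini (cont_intO c)).2.
have -> : I01 p * I01 q = I01 (fun t => I01 q * p t) by rewrite I01Z 1?mulrC //; exact: cont_int01.
apply: eq_I01 => t _; rewrite /slice_int /= I01Z 1?mulrC //; exact: cont_int01.
Qed.

Section Bump.
Variables (p q : R -> R).
Hypothesis (dp : dC 2 p) (dq : dC 2 q).
Hypothesis (p01 : forall t, 0 <= p t <= 1) (q01 : forall t, 0 <= q t <= 1).
Hypothesis (pout : forall t : R, (t <= 0) || (1 <= t) -> p t = 0).
Hypothesis (qout : forall t : R, (t <= 0) || (1 <= t) -> q t = 0).

Let cp : continuous p := dC_cont dp.
Let cq : continuous q := dC_cont dq.
Let Pc (k : int) := fcoef p k 0.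
Let Ps (k : int) := I01 (fun t => p t * sin (2 * pi * k%:~R * t)).
Let Qc (k : int) := fcoef q k 0.
Let Qs (k : int) := I01 (fun t => q t * sin (2 * pi * k%:~R * t)).

Lemma fcoef_split (r : R -> R) k y : continuous r ->
  fcoef r k (- (2 * pi * k%:~R * y)) = fcoef r k 0 * cos (2 * pi * k%:~R * y) +
    I01 (fun t => r t * sin (2 * pi * k%:~R * t)) * sin (2 * pi * k%:~R * y).
Proof.
move=> cr; set c := 2 * pi * k%:~R.
have i1 : int01 (fun t => r t * cos (c * t + 0)).
  by apply: cont_int01; apply: cont_mul1 => //; exact: cont_cosl.
have i2 : int01 (fun t => r t * sin (c * t)).
  apply: cont_int01; apply: cont_mul1 => //.
  by have := cont_sinl c 0; rewrite (_ : (fun t => _) = fun t => sin (c * t)) //; apply/funext => t; rewrite addr0.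
rewrite /fcoef [_ * cos _]mulrC [_ * sin _]mulrC -(I01Z _ i1) -(I01Z _ i2).
rewrite -(I01D (int01Z _ i1) (int01Z _ i2)); apply: eq_I01 => t _.
by rewrite cosB addr0; ring.
Qed.

(** A function that vanishes outside (0,1) has zero derivative at 0 and at 1,
    so its Fourier series converges uniformly on (0,1). *)
Lemma bump_ends (r : R -> R) : dC 2 r -> (forall t, 0 <= r t <= 1) ->
  (forall t : R, (t <= 0) || (1 <= t) -> r t = 0) ->
  exists C, forall N (y : R), 0 < y < 1 -> `|r y - fsum r N y| <= C * (swt R - sZ N (wt R)).
Proof.
move=> [cr [r' dr [cr' [r'' dr' cr'']]]] r01 rout.
have r0 (t : R) : (t <= 0) || (1 <= t) -> r' t = 0.
  (* r vanishes on a half-line that ends at t. *)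
  move=> tt; apply/eqP; rewrite -normr_le0; apply/ler_addgt0Pl => e e0; rewrite addr0.
  have /is_derive1_epsP /(_ e e0) [d d0 dP] := dr t.
  pose h : R := if t <= 0 then - (d / 2) else d / 2.
  have hd : `|h| = d / 2.
    by rewrite /h; case: ifP => _; rewrite ?normrN ger0_norm // divr_ge0 // ltW.
  have hlt : `|h| < d by rewrite hd; lra.
  have := dP h hlt; rewrite hd.
  have -> : r (t + h) = 0.
    apply: rout; rewrite /h; case: (leP t 0) tt => [t0 _|t0 /= t1].
      by apply/orP; left; lra.
    by apply/orP; right; lra.
  rewrite (rout t tt) subrr sub0r normrN normrM hd mulrC.
  have d2 : 0 < d / 2 by rewrite divr_gt0.
  by rewrite ler_pM2r.
have [M M0 HM] := cont1_bounded cr''.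
exists (2 * (1 + M)) => N y y01.
apply: (fsum_unif y01 dr dr' cr'').
- by rewrite !rout ?lexx ?orbT.
- by rewrite !r0 ?lexx ?orbT.
- by move=> t _; have /andP[h0 h1] := r01 t; rewrite ger0_norm.
- by move=> t /andP[t0 t1]; apply: HM; rewrite !ltW.
Qed.

Lemma PsN k : Ps (- k) = - Ps k.
Proof.
have i : int01 (fun t => p t * sin (2 * pi * k%:~R * t)).
  apply: cont_int01; apply: cont_mul1 => //.
  have := @cont_sinl R (2 * pi * k%:~R) 0; rewrite (_ : (fun t => _) = fun t => sin (2 * pi * k%:~R * t)) //.
  by apply/funext => t; rewrite addr0.
have E := I01Z (-1) i; rewrite mulN1r in E; rewrite /Ps -E.
by apply: eq_I01 => t _; rewrite mulrNz mulrN mulNr sinN; ring.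
Qed.

Lemma PcN k : Pc (- k) = Pc k.
Proof.
by apply: eq_I01 => t _; rewrite !addr0 mulrNz mulrN mulNr cosN.
Qed.

Lemma J_trig_bump k l :
  J (fun z => cos (th k l z) * (p z.1 * q z.2)) = Pc k * Qc l - Ps k * Qs l /\
  J (fun z => sin (th k l z) * (p z.1 * q z.2)) = Ps k * Qc l + Pc k * Qs l.
Proof.
pose a (t : R) := p t * cos (2 * pi * k%:~R * t + 0).
pose b (t : R) := p t * sin (2 * pi * k%:~R * t + 0).
pose c (t : R) := q t * cos (2 * pi * l%:~R * t + 0).
pose d (t : R) := q t * sin (2 * pi * l%:~R * t + 0).
have ca : continuous a by apply: cont_mul1 => //; exact: cont_cosl.
have cb : continuous b by apply: cont_mul1 => //; exact: cont_sinl.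
have cc : continuous c by apply: cont_mul1 => //; exact: cont_cosl.
have cd : continuous d by apply: cont_mul1 => //; exact: cont_sinl.
have Eb : I01 b = Ps k by apply: eq_I01 => t _; rewrite /b addr0.
have Ed : I01 d = Qs l by apply: eq_I01 => t _; rewrite /d addr0.
have i (u v : R -> R) : continuous u -> continuous v -> intO (fun z : R * R => u z.1 * v z.2).
  by move=> cu cv; apply: cont_intO; apply: cont_mul2; [exact: cont_fst|exact: cont_snd].
split.
  rewrite -[Pc k]/(I01 a) -[Qc l]/(I01 c) -Eb -Ed -(J_tensor ca cc) -(J_tensor cb cd) -(JB (i _ _ ca cc) (i _ _ cb cd)).
  by apply: eq_J => z _; rewrite /a /b /c /d !addr0 /th cosD; ring.
rewrite -[Pc k]/(I01 a) -[Qc l]/(I01 c) -Eb -Ed -(J_tensor cb cc) -(J_tensor ca cd) -(JD (i _ _ cb cc) (i _ _ ca cd)).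
by apply: eq_J => z _; rewrite /a /b /c /d !addr0 /th sinD; ring.
Qed.

(** By the addition formulas the summand is u k * v l + u' k * v' l, and u' is
    odd in k, so the second product sums to 0. *)
Lemma box_product N y :
  Box N (fun k l => cos (th k l y) * (Pc k * Qc l - Ps k * Qs l) + sin (th k l y) * (Ps k * Qc l + Pc k * Qs l))
  = fsum p N y.1 * fsum q N y.2.
Proof.
pose A (k : int) := 2 * pi * k%:~R * y.1; pose B (l : int) := 2 * pi * l%:~R * y.2.
pose u k := Pc k * cos (A k) + Ps k * sin (A k).
pose v l := Qc l * cos (B l) + Qs l * sin (B l).
pose u' k := Pc k * sin (A k) - Ps k * cos (A k).
pose v' l := Qs l * cos (B l) - Qc l * sin (B l).
have E k l : cos (th k l y) * (Pc k * Qc l - Ps k * Qs l) + sin (th k l y) * (Ps k * Qc l + Pc k * Qs l)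
   = u k * v l + u' k * v' l.
  by rewrite /th -/(A k) -/(B l) cosD sinD /u /v /u' /v'; ring.
rewrite /Box (@eq_sZ _ N _ (fun k => sZ N v * u k + sZ N v' * u' k)); last first.
  move=> k; rewrite (eq_sZ N (E k)) sZD !sZM [u k * _]mulrC [u' k * _]mulrC //.
rewrite sZD !sZM [sZ N u']sZ_odd ?mulr0 ?addr0; last first.
  by move=> k; rewrite /u' PcN PsN /A mulrNz mulrN !mulNr sinN cosN; ring.
rewrite mulrC /fsum; congr (_ * _); apply: eq_sZ => k; rewrite fcoef_split //.
Qed.

(** By Parseval the partial sums for F against p q equal F against the partial
    sums for p q. The former tend to g, the latter to p q. *)
Lemma recon_bump F g : intO F -> boxlim (fcos F) (fsin F) g -> continuous g ->
  J (fun x => (F x - g x) * (p x.1 * q x.2)) = 0.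
Proof.
move=> iF [C HC] cg.
have cpq : continuous (fun x : R * R => p x.1 * q x.2).
  by apply: cont_mul2; [exact: cont_fst|exact: cont_snd].
have i1 := intO_mulc iF cpq; have i2 := intO_mulc (cont_intO cg) cpq.
have -> : J (fun x => (F x - g x) * (p x.1 * q x.2)) =
    J (fun x => F x * (p x.1 * q x.2)) - J (fun x => g x * (p x.1 * q x.2)).
  by rewrite -JB //; apply: eq_J => x _; rewrite mulrBl.
have [D HD] := bump_ends dp p01 pout; have [E HE] := bump_ends dq q01 qout.
pose e N : R := swt R - sZ N (wt R); pose e2 N : R := swt R ^+ 2 - sZ N (wt R) ^+ 2.
have e0 N : 0 <= e N by rewrite subr_ge0 sZ_wt_lim.
have e20 N : 0 <= e2 N.
  rewrite subr_ge0 ler_sqr ?nnegrE ?sZ_wt_ge0 ?sZ_wt_lim //.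
  exact: le_trans (sZ_wt_ge0 _ 0) (sZ_wt_lim _ _).
have sw N : e N <= swt R by rewrite gerBl sZ_wt_ge0.
have cfs (r : R -> R) N : continuous r -> continuous (fsum r N).
  move=> cr; rewrite (_ : fsum r N = fun y => sZ N (fun k => tau k 0 (fcoef r k 0) (I01 (fun t => r t * sin (2 * pi * k%:~R * t))) (y, 0))).
    have K k : continuous (fun y => tau k 0 (fcoef r k 0) (I01 (fun t => r t * sin (2 * pi * k%:~R * t))) (y, 0)).
      by apply: cont_slice1; exact: Cinf2_cont (tau_Cinf2 _ _ _ _).
    elim: N => [|N IH].
      by rewrite (_ : (fun y => _) = fun y => tau 0 0 (fcoef r 0 0) (I01 (fun t => r t * sin (2 * pi * 0%:~R * t))) (y, 0)) //; apply/funext => y; rewrite sZ0.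
    rewrite (_ : (fun y => _) = fun y => (fun y => sZ N (fun k => tau k 0 (fcoef r k 0) (I01 (fun t => r t * sin (2 * pi * k%:~R * t))) (y, 0))) y +
       (tau (Posz N.+1) 0 (fcoef r (Posz N.+1) 0) (I01 (fun t => r t * sin (2 * pi * (Posz N.+1)%:~R * t))) (y, 0) + tau (- Posz N.+1) 0 (fcoef r (- Posz N.+1) 0) (I01 (fun t => r t * sin (2 * pi * (- Posz N.+1)%:~R * t))) (y, 0))).
      by move=> x; exact: (continuousD (IH x) (continuousD (K (Posz N.+1) x) (K (- Posz N.+1) x))).
    by apply/funext => y; rewrite sZS.
  apply/funext => y; apply: eq_sZ => k; rewrite fcoef_split // /tau /th /=.
  by rewrite mulr0 addr0.
have cS N : continuous (fun x : R * R => fsum p N x.1 * fsum q N x.2).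
  by apply: cont_mul2; [apply: cont_fst|apply: cont_snd]; exact: cfs.
(* Both sides are the same double sum of products of coefficients. *)
have M N : J (fun x => F x * (fsum p N x.1 * fsum q N x.2)) =
           J (fun x => tBox (fcos F) (fsin F) N x * (p x.1 * q x.2)).
  pose X k l := Pc k * Qc l - Ps k * Qs l; pose Y k l := Ps k * Qc l + Pc k * Qs l.
  have ic k l := intO_mulc iF (@cont_cos_th k l); have iss k l := intO_mulc iF (@cont_sin_th k l).
  pose G k l x := X k l * (F x * cos (th k l x)) + Y k l * (F x * sin (th k l x)).
  have iG k l : intO (G k l) by apply: intO_D; exact: intO_Z.
  have -> : J (fun x => F x * (fsum p N x.1 * fsum q N x.2)) = J (fun x => sZ N (fun k => sZ N (fun l => G k l x))).
    apply: eq_J => x _; rewrite -box_product /Box -sZM; apply: eq_sZ => k.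
    by rewrite -sZM; apply: eq_sZ => l; rewrite /G /X /Y; ring.
  have S1 k := J_sZ N (iG k).
  rewrite (J_sZ N (fun k => (S1 k).1)).2.
  pose H k l x := fcos F k l * (cos (th k l x) * (p x.1 * q x.2)) + fsin F k l * (sin (th k l x) * (p x.1 * q x.2)).
  have jc k l : intO (fun x => cos (th k l x) * (p x.1 * q x.2)).
    by apply: cont_intO; apply: cont_mul2 => //; exact: cont_cos_th.
  have js k l : intO (fun x => sin (th k l x) * (p x.1 * q x.2)).
    by apply: cont_intO; apply: cont_mul2 => //; exact: cont_sin_th.
  have iH k l : intO (H k l) by apply: intO_D; exact: intO_Z.
  have -> : J (fun x => tBox (fcos F) (fsin F) N x * (p x.1 * q x.2)) = J (fun x => sZ N (fun k => sZ N (fun l => H k l x))).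
    apply: eq_J => x _; rewrite mulrC /tBox /Box -sZM; apply: eq_sZ => k.
    by rewrite -sZM; apply: eq_sZ => l; rewrite /H /tau; ring.
  have S2 k := J_sZ N (iH k).
  rewrite (J_sZ N (fun k => (S2 k).1)).2; apply: eq_sZ => k.
  rewrite (S1 k).2 (S2 k).2; apply: eq_sZ => l.
  rewrite /G /H (JD (intO_Z _ (ic k l)) (intO_Z _ (iss k l))) (JD (intO_Z _ (jc k l)) (intO_Z _ (js k l))).
  rewrite (JZ _ (ic k l)) (JZ _ (iss k l)) (JZ _ (jc k l)) (JZ _ (js k l)).
  by have [-> ->] := J_trig_bump k l; rewrite -/(fcos F k l) -/(fsin F k l) /X /Y; ring.
apply: (@tends0_zero R _ (fun N => (`|D| + (1 + `|D| * swt R) * `|E|) * J (fun x => `|F x|) * e N + `|C| * e2 N)); last first.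
  by apply: tends0_add; apply: tends0_scale; [exact: tail_tends0|exact: box_tail].
move=> N.
have -> : J (fun x => F x * (p x.1 * q x.2)) - J (fun x => g x * (p x.1 * q x.2)) =
   J (fun x => F x * (p x.1 * q x.2 - fsum p N x.1 * fsum q N x.2)) +
   J (fun x => (tBox (fcos F) (fsin F) N x - g x) * (p x.1 * q x.2)).
  have -> : J (fun x => F x * (p x.1 * q x.2 - fsum p N x.1 * fsum q N x.2)) =
     J (fun x => F x * (p x.1 * q x.2)) - J (fun x => F x * (fsum p N x.1 * fsum q N x.2)).
    by rewrite -JB //; [apply: eq_J => x _; rewrite mulrBr|exact: intO_mulc].
  have -> : J (fun x => (tBox (fcos F) (fsin F) N x - g x) * (p x.1 * q x.2)) =
     J (fun x => tBox (fcos F) (fsin F) N x * (p x.1 * q x.2)) - J (fun x => g x * (p x.1 * q x.2)).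
    rewrite -JB //; first by apply: eq_J => x _; rewrite mulrBl.
    by apply: intO_mulc => //; apply: cont_intO; exact: Cinf2_cont (tBox_qper _ _ _).1.
  by rewrite M; ring.
apply: le_trans (ler_normD _ _) _; apply: lerD.
  rewrite -mulrA [_ * e N]mulrC mulrA.
  apply: J_abs_le => //.
  - exact: cont_sub2.
  - by rewrite mulr_ge0 // addr_ge0 // mulr_ge0 // addr_ge0 // mulr_ge0 // (le_trans _ (sw N)).
  move=> [x y] /OmegaP [x01 y01] /=.
  have hx := HD N x x01; have hy := HE N y y01.
  have {}hx : `|p x - fsum p N x| <= `|D| * e N by apply: le_trans hx _; rewrite ler_wpM2r ?e0 // ler_norm.
  have {}hy : `|q y - fsum q N y| <= `|E| * e N by apply: le_trans hy _; rewrite ler_wpM2r ?e0 // ler_norm.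
  have hq : `|q y| <= 1 by have /andP[h0 h1] := q01 y; rewrite ger0_norm.
  have hp : `|p x| <= 1 by have /andP[h0 h1] := p01 x; rewrite ger0_norm.
  have hs : `|fsum p N x| <= 1 + `|D| * swt R.
    have -> : fsum p N x = p x - (p x - fsum p N x) by ring.
    apply: le_trans (ler_normB _ _) _; apply: lerD => //; apply: le_trans hx _.
    by rewrite ler_wpM2l.
  have -> : p x * q y - fsum p N x * fsum q N y =
    (p x - fsum p N x) * q y + fsum p N x * (q y - fsum q N y) by ring.
  apply: le_trans (ler_normD _ _) _; rewrite !normrM mulrDl; apply: lerD.
    by rewrite -[leRHS]mulr1; apply: ler_pM.
  by rewrite -mulrA; apply: ler_pM.
have ct : continuous (fun x => tBox (fcos F) (fsin F) N x - g x).
  by apply: cont_sub2 => //; exact: Cinf2_cont (tBox_qper _ _ _).1.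
have := J_norm (cont_intO (cont_mul2 ct cpq)); move=> h; apply: le_trans h _.
rewrite -[leRHS]J_cst; apply: J_le.
- by have := integrable_norm (cont_intO (cont_mul2 ct cpq)).
- by apply: cont_intO => x; exact: cvg_cst.
move=> x Ox; rewrite normrM -[leRHS]mulr1; apply: ler_pM => //.
  by apply: le_trans (HC N x) _; rewrite ler_wpM2r ?e20 // ler_norm.
have /andP[h0 h1] := p01 x.1; have /andP[h2 h3] := q01 x.2.
by rewrite ger0_norm ?mulr_ge0 // mulr_ile1.
Qed.

End Bump.

Lemma recon F g : intO F -> boxlim (fcos F) (fsin F) g -> continuous g ->
  ae_eq (leb2 R) Om (EFin \o F) (EFin \o g).
Proof.
move=> iF bF cg.
have iFg : intO (fun x => F x - g x) by apply: intO_B => //; exact: cont_intO.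
have H a b c d n : 0 <= a -> b <= 1 -> 0 <= c -> d <= 1 ->
    J (fun x => (F x - g x) * (cutoff a b n x.1 * cutoff c d n x.2)) = 0.
  move=> a0 b1 c0 d1; apply: recon_bump => //; try exact: dC_cutoff.
  - by move=> t; rewrite cutoff_ge0 cutoff_le1.
  - by move=> t; rewrite cutoff_ge0 cutoff_le1.
  - move=> t /orP[h|h]; apply: cutoff_out; apply/orP; [left|right]; lra.
  - move=> t /orP[h|h]; apply: cutoff_out; apply/orP; [left|right]; lra.
have := fundamental_ae iFg H; apply: filterS => x /= + Ox => /(_ Ox) [] /eqP.
by rewrite subr_eq0 => /eqP ->.
Qed.

End Recon.

(** * Elliptic regularity *)

Section Regularity.
Variable R : realType.
Notation T := (measurableTypeR R).
Notation Om := (@Omega R : set (T * T)).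
Implicit Types (F f g : R * R -> R).

Definition Ex (a b : R) (x : R * R) : R := expR (a * x.1) * expR (b * x.2).

Lemma Ex_qper a b : qper (expR a) (expR b) (Ex a b).
Proof.
split; first by apply: Cinf2_mul; [exact: Cinf2_fst (Cinf1_exp a)|exact: Cinf2_snd (Cinf1_exp b)].
by move=> x y; rewrite /Ex /= !mulrDr !mulr1 !expRD; split; ring.
Qed.

Lemma Ex_pder j a b : pder j (Ex a b) (fun x => (if j then b else a) * Ex a b x).
Proof.
case: j; [apply: (pder_eqr (pder_mul (pder2_fst (fun t => expR (a * t))) (pder2_snd (@dexp R b))))|
  apply: (pder_eqr (pder_mul (pder1_fst (@dexp R a)) (pder1_snd (fun t => expR (b * t)))))] => x;
  by rewrite /Ex; ring.
Qed.

Lemma ExK a b x : Ex (- a) (- b) x * Ex a b x = 1.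
Proof.
by rewrite /Ex !mulNr !expRN; have := expR_gt0 (a * x.1); have := expR_gt0 (b * x.2) => h1 h2; field; rewrite !lt0r_neq0.
Qed.

(** The boundary condition with multipliers c_j is built into the choice of
    test functions. *)
Definition weak_lap (c1 c2 : R) f g := forall t, qper c1^-1 c2^-1 t ->
  J (fun x => f x * lap t x) = J (fun x => g x * t x).

Variables (c1 c2 : R) (c1_gt0 : 0 < c1) (c2_gt0 : 0 < c2).
Let l1 := ln c1.
Let l2 := ln c2.
Let E := Ex (- l1) (- l2).

Lemma E_qper : qper c1^-1 c2^-1 E.
Proof.
by have := Ex_qper (- l1) (- l2); rewrite !expRN !lnK // posrE.
Qed.

Lemma Etau_qper k l p q : qper c1^-1 c2^-1 (fun x => E x * tau k l p q x).
Proof.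
by have := qper_mul E_qper (tau_qper k l p q); rewrite !mulr1.
Qed.

Let ll (j : bool) := if j then l2 else l1.

Lemma Etau_pD j k l p q : pD j (fun x => E x * tau k l p q x) =
  fun x => E x * tau k l (frq R j k l * q - ll j * p) (- frq R j k l * p - ll j * q) x.
Proof.
apply: pderE; apply: (pder_eqr (pder_mul (Ex_pder j _ _) (tau_pder j k l p q))) => x.
by rewrite /E /tau /ll; case: j; ring.
Qed.

Let rr k l := l1 ^+ 2 + l2 ^+ 2 - (frq R false k l ^+ 2 + frq R true k l ^+ 2).
Let mm k l := 2 * (l1 * frq R false k l + l2 * frq R true k l).

(** These are the eigenfunctions in real form: the Laplacian acts on the pair
    (p, q) as multiplication by the complex number rr + i mm. *)
Lemma Etau_lap k l p q : lap (fun x => E x * tau k l p q x) =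
  fun x => E x * tau k l (rr k l * p - mm k l * q) (rr k l * q + mm k l * p) x.
Proof.
rewrite /lap !Etau_pD; apply/funext => x; rewrite /tau /ll /rr /mm; ring.
Qed.

Definition cE f k l := fcos (fun x => f x * E x) k l.
Definition sE f k l := fsin (fun x => f x * E x) k l.

Lemma J_Etau f k l p q : intO f ->
  J (fun x => f x * (E x * tau k l p q x)) = p * cE f k l + q * sE f k l.
Proof.
move=> iF; have iE := intO_mulc iF (Cinf2_cont E_qper.1).
have ic := intO_mulc iE (@cont_cos_th R k l); have iss := intO_mulc iE (@cont_sin_th R k l).
rewrite /cE /sE /fcos /fsin -(JZ _ ic) -(JZ _ iss) -(JD (intO_Z _ ic) (intO_Z _ iss)).
by apply: eq_J => x _; rewrite /tau; ring.
Qed.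

Lemma coef_step f g k l : intO f -> intO g -> weak_lap c1 c2 f g ->
  cE g k l = rr k l * cE f k l + mm k l * sE f k l /\
  sE g k l = rr k l * sE f k l - mm k l * cE f k l.
Proof.
move=> jf jg H.
have := H _ (Etau_qper k l 1 0); have := H _ (Etau_qper k l 0 1).
rewrite !Etau_lap !J_Etau // => h1 h2; split; [move: h2|move: h1] => h.
  by rewrite -[LHS]addr0 -[X in _ + X](mul0r (sE g k l)) -{1}[cE g k l]mul1r -h; ring.
by rewrite -[LHS]add0r -[X in X + _](mul0r (cE g k l)) -{1}[sE g k l]mul1r -h; ring.
Qed.

Let A f k l := cE f k l ^+ 2 + sE f k l ^+ 2.
Let Q (k l : int) : R := (1 + k%:~R ^+ 2 + l%:~R ^+ 2) ^+ 2.

(** The real part of the eigenvalue alone controls the frequency. *)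
Lemma Q_le k l : Q k l <= 2 * (1 + l1 ^+ 2 + l2 ^+ 2) ^+ 2 * (1 + rr k l ^+ 2).
Proof.
rewrite /Q /rr /frq; have S0 : 0 <= l1 ^+ 2 + l2 ^+ 2 by rewrite addr_ge0 ?sqr_ge0.
have -> : 1 + l1 ^+ 2 + l2 ^+ 2 = 1 + (l1 ^+ 2 + l2 ^+ 2) by rewrite addrA.
set x : R := k%:~R; set y : R := l%:~R.
have p1 : 1 <= (2 * pi : R) by have := pi_ge2 R; lra.
have P1 : 1 <= (2 * pi : R) ^+ 2 by rewrite exprn_ege1.
set P := (2 * pi : R) in P1 p1 *.
have P0 : 0 <= P ^+ 2 by exact: sqr_ge0.
set v := x ^+ 2 + y ^+ 2; have v0 : 0 <= v by rewrite addr_ge0 ?sqr_ge0.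
have Pv : v <= P ^+ 2 * v by rewrite ler_peMl.
have -> : (P * x) ^+ 2 + (P * y) ^+ 2 = P ^+ 2 * v by rewrite /v; ring.
have -> : 1 + x ^+ 2 + y ^+ 2 = 1 + v by rewrite /v addrA.
have h : (1 + v) ^+ 2 <= (1 + P ^+ 2 * v) ^+ 2.
  by rewrite ler_sqr ?nnegrE ?lerD2l // addr_ge0 // mulr_ge0.
apply: le_trans h _; move: (P ^+ 2 * v) => w; move: S0; move: (l1 ^+ 2 + l2 ^+ 2) => {}S S0.
have h1 : 0 <= S * (S + 2) * (S - w) ^+ 2.
  by apply: mulr_ge0; [apply: mulr_ge0 => //; lra|exact: sqr_ge0].
have h2 := sqr_ge0 (1 + S + (S - w)).
rewrite -subr_ge0; have -> : 2 * (1 + S) ^+ 2 * (1 + (S - w) ^+ 2) - (1 + w) ^+ 2 =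
  (1 + S + (S - w)) ^+ 2 + 2 * (S * (S + 2) * (S - w) ^+ 2) by ring.
by apply: addr_ge0 => //; apply: mulr_ge0.
Qed.

(** Each step of the sequence multiplies A by the square of the modulus of the
    eigenvalue, while the coefficients of every member are bounded by an L^1
    norm. *)
Lemma chain_decay n (f : nat -> R * R -> R) : (forall i, intO (f i)) ->
  (forall i, weak_lap c1 c2 (f i) (f i.+1)) -> exists2 C, 0 <= C &
  forall k l, Q k l ^+ n * A (f 0%N) k l <= C.
Proof.
elim: n f => [|n IH] f jf hf.
  have iE := intO_mulc (jf 0%N) (Cinf2_cont E_qper.1).
  set B := J (fun x => `|f 0%N x * E x|).
  have B0 : 0 <= B by apply: J_ge0.
  exists (2 * B ^+ 2); first by rewrite mulr_ge0 ?sqr_ge0.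
  move=> k l; rewrite expr0 mul1r.
  have h1 : `|cE (f 0%N) k l| <= 1 * B.
    by apply: J_abs_le => //; [exact: cont_cos_th|move=> x _; rewrite ler_norml cos_geN1 cos_le1].
  have h2 : `|sE (f 0%N) k l| <= 1 * B.
    by apply: J_abs_le => //; [exact: cont_sin_th|move=> x _; rewrite ler_norml sin_geN1 sin_le1].
  rewrite mul1r in h1; rewrite mul1r in h2.
  rewrite /A mulr2n mulrDl mul1r -[cE _ _ _ ^+ 2]real_normK ?num_real // -[sE _ _ _ ^+ 2]real_normK ?num_real //.
  by apply: lerD; rewrite ler_sqr ?nnegrE.
have [C0 C00 H0] := IH f jf hf.
have [C1 C10 H1] := IH (fun i => f i.+1) (fun i => jf i.+1) (fun i => hf i.+1).
set K := 2 * (1 + l1 ^+ 2 + l2 ^+ 2) ^+ 2.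
have K0 : 0 <= K by rewrite mulr_ge0 ?sqr_ge0.
exists (K * (C0 + C1)); first by rewrite mulr_ge0 ?addr_ge0.
move=> k l; have := H0 k l; have := H1 k l; have := Q_le k l.
have [e1 e2] := coef_step k l (jf 0%N) (jf 1%N) (hf 0%N).
rewrite /A e1 e2 -/K; set c := cE _ _ _; set s := sE _ _ _.
have Q0 : 0 <= Q k l ^+ n by rewrite exprn_ge0 // sqr_ge0.
rewrite [Q k l ^+ n.+1]exprS; move: Q0; set q := Q k l ^+ n; set r := rr k l; set m := mm k l; move=> q0 hQ h1 h2.
have a0 : 0 <= c ^+ 2 + s ^+ 2 by rewrite addr_ge0 ?sqr_ge0.
have qa : 0 <= q * (c ^+ 2 + s ^+ 2) by exact: mulr_ge0.
rewrite -[Q k l * q * _]mulrA; apply: le_trans (ler_wpM2r qa hQ) _; rewrite -mulrA ler_wpM2l //.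
rewrite mulrDl mul1r; apply: lerD => //; apply: le_trans h1.
have -> : q * ((r * c + m * s) ^+ 2 + (r * s - m * c) ^+ 2) = r ^+ 2 * (q * (c ^+ 2 + s ^+ 2)) + m ^+ 2 * (q * (c ^+ 2 + s ^+ 2)) by ring.
by rewrite lerDl mulr_ge0 ?sqr_ge0.
Qed.

Lemma wt_Q k l : 1 <= Q k l * (wt R k * wt R l).
Proof.
rewrite /Q /wt; have := wt_den_gt0 R k; have := wt_den_gt0 R l.
set x : R := k%:~R; set y : R := l%:~R => h1 h2.
rewrite -invfM -[_ * _^-1]/(_ / _) ler_pdivlMr ?mulr_gt0 // mul1r.
have := sqr_ge0 x; have := sqr_ge0 y; set u := x ^+ 2; set v := y ^+ 2 => u0 v0.
nra.
Qed.

Lemma coef_decay (f : nat -> R * R -> R) : (forall i, intO (f i)) ->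
  (forall i, weak_lap c1 c2 (f i) (f i.+1)) -> decay (cE (f 0%N)) /\ decay (sE (f 0%N)).
Proof.
move=> jf hf.
have H (a : int -> int -> R) : (forall k l, a k l ^+ 2 <= A (f 0%N) k l) -> decay a.
  (* The exponent is doubled because A is quadratic in the coefficients. *)
  move=> ha m; have [C C0 HC] := chain_decay (m + m) jf hf.
  exists (1 + C) => k l.
  have Q1 : 1 <= Q k l ^+ m * (wt R k * wt R l) ^+ m by rewrite -exprMn exprn_ege1 // wt_Q.
  have w0 : 0 <= (wt R k * wt R l) ^+ m by rewrite exprn_ge0 // mulr_ge0 // ltW // wt_gt0.
  have Q0 : 0 <= Q k l ^+ m by rewrite exprn_ge0 // sqr_ge0.
  have hq : `|a k l| * Q k l ^+ m <= 1 + C.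
    have : (`|a k l| * Q k l ^+ m) ^+ 2 <= C.
      rewrite exprMn real_normK ?num_real // -exprM muln2 -addnn mulrC.
      by apply: le_trans (HC k l); rewrite ler_wpM2l // exprD mulr_ge0.
    have : 0 <= `|a k l| * Q k l ^+ m by rewrite mulr_ge0.
    set z := `|a k l| * _ => z0 hz; nra.
  apply: le_trans (_ : `|a k l| * (Q k l ^+ m * (wt R k * wt R l) ^+ m) <= _).
    by rewrite ler_peMr.
  by rewrite mulrA ler_wpM2r.
by split; apply: H => k l; rewrite /A ?lerDl ?lerDr sqr_ge0.
Qed.

(** Divide by c_1^(x_1) c_2^(x_2) to reach the torus, rebuild the function
    from its rapidly decreasing Fourier coefficients, and multiply back. *)
Theorem regularity (f : nat -> R * R -> R) : (forall i, intO (f i)) ->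
  (forall i, weak_lap c1 c2 (f i) (f i.+1)) ->
  exists2 g, qper c1 c2 g & ae_eq (leb2 R) Om (EFin \o f 0%N) (EFin \o g).
Proof.
move=> jf hf; have [dc ds] := coef_decay jf hf.
have [g bg] := boxlim_exists dc ds; have Vg := boxlim_qper dc ds bg.
have iE := intO_mulc (jf 0%N) (Cinf2_cont E_qper.1).
have ae := recon iE bg (Cinf2_cont Vg.1).
exists (fun x => Ex l1 l2 x * g x).
  by have := qper_mul (Ex_qper l1 l2) Vg; rewrite !mulr1 !lnK // posrE.
apply: filterS ae => x /= + Ox => /(_ Ox) [] <-.
by rewrite [_ * E x]mulrC mulrA [Ex l1 l2 x * _]mulrC ExK mul1r.
Qed.

Theorem weak_unique f : intO f ->
  (forall t, qper c1^-1 c2^-1 t -> J (fun x => f x * t x) = 0) ->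
  ae_eq (leb2 R) Om (EFin \o f) (fun=> 0%E).
Proof.
move=> jf H; have iE := intO_mulc jf (Cinf2_cont E_qper.1).
have ec k l : cE f k l = 0.
  by have := H _ (Etau_qper k l 1 0); rewrite J_Etau // mul1r mul0r addr0.
have es k l : sE f k l = 0.
  by have := H _ (Etau_qper k l 0 1); rewrite J_Etau // mul1r mul0r add0r.
have bg : boxlim (cE f) (sE f) (fun=> 0).
  exists 0 => N z; rewrite mul0r normr_le0 subr0 /tBox /Box.
  rewrite (@eq_sZ _ N _ (fun k => 0 * 0)) ?sZM ?mul0r // => k.
  rewrite (@eq_sZ _ N _ (fun k => 0 * 0)) ?sZM ?mul0r // => l.
  by rewrite ec es /tau !mul0r addr0.
have := recon iE bg (@Cinf2_cont R (fun=> 0) (Cinf2_cst 0)).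
apply: filterS => x /= + Ox => /(_ Ox) [] fE.
have E0 : E x != 0 by rewrite gt_eqF // mulr_gt0 // expR_gt0.
by congr (_%:E); apply: (mulIf E0); rewrite mul0r.
Qed.

End Regularity.

(** * Square integrable functions *)

Section RealL2.
Variable R : realType.
Notation T := (measurableTypeR R).
Notation Om := (@Omega R : set (T * T)).
Implicit Types (f g : R * R -> R).

Definition mO f := measurable_fun Om (f : T * T -> T).
Definition sq f := mO f /\ intO (fun x => f x ^+ 2).

Lemma mO_mul f g : mO f -> mO g -> mO (fun x => f x * g x).
Proof. exact: measurable_funM. Qed.

Lemma mO_add f g : mO f -> mO g -> mO (fun x => f x + g x).
Proof. exact: measurable_funD. Qed.

Lemma mO_cont f : continuous f -> mO f.
Proof. by move=> cf; exact: cont2_measurable (@measurable_Omega R) cf. Qed.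

Lemma eq_intO f g : (forall x, f x = g x) -> intO f -> intO g.
Proof. by move=> /funext ->. Qed.

Lemma intO_dom f g : mO f -> intO g -> (forall x, `|f x| <= g x) -> intO f.
Proof.
move=> mf ig H; apply: (le_integrable (@measurable_Omega R) _ _ ig).
  exact/measurable_EFinP.
by move=> x _ /=; rewrite lee_fin (le_trans (H x)) // ler_norm.
Qed.

Lemma sq_intM f g : sq f -> sq g -> intO (fun x => f x * g x).
Proof.
move=> [mf jf] [mg jg]; apply: (intO_dom (mO_mul mf mg) (intO_D jf jg)) => x.
rewrite normrM; have := sqr_ge0 (`|f x| - `|g x|).
rewrite -(real_normK (num_real (f x))) -(real_normK (num_real (g x))).
have := normr_ge0 (f x); have := normr_ge0 (g x).
move: (`|f x|) (`|g x|) => a b ha hb h; nra.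
Qed.

Lemma sq_cont f : continuous f -> sq f.
Proof.
by move=> cf; split; [exact: mO_cont|apply: cont_intO; apply: cont_mul2].
Qed.

Lemma sq_int f : sq f -> intO f.
Proof.
move=> hf; apply: eq_intO (sq_intM hf (@sq_cont (fun=> 1) (fun x => cvg_cst _))) => x.
exact: mulr1.
Qed.

Lemma sq_mul f g : sq f -> continuous g -> sq (fun x => g x * f x).
Proof.
move=> [mf jf] cg; split; first exact: mO_mul (mO_cont cg) mf.
by apply: eq_intO (intO_mulc jf (cont_mul2 cg cg)) => x; ring.
Qed.

Lemma sq_scale c f : sq f -> sq (fun x => c * f x).
Proof. by move=> hf; apply: (@sq_mul _ (fun=> c)) => // x; exact: cvg_cst. Qed.

Lemma sq_add f g : sq f -> sq g -> sq (fun x => f x + g x).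
Proof.
move=> hf hg; split; first exact: mO_add hf.1 hg.1.
apply: eq_intO (intO_D (intO_D hf.2 (intO_Z 2 (sq_intM hf hg))) hg.2) => x; ring.
Qed.

Definition aeO f g := ae_eq (leb2 R) Om (EFin \o f) (EFin \o g).

Lemma aeO_refl f : aeO f f.
Proof. by apply/aeW. Qed.

Lemma aeO_add f f' g g' : aeO f f' -> aeO g g' -> aeO (fun x => f x + g x) (fun x => f' x + g' x).
Proof. by apply: filterS2 => x /= + + Ox => /(_ Ox) [->] /(_ Ox) [->]. Qed.

Lemma aeO_mul f f' g g' : aeO f f' -> aeO g g' -> aeO (fun x => f x * g x) (fun x => f' x * g' x).
Proof. by apply: filterS2 => x /= + + Ox => /(_ Ox) [->] /(_ Ox) [->]. Qed.

Lemma aeO_scale c f g : aeO f g -> aeO (fun x => c * f x) (fun x => c * g x).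
Proof. by apply: aeO_mul; exact: aeO_refl. Qed.

Lemma J_ae f g : mO f -> mO g -> aeO f g -> J f = J g.
Proof.
move=> mf mg h; rewrite /J /Rintegral; congr (fine _); apply: ae_eq_integral => //.
- exact: measurable_Omega.
- exact/measurable_EFinP.
- exact/measurable_EFinP.
Qed.

End RealL2.

(** * The operator L_h and its adjoint *)

Section Complex.
Variable R : realType.
Notation T := (measurableTypeR R).
Notation Om := (@Omega R : set (T * T)).
Implicit Types (f g phi : R * R -> R[i]) (a b : R * R -> R).

Definition re f : R * R -> R := fun x => complex.Re (f x).
Definition im f : R * R -> R := fun x => complex.Im (f x).
Definition cx a b : R * R -> R[i] := fun x => (a x +i* b x)%C.

Lemma cxK f : cx (re f) (im f) = f.
Proof. by apply/funext => x; rewrite /cx /re /im; case: (f x). Qed.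

Lemma ReM (x y : R[i]) : complex.Re (x * y) = complex.Re x * complex.Re y - complex.Im x * complex.Im y.
Proof. by case: x y => [a b] [c d]. Qed.

Lemma ImM (x y : R[i]) : complex.Im (x * y) = complex.Re x * complex.Im y + complex.Im x * complex.Re y.
Proof. by case: x y => [a b] [c d]. Qed.

Lemma ReC (x : R[i]) : complex.Re (x^*) = complex.Re x.
Proof. by case: x. Qed.

Lemma ImC (x : R[i]) : complex.Im (x^*) = - complex.Im x.
Proof. by case: x. Qed.

Lemma eq_cplx (x y : R[i]) : complex.Re x = complex.Re y -> complex.Im x = complex.Im y -> x = y.
Proof. by case: x y => [a b] [c d] /= -> ->. Qed.

Lemma normc2 (z : R[i]) : ComplexField.Normc.normc z ^+ 2 = complex.Re z ^+ 2 + complex.Im z ^+ 2.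
Proof.
by case: z => a b; rewrite /ComplexField.Normc.normc sqr_sqrtr // addr_ge0 ?sqr_ge0.
Qed.

Lemma L2_sq f : L2 (leb2 R) Om f <-> sq (re f) /\ sq (im f).
Proof.
split=> [[m1 m2 i]|[[m1 i1] [m2 i2]]].
  have {}i : intO (fun x => re f x ^+ 2 + im f x ^+ 2).
    by move: i; rewrite (_ : (fun x => _) = EFin \o (fun x => re f x ^+ 2 + im f x ^+ 2)) //; apply/funext => x; rewrite normc2.
  split; split => //; apply: (intO_dom _ i).
  - exact: (mO_mul m1 m1).
  - by move=> x; rewrite ger0_norm ?sqr_ge0 // lerDl sqr_ge0.
  - exact: (mO_mul m2 m2).
  - by move=> x; rewrite ger0_norm ?sqr_ge0 // lerDr sqr_ge0.
split=> //; have := intO_D i1 i2.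
by rewrite /intO (_ : EFin \o _ = fun x => (ComplexField.Normc.normc (f x) ^+ 2)%:E) //; apply/funext => x /=; rewrite normc2.
Qed.

Lemma L2norm2 f : L2norm (leb2 R) Om f ^+ 2 = J (fun x => re f x ^+ 2 + im f x ^+ 2).
Proof.
rewrite /L2norm sqr_sqrtr; last by apply: Rintegral_ge0 => x _; exact: sqr_ge0.
by apply: eq_J => x _; rewrite normc2.
Qed.

Lemma int_OmegaE f : int_Omega f = (J (re f) +i* J (im f))%C.
Proof. by []. Qed.

Lemma laplacianE f : laplacian f = cx (lap (re f)) (lap (im f)).
Proof. by rewrite /laplacian !pderivE. Qed.

Lemma re_laplacian f : re (laplacian f) = lap (re f).
Proof. by rewrite laplacianE. Qed.

Lemma im_laplacian f : im (laplacian f) = lap (im f).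
Proof. by rewrite laplacianE. Qed.

Definition qperc c1 c2 f := qper c1 c2 (re f) /\ qper c1 c2 (im f).
Definition aeC f g := aeO (re f) (re g) /\ aeO (im f) (im g).

Lemma qper0 c1 c2 : qper c1 c2 (fun=> 0 : R).
Proof. by split; [exact: Cinf2_cst|move=> x y; rewrite !mulr0]. Qed.

Lemma qperc_smooth c1 c2 f : qperc c1 c2 f -> smooth f.
Proof. by move=> [[h1 _] [h2 _]]; apply/smooth_Cinf2. Qed.

Lemma qperc_BC c1 c2 f : qperc c1 c2 f -> BC c1 c2 f.
Proof.
move=> [h1 h2] t ht; have [a1 a2 a3 a4] := QP_rBC h1 ht; have [b1 b2 b3 b4] := QP_rBC h2 ht.
rewrite !pderivE; split; apply: eq_cplx; rewrite ?ReM ?ImM /= !mul0r ?subr0 ?addr0 //.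
Qed.

Lemma BC_rBC c1 c2 f : BC c1 c2 f -> rBC c1 c2 (re f) /\ rBC c1 c2 (im f).
Proof.
move=> H; split=> t /H; rewrite !pderivE => -[] /[dup] /(congr1 (@complex.Re R)) + /(congr1 (@complex.Im R)) +
  /[dup] /(congr1 (@complex.Re R)) + /(congr1 (@complex.Im R)) +
  /[dup] /(congr1 (@complex.Re R)) + /(congr1 (@complex.Im R)) +
  /[dup] /(congr1 (@complex.Re R)) + /(congr1 (@complex.Im R)) +;
  rewrite !ReM !ImM /= !mul0r !subr0 !addr0 => *; by split.
Qed.

Lemma qperc_L2 c1 c2 f : qperc c1 c2 f -> L2 (leb2 R) Om f.
Proof. by move=> [h1 h2]; apply/L2_sq; split; apply: sq_cont; apply: Cinf2_cont; [exact: h1.1|exact: h2.1]. Qed.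

Lemma qperc_lap c1 c2 f : qperc c1 c2 f -> qperc c1 c2 (laplacian f).
Proof. by move=> [h1 h2]; rewrite laplacianE; split; exact: lap_qper. Qed.

(** What the proof uses of the operators L_h, with multipliers c = h, and
    L_h^*, with multipliers c = 1/h. *)
Record lapop (G : (R * R -> R[i]) -> (R * R -> R[i]) -> Prop) c1 c2 : Prop := LapOp {
  lapop_L2 : forall f g, G f g -> L2 (leb2 R) Om f /\ L2 (leb2 R) Om g;
  lapop_weak : forall f g, G f g -> weak_lap c1 c2 (re f) (re g) /\ weak_lap c1 c2 (im f) (im g);
  lapop_sm : forall f g, L2 (leb2 R) Om f -> qperc c1 c2 g -> aeC f g -> G f (laplacian g) }.

Lemma J_ae_mul a a' b : sq a -> sq a' -> sq b -> aeO a a' -> J (fun x => a x * b x) = J (fun x => a' x * b x).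
Proof.
move=> sa sa' sb h; apply: J_ae; [exact: mO_mul sa.1 sb.1|exact: mO_mul sa'.1 sb.1|].
by apply: aeO_mul => //; exact: aeO_refl.
Qed.

Lemma int_cmul f g : L2 (leb2 R) Om f -> L2 (leb2 R) Om g -> int_Omega (fun x => f x * g x) =
  ((J (fun x => re f x * re g x) - J (fun x => im f x * im g x)) +i*
   (J (fun x => re f x * im g x) + J (fun x => im f x * re g x)))%C.
Proof.
move=> /L2_sq [sf1 sf2] /L2_sq [sg1 sg2]; rewrite int_OmegaE.
rewrite -(JB (sq_intM sf1 sg1) (sq_intM sf2 sg2)) -(JD (sq_intM sf1 sg2) (sq_intM sf2 sg1)).
by congr (_ +i* _)%C; apply: eq_J => x _; rewrite /re /im ?ReM ?ImM.
Qed.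

Lemma int_cmulE f g a b c d : re f = a -> im f = b -> re g = c -> im g = d ->
  L2 (leb2 R) Om f -> L2 (leb2 R) Om g -> int_Omega (fun x => f x * g x) =
  ((J (fun x => a x * c x) - J (fun x => b x * d x)) +i*
   (J (fun x => a x * d x) + J (fun x => b x * c x)))%C.
Proof. by move=> <- <- <- <-; exact: int_cmul. Qed.

Lemma int_ae f f' g : L2 (leb2 R) Om f -> L2 (leb2 R) Om f' -> L2 (leb2 R) Om g -> aeC f f' ->
  int_Omega (fun x => f x * g x) = int_Omega (fun x => f' x * g x).
Proof.
move=> Lf Lf' Lg [h1 h2]; rewrite !int_cmul //.
move: Lf Lf' Lg => /L2_sq [s1 s2] /L2_sq [s1' s2'] /L2_sq [t1 t2].
by rewrite !(J_ae_mul s1 s1') // !(J_ae_mul s2 s2').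
Qed.

Lemma L2_conj f : L2 (leb2 R) Om f -> L2 (leb2 R) Om (fun x => (f x)^*).
Proof.
move=> /L2_sq [s1 s2]; apply/L2_sq; split.
  by rewrite (_ : re _ = re f) //; apply/funext => x; rewrite /re ReC.
rewrite (_ : im _ = fun x => -1 * im f x); first exact: sq_scale.
by apply/funext => x; rewrite /im ImC mulN1r.
Qed.

Lemma re_conj f : re (fun x => (f x)^*) = re f.
Proof. by apply/funext => x; rewrite /re ReC. Qed.

Lemma im_conj f : im (fun x => (f x)^*) = fun x => -1 * im f x.
Proof. by apply/funext => x; rewrite /im ImC mulN1r. Qed.

Lemma qperc_conj c1 c2 f : qperc c1 c2 f -> qperc c1 c2 (fun x => (f x)^*).
Proof. by move=> [h1 h2]; split; rewrite ?re_conj ?im_conj //; exact: qper_scale. Qed.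

Lemma aeC_conj f g : aeC f g -> aeC (fun x => (f x)^*) (fun x => (g x)^*).
Proof. by move=> [h1 h2]; split; rewrite ?re_conj ?im_conj //; exact: aeO_scale. Qed.

Lemma lap_scale c a : Cinf2 a -> lap (fun x => c * a x) = fun x => c * lap a x.
Proof.
move=> sa; rewrite /lap !pD_scale //; try exact: Cinf2_pD.
by apply/funext => x; rewrite mulrDr.
Qed.

Lemma lap0 : lap (fun=> 0 : R) = fun=> 0.
Proof. by rewrite /lap !pD_cst; apply/funext => x; rewrite addr0. Qed.

Lemma laplacian_conj f : smooth f -> laplacian (fun x => (f x)^*) = fun x => (laplacian f x)^*.
Proof.
move=> /smooth_Cinf2 [s1 s2]; rewrite !laplacianE re_conj im_conj lap_scale //.
by apply/funext => x; apply: eq_cplx; rewrite ?ReC ?ImC //= mulN1r.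
Qed.

Section Lh.
Variables (h1 h2 : R) (h1_gt0 : 0 < h1) (h2_gt0 : 0 < h2).

Lemma smooth_L2 f : smooth f -> L2 (leb2 R) Om f.
Proof. by move=> /smooth_Cinf2 [s1 s2]; apply/L2_sq; split; apply: sq_cont; exact: Cinf2_cont. Qed.

Lemma smooth_laplacian f : smooth f -> smooth (laplacian f).
Proof. by move=> /smooth_Cinf2 [s1 s2]; apply/smooth_Cinf2; rewrite laplacianE; split; exact: lap_Cinf2. Qed.

Lemma qperc_cx c1 c2 a : qper c1 c2 a -> qperc c1 c2 (cx a (fun=> 0)).
Proof. by move=> h; split=> //; exact: qper0. Qed.

Lemma laplacian_cx a : laplacian (cx a (fun=> 0)) = cx (lap a) (fun=> 0).
Proof. by rewrite laplacianE -[im _]/(fun=> 0) lap0. Qed.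

Lemma cx_inj (x y z t : R) : (x +i* y)%C = (z +i* t)%C -> x = z /\ y = t.
Proof. by case. Qed.

Lemma J0 a : (forall x, a x = 0) -> J a = 0.
Proof. by move=> H; rewrite (@eq_J _ _ (fun=> 0)) ?J_cst. Qed.

Lemma Lh_lapop : lapop (Lh h1 h2) h1 h2.
Proof.
split=> [f g []//|f g [Lf Lg H]|f g Lf Vg fg].
  have K t : qper h1^-1 h2^-1 t -> J (fun x => re f x * lap t x) = J (fun x => re g x * t x) /\
     J (fun x => im f x * lap t x) = J (fun x => im g x * t x).
    move=> Vt; have Vc := qperc_cx Vt; have Vl := qperc_lap Vc.
    have := H _ (qperc_smooth Vc) (qperc_BC Vc).
    rewrite (int_cmul Lf (qperc_L2 Vl)) (int_cmul Lg (qperc_L2 Vc)) laplacian_cx => /cx_inj.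
    by rewrite !(@J0 (fun x => _ * im _ x)) ?subr0 ?add0r // => x; rewrite mulr0.
  by split=> t Vt; have [] := K t Vt.
have sg := qperc_smooth Vg; split=> //; first exact: qperc_L2 (qperc_lap Vg).
move=> t st bt; have Lt := smooth_L2 st; have Llt := smooth_L2 (smooth_laplacian st).
rewrite (int_ae Lf (qperc_L2 Vg) Llt fg) (int_cmulE erefl erefl (re_laplacian t) (im_laplacian t) (qperc_L2 Vg) Llt).
rewrite (int_cmulE (re_laplacian g) (im_laplacian g) erefl erefl (qperc_L2 (qperc_lap Vg)) Lt).
have /smooth_Cinf2 [t1 t2] := st; have [b1 b2] := BC_rBC bt.
have [[g1 q1] [g2 q2]] := Vg; have B1 := QP_rBC Vg.1; have B2 := QP_rBC Vg.2.
have G := Green h1_gt0 h2_gt0.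
exact: (f_equal2 (@Complex R) (f_equal2 (fun u v : R => u - v) (G _ _ g1 t1 B1 b1) (G _ _ g2 t2 B2 b2))
  (f_equal2 (fun u v : R => u + v) (G _ _ g1 t2 B1 b2) (G _ _ g2 t1 B2 b1))).
Qed.

(** Quasi-periodic functions with multipliers h belong to the domain of L_h,
    so they may serve as test functions. Conversely the conjugate of a
    function with multipliers 1/h is a test function in the definition of L_h.
    *)
Lemma Lh_adj_lapop : lapop (Lh_adj h1 h2) h1^-1 h2^-1.
Proof.
have [_ _ HS] := Lh_lapop.
split=> [f g []//|f g [Lf Lg H]|f g Lf Vg fg].
  have K t : qper h1 h2 t -> J (fun x => re f x * lap t x) = J (fun x => re g x * t x) /\
     J (fun x => im f x * lap t x) = J (fun x => im g x * t x).
    move=> Vt; have Vc := qperc_cx Vt; have Vl := qperc_lap Vc.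
    have aec : aeC (cx t (fun=> 0)) (cx t (fun=> 0)) by split; exact: aeO_refl.
    have := H _ _ (HS _ _ (qperc_L2 Vc) Vc aec).
    rewrite -![cint _ _ _]/(int_Omega _) (int_cmul (qperc_L2 Vl) (L2_conj Lf)) (int_cmul (qperc_L2 Vc) (L2_conj Lg)).
    rewrite laplacian_cx !re_conj !im_conj => /cx_inj.
    have z (a b : R * R -> R) : J (fun x => im (cx a (fun=> 0)) x * b x) = 0 by apply: J0 => x; exact: mul0r.
    rewrite !z !subr0 !addr0.
    have /L2_sq [f1 f2] := Lf; have /L2_sq [g1 g2] := Lg.
    have lt1 := sq_cont (Cinf2_cont (lap_qper Vt).1); have st1 := sq_cont (Cinf2_cont Vt.1).
    move=> [e1 e2]; split.
      by rewrite (@eq_J _ _ (fun x => lap t x * re f x)) ?e1 => [|x _]; [apply: eq_J => x _|]; exact: mulrC.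
    have e (u v : R * R -> R) : sq u -> sq v -> J (fun x => u x * v x) = - J (fun x => v x * (-1 * u x)).
      move=> su sv; rewrite -[RHS]mulN1r -(JZ _ (sq_intM sv (sq_scale (-1) su))).
      by apply: eq_J => x _; ring.
    rewrite (e _ _ f2 lt1) (e _ _ g2 st1); congr (- _); exact: e2.
  by split=> t; rewrite !invrK => Vt; have [] := K t Vt.
have Vl := qperc_lap Vg; have Lg := qperc_L2 Vg; have Ll := qperc_L2 Vl.
split=> // u v [Lu Lv H]; rewrite -![cint _ _ _]/(int_Omega _).
have Vgc := qperc_conj Vg.
have := H _ (qperc_smooth Vgc) (qperc_BC Vgc); rewrite (laplacian_conj (qperc_smooth Vg)) => ->.
have C (p q : R * R -> R[i]) : int_Omega (fun x => p x * q x) = int_Omega (fun x => q x * p x).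
  by congr (int_Omega _); apply/funext => x; rewrite mulrC.
rewrite (C v (fun x => (f x)^*)) (C v (fun x => (g x)^*)).
exact: int_ae (L2_conj Lf) (L2_conj Lg) Lv (aeC_conj fg).
Qed.

End Lh.

End Complex.

(** * Smooth representatives *)

Section Hinfty.
Variable R : realType.
Notation T := (measurableTypeR R).
Notation Om := (@Omega R : set (T * T)).
Notation L2O := (L2 (leb2 R) Om).
Implicit Types (f g phi : R * R -> R[i]) (a b : R * R -> R).

Lemma aeC_refl f : aeC f f.
Proof. by split; exact: aeO_refl. Qed.

Definition N2 f := J (fun x => re f x ^+ 2 + im f x ^+ 2).

Lemma N2_ge0 f : 0 <= N2 f.
Proof. by apply: J_ge0 => x _; rewrite addr_ge0 ?sqr_ge0. Qed.

Lemma N2_ae f g : L2O f -> L2O g -> aeC f g -> N2 f = N2 g.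
Proof.
move=> /L2_sq [[m1 _] [m2 _]] /L2_sq [[m1' _] [m2' _]] [e1 e2]; apply: J_ae.
- by apply: mO_add; apply: mO_mul.
- by apply: mO_add; apply: mO_mul.
by apply: aeO_add; apply: aeO_mul.
Qed.

Variables (G : (R * R -> R[i]) -> (R * R -> R[i]) -> Prop) (c1 c2 : R).
Hypothesis (c1_gt0 : 0 < c1) (c2_gt0 : 0 < c2) (LG : lapop G c1 c2).

Lemma app_spec f : dom G f -> G f (app G f).
Proof. by move=> [g fg]; rewrite /app; apply: xgetPex; exists g. Qed.

(** By Green's formula b - lap g is orthogonal to all quasi-periodic functions
    with the inverse multipliers. *)
Lemma weak_lap_smooth a b (g : R * R -> R) : sq a -> sq b -> weak_lap c1 c2 a b -> qper c1 c2 g -> aeO a g -> aeO b (lap g).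
Proof.
move=> sa sb H Vg ag.
have sg : sq g := sq_cont (Cinf2_cont Vg.1).
have sl : sq (lap g) := sq_cont (Cinf2_cont (lap_qper Vg).1).
have K t : qper c1^-1 c2^-1 t -> J (fun x => (b x - lap g x) * t x) = 0.
  move=> Vt; have st : sq t := sq_cont (Cinf2_cont Vt.1).
  have slt : sq (lap t) := sq_cont (Cinf2_cont (lap_qper Vt).1).
  have -> : J (fun x => (b x - lap g x) * t x) = J (fun x => b x * t x) - J (fun x => lap g x * t x).
    by rewrite -(JB (sq_intM sb st) (sq_intM sl st)); apply: eq_J => x _; exact: mulrBl.
  have E1 := H t Vt; have E2 := J_ae_mul sa sg slt ag.
  have E3 := Green c1_gt0 c2_gt0 Vg.1 Vt.1 (QP_rBC Vg) (QP_rBC Vt).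
  by apply/eqP; rewrite subr_eq0; apply/eqP; exact: etrans (etrans (esym E1) E2) E3.
have := weak_unique c1_gt0 c2_gt0 (intO_B (sq_int sb) (sq_int sl)) K.
by apply: filterS => x /= + Ox => /(_ Ox) [] /eqP; rewrite subr_eq0 => /eqP ->.
Qed.

Lemma lap_step f g f' : G f g -> qperc c1 c2 f' -> aeC f f' -> aeC g (laplacian f').
Proof.
move=> fg [V1 V2] [e1 e2].
have [/L2_sq [s1 s2] /L2_sq [t1 t2]] := lapop_L2 LG fg; have [w1 w2] := lapop_weak LG fg.
have H1 := weak_lap_smooth s1 t1 w1 V1 e1; have H2 := weak_lap_smooth s2 t2 w2 V2 e2.
rewrite laplacianE; split; [exact: H1|exact: H2].
Qed.

Notation lapc j f := (iter j (@laplacian R) f).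

Lemma qperc_lapc j f : qperc c1 c2 f -> qperc c1 c2 (lapc j f).
Proof. by move=> Vf; elim: j => //= j; exact: qperc_lap. Qed.

Lemma Hinf_iter phi f : L2O phi -> qperc c1 c2 f -> aeC phi f -> forall j,
  L2O (iter j (app G) phi) /\ aeC (iter j (app G) phi) (lapc j f).
Proof.
move=> Lp Vf pf; elim=> [//|j [IH1 IH2]].
have Vj := qperc_lapc j Vf.
have D : dom G (iter j (app G) phi) by eexists; exact: (lapop_sm LG IH1 Vj IH2).
have A := app_spec D; split; first by have [] := lapop_L2 LG A.
exact: lap_step A Vj IH2.
Qed.

(** The sequence of the images of phi under the powers of G satisfies the
    hypothesis of regularity. *)
Lemma HinfP phi : Hinfty G phi <-> L2O phi /\ exists2 f, qperc c1 c2 f & aeC phi f.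
Proof.
split=> [H|[Lp [f Vf pf]] k _ j _]; last first.
  have [L e] := Hinf_iter Lp Vf pf j.
  by eexists; exact: (lapop_sm LG L (qperc_lapc j Vf) e).
pose F j := iter j (app G) phi.
have D j : G (F j) (F j.+1) by apply: app_spec; apply: (H j.+1) => //=.
have [Lp _] := lapop_L2 LG (D 0%N); split=> //.
have L j : L2O (F j) by have [] := lapop_L2 LG (D j).
have i1 j : intO (re (F j)) by have /L2_sq [s _] := L j; exact: sq_int.
have i2 j : intO (im (F j)) by have /L2_sq [_ s] := L j; exact: sq_int.
have [a Va ea] := regularity c1_gt0 c2_gt0 i1 (fun j => (lapop_weak LG (D j)).1).
have [b Vb eb] := regularity c1_gt0 c2_gt0 i2 (fun j => (lapop_weak LG (D j)).2).
by exists (cx a b).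
Qed.

Lemma L2norm_iter phi f j : L2O phi -> qperc c1 c2 f -> aeC phi f ->
  L2norm (leb2 R) Om (iter j (app G) phi) ^+ 2 = N2 (lapc j f).
Proof.
move=> Lp Vf pf; have [L e] := Hinf_iter Lp Vf pf j.
by rewrite L2norm2; apply: N2_ae => //; exact: qperc_L2 (qperc_lapc j Vf).
Qed.

Lemma seminorm_le k phi f : L2O phi -> qperc c1 c2 f -> aeC phi f ->
  Hseminorm (leb2 R) Om G k phi ^+ 2 <= \sum_(j < k.+1) N2 (lapc j f).
Proof.
move=> Lp Vf pf; set S := \sum_(_ < _) _.
have S0 : 0 <= S by apply: sumr_ge0 => j _; exact: N2_ge0.
have h : Hseminorm (leb2 R) Om G k phi <= Num.sqrt S.
  apply: bigmax_le => [|j _]; first exact: sqrtr_ge0.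
  rewrite -(ger0_norm (_ : 0 <= L2norm _ _ _)) ?sqrtr_ge0 // -sqrtr_sqr ler_wsqrtr //.
  rewrite (L2norm_iter j Lp Vf pf) /S (bigD1 j) //= lerDl.
  by apply: sumr_ge0 => i _; exact: N2_ge0.
have h0 : 0 <= Hseminorm (leb2 R) Om G k phi.
  by apply: le_trans (le_bigmax _ _ ord0); exact: sqrtr_ge0.
by rewrite -[leRHS]sqr_sqrtr // ler_sqr ?nnegrE ?sqrtr_ge0.
Qed.

Lemma seminorm_ge k phi f j : L2O phi -> qperc c1 c2 f -> aeC phi f -> (j <= k)%N ->
  N2 (lapc j f) <= Hseminorm (leb2 R) Om G k phi ^+ 2.
Proof.
move=> Lp Vf pf jk; rewrite -(L2norm_iter j Lp Vf pf).
have h := le_bigmax 0 (fun j : 'I_k.+1 => L2norm (leb2 R) Om (iter j (app G) phi)) (inord j).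
rewrite /= inordK // in h.
have h0 : 0 <= L2norm (leb2 R) Om (iter j (app G) phi) := sqrtr_ge0 _.
change (is_true (L2norm (leb2 R) Om (iter j (app G) phi) <= Hseminorm (leb2 R) Om G k phi)) in h.
move: h h0; move: (L2norm _ _ _) (Hseminorm _ _ _ _ _) => u v h h0.
by rewrite ler_sqr // nnegrE // (le_trans h0).
Qed.

End Hinfty.

(** * Distributions *)

Section Dual.
Variable R : realType.
Variables (h1 h2 : R) (h1_gt0 : 0 < h1) (h2_gt0 : 0 < h2).
Notation T := (measurableTypeR R).
Notation Om := (@Omega R : set (T * T)).
Notation L2O := (L2 (leb2 R) Om).
Notation V := (qper h1^-1 h2^-1).
Notation Vc := (qperc h1^-1 h2^-1).
Notation normc := (@ComplexField.Normc.normc R).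
Implicit Types (f g phi : R * R -> R[i]) (a b : R * R -> R).
Notation lapc j f := (iter j (@laplacian R) f).

Lemma re_lapc j f : re (lapc j f) = laps j (re f) /\ im (lapc j f) = laps j (im f).
Proof.
elim: j => //= j [IH1 IH2]; have E1 := re_laplacian (lapc j f); have E2 := im_laplacian (lapc j f).
by split; [exact: (etrans E1 (f_equal (@lap R) IH1))|exact: (etrans E2 (f_equal (@lap R) IH2))].
Qed.

Definition sobc n f := sob h1 h2 n (re f) + sob h1 h2 n (im f).

Lemma om_bounds : exists2 m : R, 0 < m & exists2 M, 0 < M & forall x, Omega x -> m <= om h1 h2 x <= M.
Proof.
have [M M0 HM] := cont2_bounded (Cinf2_cont (om_qper h1_gt0 h2_gt0).1).
have [K K0 HK] := cont2_bounded (Cinf2_cont (Ex_qper (- (2 * ln h1)) (- (2 * ln h2))).1).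
exists (1 + K)^-1; first by rewrite invr_gt0; lra.
exists (1 + M); first lra.
move=> [x y] /OmegaP [/andP[x0 x1] /andP[y0 y1]].
have xx : 0 <= x <= 1 by rewrite !ltW.
have yy : 0 <= y <= 1 by rewrite !ltW.
have {}HM := HM x y xx yy.
have {}HK := HK x y xx yy.
have o0 := om_gt0 h1 h2 (x, y); have E := ExK (2 * ln h1) (2 * ln h2) (x, y).
rewrite -[Ex (2 * _) _ _]/(om h1 h2 (x, y)) in E.
move: HM HK o0 E; move: (om _ _ _) (Ex _ _ _) => o e HM HK o0 E.
have e1 : e <= 1 + K by have := ler_norm e; lra.
apply/andP; split; last by have := ler_norm o; lra.
rewrite invf_ple ?posrE //; last lra.
by have -> : o^-1 = e by apply: (mulIf (lt0r_neq0 o0)); rewrite E mulVf // lt0r_neq0.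
Qed.

Lemma W_N2 : exists2 C, 0 <= C & forall f, smooth f ->
  W h1 h2 (re f) + W h1 h2 (im f) <= C * N2 f /\ N2 f <= C * (W h1 h2 (re f) + W h1 h2 (im f)).
Proof.
have [m m0 [M M0 H]] := om_bounds; exists (M + m^-1); first by rewrite addr_ge0 ?invr_ge0 ?ltW.
move=> f /smooth_Cinf2 [/Cinf2_cont c1 /Cinf2_cont c2].
have iW := intO_D (W_int h1_gt0 h2_gt0 c1) (W_int h1_gt0 h2_gt0 c2).
have iN : intO (fun x => re f x ^+ 2 + im f x ^+ 2) by apply: intO_D; apply: cont_intO; apply: cont_mul2.
rewrite /W -(JD (W_int h1_gt0 h2_gt0 c1) (W_int h1_gt0 h2_gt0 c2)) /N2 -(JZ _ iW) -(JZ _ iN).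
have m0' : 0 <= m^-1 by rewrite invr_ge0 ltW.
split; apply: J_le => //; try exact: intO_Z; move=> x /H /andP[om1 om2]; rewrite -mulrDr;
  have s0 : 0 <= re f x ^+ 2 + im f x ^+ 2 by rewrite addr_ge0 ?sqr_ge0.
  by rewrite ler_wpM2r //; apply: le_trans om2 _; rewrite lerDl.
have s1 : 0 <= om h1 h2 x * (re f x ^+ 2 + im f x ^+ 2) by rewrite mulr_ge0 // ltW // om_gt0.
rewrite mulrDl -[leLHS]add0r; apply: lerD; first by rewrite mulr_ge0 // ltW.
by rewrite mulrA ler_peMl // -(mulVf (lt0r_neq0 m0)) ler_wpM2l.
Qed.

Let Ladj := Lh_adj_lapop h1_gt0 h2_gt0.
Let k1 : 0 < h1^-1. Proof. by rewrite invr_gt0. Qed.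
Let k2 : 0 < h2^-1. Proof. by rewrite invr_gt0. Qed.

Lemma Hinf_adjP phi : Hinf_adj h1 h2 phi <-> L2O phi /\ exists2 f, Vc f & aeC phi f.
Proof. exact: HinfP. Qed.

Lemma Hinf_P phi : Hinf h1 h2 phi <-> L2O phi /\ exists2 f, qperc h1 h2 f & aeC phi f.
Proof. exact: HinfP (Lh_lapop h1_gt0 h2_gt0) phi. Qed.

Lemma Vc_Hinf f : Vc f -> Hinf_adj h1 h2 f.
Proof. by move=> Vf; apply/Hinf_adjP; split; [exact: qperc_L2 Vf|exists f => //; exact: aeC_refl]. Qed.

(** Continuity in terms of the Sobolev norms of smooth representatives. *)
Definition tame (w : functional R) := exists n, exists2 B, 0 <= B &
  forall f, Vc f -> normc (w f) ^+ 2 <= B * sobc n f.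

Lemma N2_lapc j : exists2 C, 0 <= C & forall f, Vc f -> N2 (lapc j f) <= C * sobc (2 * j) f.
Proof.
have [C C0 H] := W_N2; exists (C * 4 ^+ j); first by rewrite mulr_ge0 // exprn_ge0.
move=> f Vf; have [_ h] := H _ (qperc_smooth (qperc_lapc j Vf)); apply: le_trans h _.
rewrite -mulrA ler_wpM2l //; have [-> ->] := re_lapc j f.
by rewrite /sobc mulrDr; apply: lerD; apply: W_laps => //; [exact: Vf.1.1|exact: Vf.2.1].
Qed.

Lemma sobc_le n m f : (n <= m)%N -> sobc n f <= sobc m f.
Proof. by move=> nm; apply: lerD; exact: sob_le. Qed.

Lemma seminorm_sob k : exists2 C, 0 <= C & forall phi f, L2O phi -> Vc f -> aeC phi f ->
  Hseminorm (leb2 R) Om (Lh_adj h1 h2) k phi ^+ 2 <= C * sobc (2 * k) f.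
Proof.
have [C C0 H] : exists2 C, 0 <= C & forall f, Vc f -> \sum_(j < k.+1) N2 (lapc j f) <= C * sobc (2 * k) f.
  elim: k => [|k [C C0 H]].
    by have [C C0 H] := N2_lapc 0; exists C => // f Vf; rewrite big_ord1; exact: H.
  have [D D0 HD] := N2_lapc k.+1; exists (C + D); first exact: addr_ge0.
  move=> f Vf; rewrite big_ord_recr /= mulrDl; apply: lerD; last exact: HD.
  by apply: le_trans (H f Vf) _; rewrite ler_wpM2l // sobc_le // leq_mul2l leqnSn.
exists C => // phi f Lp Vf pf; apply: le_trans (H f Vf).
exact: seminorm_le k1 k2 Ladj _ _ _ Lp Vf pf.
Qed.

Lemma sob_seminorm n : exists2 C, 0 <= C & forall f, Vc f ->
  sobc n f <= C * Hseminorm (leb2 R) Om (Lh_adj h1 h2) n f ^+ 2.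
Proof.
have [C C0 HC] := sob_laps h1_gt0 h2_gt0 n; have [D D0 HD] := W_N2.
exists (C * (n.+1%:R * D)); first by rewrite !mulr_ge0.
move=> f Vf; have h := lerD (HC _ Vf.1) (HC _ Vf.2); apply: le_trans h _.
rewrite -mulrDr -!mulrA ler_wpM2l // -big_split /=.
apply: le_trans (_ : \sum_(j < n.+1) D * Hseminorm (leb2 R) Om (Lh_adj h1 h2) n f ^+ 2 <= _).
  apply: ler_sum => j _; have [h _] := HD _ (qperc_smooth (qperc_lapc j Vf)).
  have [E1 E2] := re_lapc j f; rewrite E1 E2 in h; apply: le_trans h _; rewrite ler_wpM2l //.
  apply: (seminorm_ge k1 k2 Ladj (qperc_L2 Vf) Vf (aeC_refl f)).
  by rewrite -ltnS ltn_ord.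
by rewrite sumr_const card_ord mulr_natl.
Qed.

Lemma cmul_reim (c : R[i]) f g : re (fun x => c * f x + g x) = (fun x => complex.Re c * re f x + (- complex.Im c * im f x + re g x)) /\
  im (fun x => c * f x + g x) = (fun x => complex.Re c * im f x + (complex.Im c * re f x + im g x)).
Proof.
by split; apply/funext => x; rewrite /re /im; case: c (f x) (g x) => [p q] [r s] [t u] /=; ring.
Qed.

Lemma qperc_lin c1 c2 (c : R[i]) f g : qperc c1 c2 f -> qperc c1 c2 g -> qperc c1 c2 (fun x => c * f x + g x).
Proof.
move=> [f1 f2] [g1 g2]; rewrite /qperc; have [-> ->] := cmul_reim c f g.
by split; apply: qper_add; try apply: qper_scale => //; apply: qper_add => //; apply: qper_scale.
Qed.

Lemma L2_lin (c : R[i]) f g : L2O f -> L2O g -> L2O (fun x => c * f x + g x).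
Proof.
move=> /L2_sq [f1 f2] /L2_sq [g1 g2]; apply/L2_sq; have [-> ->] := cmul_reim c f g.
by split; apply: sq_add; try apply: sq_scale => //; apply: sq_add => //; apply: sq_scale.
Qed.

Lemma aeC_lin (c : R[i]) f g f' g' : aeC f f' -> aeC g g' -> aeC (fun x => c * f x + g x) (fun x => c * f' x + g' x).
Proof.
move=> [f1 f2] [g1 g2]; rewrite /aeC; have [-> ->] := cmul_reim c f g; have [-> ->] := cmul_reim c f' g'.
by split; apply: aeO_add; try apply: aeO_scale => //; apply: aeO_add => //; apply: aeO_scale.
Qed.

Lemma Hminf_tame w : Hminf h1 h2 w -> tame w.
Proof.
move=> [_ [k [B HB]]]; have [C C0 HC] := seminorm_sob k.
exists (2 * k)%N, (B ^+ 2 * C); first by rewrite mulr_ge0 ?sqr_ge0.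
move=> f Vf; have := HB f (Vc_Hinf Vf).
rewrite -[ `|w f| ]/((normc (w f))%:C)%C lecR => h.
have n0 : 0 <= normc (w f) by case: (w f) => x y; exact: sqrtr_ge0.
have h' : normc (w f) ^+ 2 <= (B * Hseminorm (leb2 R) Om (Lh_adj h1 h2) k f) ^+ 2.
  by rewrite ler_sqr // nnegrE // (le_trans n0).
apply: le_trans h' _; have := HC f f (qperc_L2 Vf) Vf (aeC_refl f).
move: (Hseminorm _ _ _ _ _) (sobc _ _) => s t st.
by rewrite exprMn -[leRHS]mulrA ler_wpM2l ?sqr_ge0.
Qed.

(** All seminorms of phi - f vanish. *)
Lemma Hminf_ae w phi f : Hminf h1 h2 w -> L2O phi -> Vc f -> aeC phi f -> w phi = w f.
Proof.
move=> [lw [k [B HB]]] Lp Vf pf; have [C C0 HC] := seminorm_sob k.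
have Hp : Hinf_adj h1 h2 phi by apply/Hinf_adjP; split=> //; exists f.
pose d x := -1 * f x + phi x.
have Ld : L2O d := L2_lin (-1) (qperc_L2 Vf) Lp.
have V0 : Vc (fun=> 0) by split; exact: qper0.
have d0 : aeC d (fun=> 0).
  have := aeC_lin (-1) (aeC_refl f) pf; rewrite (_ : (fun x => -1 * f x + f x) = fun=> 0) //.
  by apply/funext => x; rewrite mulN1r addNr.
have N0 n : sobc n (fun=> 0) = 0.
  have z : sob h1 h2 n (fun=> 0) = 0.
    have := sob_scale h1_gt0 h2_gt0 n 0 (@Cinf2_cst R 0).
    by rewrite (_ : (fun x => 0 * 0) = fun=> 0) => [->|]; rewrite ?expr0n ?mul0r.
  by rewrite /sobc -[re _]/(fun=> 0) -[im _]/(fun=> 0) z addr0.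
have S0 := HC d _ Ld V0 d0; rewrite N0 mulr0 in S0.
have {}S0 : Hseminorm (leb2 R) Om (Lh_adj h1 h2) k d = 0.
  by apply/eqP; rewrite -sqrf_eq0; apply/eqP/le_anti; rewrite S0 sqr_ge0.
have Hd : Hinf_adj h1 h2 d by apply/Hinf_adjP; split=> //; exists (fun=> 0).
have := HB d Hd; rewrite S0 mulr0 normr_le0 => /eqP wd.
have := lw (-1) f phi (Vc_Hinf Vf) Hp; rewrite -[X in w X]/d wd mulN1r => /eqP.
by rewrite eq_sym addrC subr_eq0 => /eqP.
Qed.

(** A distribution only needs to be studied on smooth representatives. *)
Lemma HminfI w : (forall phi f, L2O phi -> Vc f -> aeC phi f -> w phi = w f) ->
  (forall c f g, Vc f -> Vc g -> w (fun x => c * f x + g x) = c * w f + w g) ->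
  tame w -> Hminf h1 h2 w.
Proof.
move=> wae wlin [n [B B0 HB]]; split.
  move=> c p q /Hinf_adjP [Lp [f Vf pf]] /Hinf_adjP [Lq [g Vg qg]].
  rewrite (wae _ _ Lp Vf pf) (wae _ _ Lq Vg qg) -wlin //.
  by apply: wae; [exact: L2_lin|exact: qperc_lin|exact: aeC_lin].
have [C C0 HC] := sob_seminorm n.
exists n, (Num.sqrt (B * C)) => p /Hinf_adjP [Lp [f Vf pf]].
rewrite (wae _ _ Lp Vf pf) -[ `|w f| ]/((normc (w f))%:C)%C lecR.
have n0 : 0 <= normc (w f) by case: (w f) => x y; exact: sqrtr_ge0.
have E : Hseminorm (leb2 R) Om (Lh_adj h1 h2) n p = Hseminorm (leb2 R) Om (Lh_adj h1 h2) n f.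
  apply: eq_bigr => j _; apply/eqP; rewrite -(@eqrXn2 _ 2) ?sqrtr_ge0 //; apply/eqP.
  by rewrite (L2norm_iter k1 k2 Ladj j Lp Vf pf) (L2norm_iter k1 k2 Ladj j (qperc_L2 Vf) Vf (aeC_refl f)).
have S0 : 0 <= Hseminorm (leb2 R) Om (Lh_adj h1 h2) n f.
  by apply: le_trans (le_bigmax _ _ ord0); exact: sqrtr_ge0.
rewrite E -(@ler_sqr _ (normc _)) ?nnegrE ?mulr_ge0 ?sqrtr_ge0 // exprMn sqr_sqrtr ?mulr_ge0 //.
apply: le_trans (HB f Vf) _; rewrite -[leRHS]mulrA ler_wpM2l //; exact: HC.
Qed.

Lemma Hminf_lin w c f g : Hminf h1 h2 w -> Vc f -> Vc g -> w (fun x => c * f x + g x) = c * w f + w g.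
Proof. by move=> [lw _] Vf Vg; apply: lw; exact: Vc_Hinf. Qed.

End Dual.

(** * Weak derivatives *)

Section WeakDerivative.
Variable R : realType.
Notation T := (measurableTypeR R).
Notation Om := (@Omega R : set (T * T)).
Notation L2O := (L2 (leb2 R) Om).
Implicit Types (f g phi psi : R * R -> R[i]) (a b : R * R -> R).

Lemma rC1_Cn t : rC 1 t -> Cn 1 (cx t (fun=> 0 : R)).
Proof.
move=> [ct dt]; have c0 : continuous (fun _ : R * R => 0 : R) by move=> x; exact: cvg_cst.
case=> [|j [|//]] _ /=; split=> //.
- move=> _ j x; have [t' d _] := dt j; split; first by have [] := d x.
  by have [] := @pder_cst R j 0 x.
- by have [t' d ct'] := dt j; rewrite pDE (pderE d).
- by rewrite pDE pD_cst.
Qed.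

Lemma parts_compact j (u t t' : R * R -> R) : Cinf2 u -> rC 1 t -> pder j t t' -> continuous t' ->
  (forall x, ~ Omega x -> t x = 0) ->
  J (fun x => u x * t' x) = - J (fun x => pD j u x * t x).
Proof.
move=> su [ct _] dt ct' t0.
have cu := Cinf2_cont su; have cu' := Cinf2_cont (Cinf2_pD j su).
have c1 := cont_mul2 cu' ct; have c2 := cont_mul2 cu ct'.
have E0 : J (fun x => pD j u x * t x + u x * t' x) = 0.
  apply: (J_pder_edge (pder_mul (Cinf2_pder j su) dt)); first exact: cont_add2.
  have z1 (s : R) : t (s, 1) = 0 by apply: t0 => /OmegaP [_]; rewrite ltxx andbF.
  have z2 (s : R) : t (s, 0) = 0 by apply: t0 => /OmegaP [_]; rewrite ltxx.
  have z3 (s : R) : t (1, s) = 0 by apply: t0 => /OmegaP []; rewrite ltxx andbF.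
  have z4 (s : R) : t (0, s) = 0 by apply: t0 => /OmegaP []; rewrite ltxx.
  by move=> s _; case: j {dt cu' c1}; rewrite ?z1 ?z2 ?z3 ?z4 !mulr0.
have E1 := JD (cont_intO c1) (cont_intO c2); rewrite E0 in E1.
by apply/eqP; rewrite -addr_eq0 addrC -E1.
Qed.

Lemma re_pderiv j f : re (pderiv j f) = pD j (re f).
Proof. by rewrite pderivE. Qed.

Lemma im_pderiv j f : im (pderiv j f) = pD j (im f).
Proof. by rewrite pderivE. Qed.

Lemma cont_L2 f : continuous (re f) -> continuous (im f) -> L2O f.
Proof. by move=> c1 c2; apply/L2_sq; split; exact: sq_cont. Qed.

Lemma smooth_pderiv j f : smooth f -> smooth (pderiv j f).
Proof.
move=> /smooth_Cinf2 [s1 s2]; apply/smooth_Cinf2; rewrite pderivE.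
by split; exact: Cinf2_pD.
Qed.

Lemma weak_pderiv_smooth j phi f : L2O phi -> smooth f -> aeC phi f -> weak_pderiv j phi (pderiv j f).
Proof.
move=> Lp sf pf; have Lf' := smooth_L2 (smooth_pderiv j sf); split=> // t Ct supp.
have t0 x : ~ Omega x -> t x = 0.
  move=> nO; apply: contrapT => tx; apply: nO; apply: supp; apply: subset_closure.
  by apply/eqP.
have [r1 r2] := Cn_rC Ct; have [[c1 D1] [c2 D2]] := (r1, r2).
have [t1 d1 ct1] := D1 j; have [t2 d2 ct2] := D2 j.
have e1 : re (pderiv j t) = t1 by rewrite re_pderiv (pderE d1).
have e2 : im (pderiv j t) = t2 by rewrite im_pderiv (pderE d2).
have Lt : L2O t by exact: cont_L2.
have Lt' : L2O (pderiv j t) by apply: cont_L2; rewrite ?e1 ?e2.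
rewrite (int_ae Lp (smooth_L2 sf) Lt' pf) (int_cmulE erefl erefl e1 e2 (smooth_L2 sf) Lt').
rewrite (int_cmulE (re_pderiv j f) (im_pderiv j f) erefl erefl Lf' Lt).
have /smooth_Cinf2 [s1 s2] := sf.
have z1 x : ~ Omega x -> re t x = 0 by move=> /t0; rewrite /re => ->.
have z2 x : ~ Omega x -> im t x = 0 by move=> /t0; rewrite /im => ->.
have P11 := parts_compact s1 r1 d1 ct1 z1; have P12 := parts_compact s1 r2 d2 ct2 z2.
have P21 := parts_compact s2 r1 d1 ct1 z1; have P22 := parts_compact s2 r2 d2 ct2 z2.
move: P11 P12 P21 P22; rewrite -/(re f) -/(im f) -/(re t) -/(im t).
move: (J _) (J _) (J _) (J _) (J _) (J _) (J _) (J _) => a1 a2 a3 a4 a5 a6 a7 a8.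
move=> E1 E2 E3 E4; apply: eq_cplx; rewrite /=.
  by rewrite ?E1 ?E2 ?E3 ?E4; ring.
by rewrite ?E1 ?E2 ?E3 ?E4; ring.
Qed.

Lemma closed_fst (c d : R) : closed [set x : R * R | c <= x.1 <= d].
Proof.
have -> : [set x : R * R | c <= x.1 <= d] = (@fst R R) @^-1` `[c, d]%classic.
  by apply/seteqP; split=> x /=; rewrite in_itv.
apply: closed_comp; last exact: itv_closed.
by move=> x _; exact: cvg_fst.
Qed.

Lemma closed_snd (c d : R) : closed [set x : R * R | c <= x.2 <= d].
Proof.
have -> : [set x : R * R | c <= x.2 <= d] = (@snd R R) @^-1` `[c, d]%classic.
  by apply/seteqP; split=> x /=; rewrite in_itv.
apply: closed_comp; last exact: itv_closed.
by move=> x _; exact: cvg_snd.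
Qed.

Lemma cutoff0 (a b t : R) : cutoff a b 0 t = 0.
Proof. by rewrite /cutoff mul0r sub0r ramp_neg ?mul0r // lerN10. Qed.

(** Products of cut-offs in the two variables are admissible test functions,
    and no nonzero function is orthogonal to all of them. *)
Lemma weak_pderiv_unique j phi f g : weak_pderiv j phi f -> weak_pderiv j phi g -> aeC f g.
Proof.
move=> [Lp Lf Hf] [_ Lg Hg].
have /L2_sq [f1 f2] := Lf; have /L2_sq [g1 g2] := Lg.
have K (a b c d : R) n : 0 <= a -> b <= 1 -> 0 <= c -> d <= 1 ->
   let t := fun x : R * R => cutoff a b n x.1 * cutoff c d n x.2 in
   J (fun x => re f x * t x) = J (fun x => re g x * t x) /\
   J (fun x => im f x * t x) = J (fun x => im g x * t x).
  move=> a0 b1 c0 d1 t.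
  have [n0|npos] := eqVneq n 0%N.
    have t0 x : t x = 0 by rewrite /t n0 cutoff0 mul0r.
    by rewrite !J0 // => x; rewrite t0 mulr0.
  have np : 0 < (n%:R : R)^-1 by rewrite invr_gt0 ltr0n lt0n.
  have rt : rC 1 t.
    apply: rC_le; apply: rC_mul; [apply: rC_fst|apply: rC_snd]; exact: dC_cutoff.
  have ct := rC_cont rt.
  have supp : closure [set x | cx t (fun=> 0) x != 0] `<=` @Omega R.
    pose K := [set x : R * R | a + n%:R^-1 <= x.1 <= b - n%:R^-1] `&`
              [set x : R * R | c + n%:R^-1 <= x.2 <= d - n%:R^-1].
    have cK : closed K by apply: closedI; [exact: closed_fst|exact: closed_snd].
    have KO : K `<=` @Omega R.
      move=> [x y] [/= /andP[h1 h2] /andP[h3 h4]]; apply/OmegaP; split; apply/andP; split; lra.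
    apply: subset_trans KO; rewrite [X in _ `<=` X](closure_id K).1 //; apply: closure_subset.
    move=> [x y] /= tn0.
    have [n1 n2] : cutoff a b n x != 0 /\ cutoff c d n y != 0.
      by apply/andP; rewrite -negb_or -mulf_eq0; apply: contra tn0 => /eqP E; rewrite /cx /t /= E.
    split=> /=; rewrite -[_ && _]negbK negb_and -!ltNge; apply/negP => /orP h.
      by move/eqP: n1; apply; apply: cutoff_supp; case: h => h; rewrite (ltW h) ?orbT.
    by move/eqP: n2; apply; apply: cutoff_supp; case: h => h; rewrite (ltW h) ?orbT.
  have Lt : L2O (cx t (fun=> 0)) by apply: cont_L2 => // x; exact: cvg_cst.
  have := etrans (esym (Hf _ (rC1_Cn rt) supp)) (Hg _ (rC1_Cn rt) supp).
  move=> /oppr_inj; rewrite (int_cmul Lf Lt) (int_cmul Lg Lt) => /cx_inj.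
  have z (u : R * R -> R) : J (fun x => u x * im (cx t (fun=> 0)) x) = 0 by apply: J0 => x; exact: mulr0.
  by rewrite !z !subr0 !add0r.
have M u v : sq u -> sq v -> (forall (a b c d : R) n, 0 <= a -> b <= 1 -> 0 <= c -> d <= 1 ->
   let t := fun x : R * R => cutoff a b n x.1 * cutoff c d n x.2 in
   J (fun x => u x * t x) = J (fun x => v x * t x)) -> aeO u v.
  move=> su sv H.
  have := @fundamental_ae R _ (intO_B (sq_int su) (sq_int sv)) _.
  have h (a b c d : R) n : 0 <= a -> b <= 1 -> 0 <= c -> d <= 1 ->
    J (fun x => (u x - v x) * (cutoff a b n x.1 * cutoff c d n x.2)) = 0.
    move=> a0 b1 c0 d1; have E := H a b c d n a0 b1 c0 d1.
    set t := fun x : R * R => cutoff a b n x.1 * cutoff c d n x.2 in E *.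
    have st : sq t.
      apply: sq_cont; apply: (@rC_cont _ 2).
      by apply: rC_mul; [apply: rC_fst|apply: rC_snd]; exact: dC_cutoff.
    have -> : J (fun x => (u x - v x) * t x) = J (fun x => u x * t x) - J (fun x => v x * t x).
      by rewrite -(JB (sq_intM su st) (sq_intM sv st)); apply: eq_J => x _; exact: mulrBl.
    by rewrite E subrr.
  by move/(_ h); apply: filterS => x /= + Ox => /(_ Ox) [] /eqP; rewrite subr_eq0 => /eqP ->.
by split; apply: M => // a b c d n a0 b1 c0 d1; have [] := K a b c d n a0 b1 c0 d1.
Qed.

Lemma wpderiv_smooth j phi f : L2O phi -> smooth f -> aeC phi f ->
  L2O (wpderiv j phi) /\ aeC (wpderiv j phi) (pderiv j f).
Proof.
move=> Lp sf pf; have H := weak_pderiv_smooth j Lp sf pf.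
have W : weak_pderiv j phi (wpderiv j phi) by rewrite /wpderiv; apply: xgetPex; exists (pderiv j f).
by split; [case: W|exact: weak_pderiv_unique W H].
Qed.

End WeakDerivative.

(** * Transposes of operators on smooth functions *)

Section Operators.
Variable R : realType.
Variables (h1 h2 : R) (h1_gt0 : 0 < h1) (h2_gt0 : 0 < h2).
Notation Om := (@Omega R : set (measurableTypeR R * measurableTypeR R)).
Notation L2O := (L2 (leb2 R) Om).
Notation V := (qper h1^-1 h2^-1).
Notation Vc := (qperc h1^-1 h2^-1).
Notation normc := (@ComplexField.Normc.normc R).
Implicit Types (f g phi : R * R -> R[i]) (u v : R * R -> R) (b : R -> R) (w : functional R).

(** An operator with real coefficients acts on the real and the imaginary
    part. *)
Definition compwise (s : (R * R -> R) -> R * R -> R) f := cx (s (re f)) (s (im f)).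

(** The operators whose transposes act on distributions. *)
Record tame_op (s : (R * R -> R) -> R * R -> R) : Prop := TameOp {
  tame_V : forall u, V u -> V (s u);
  tame_lin : forall c u v, V u -> V v -> s (fun x => c * u x + v x) = fun x => c * s u x + s v x;
  tame_sob : forall n, exists m, exists2 C, 0 <= C & forall u, V u -> sob h1 h2 n (s u) <= C * sob h1 h2 m u }.

Lemma compwise_V s f : tame_op s -> Vc f -> Vc (compwise s f).
Proof. by move=> ts [V1 V2]; split; exact: (tame_V ts). Qed.

Lemma compwise_lin s c f g : tame_op s -> Vc f -> Vc g ->
  compwise s (fun x => c * f x + g x) = fun x => c * compwise s f x + compwise s g x.
Proof.
move=> ts [f1 f2] [g1 g2]; rewrite /compwise; have [-> ->] := cmul_reim c f g.
have V1 : V (fun x => - complex.Im c * im f x + re g x) by apply: qper_add => //; exact: qper_scale.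
have V2 : V (fun x => complex.Im c * re f x + im g x) by apply: qper_add => //; exact: qper_scale.
rewrite (tame_lin ts _ f1 V1) (tame_lin ts _ f2 g1) (tame_lin ts _ f2 V2) (tame_lin ts _ f1 g2).
apply/funext => x; rewrite /cx; case: c {V1 V2} => p q /=.
move: (s (re f) x) (s (im f) x) (s (re g) x) (s (im g) x) => k l m n.
by apply: eq_cplx => /=; ring.
Qed.

Lemma Hminf_comp s w w' : tame_op s -> Hminf h1 h2 w ->
  (forall phi f, L2O phi -> Vc f -> aeC phi f -> w' phi = w (compwise s f)) -> Hminf h1 h2 w'.
Proof.
move=> ts Hw E; have E' f : Vc f -> w' f = w (compwise s f).
  by move=> Vf; apply: E => //; [exact: qperc_L2 Vf|exact: aeC_refl].
apply: HminfI => //.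
- by move=> phi f Lp Vf pf; rewrite (E phi f) // E'.
- move=> c f g Vf Vg; rewrite !E' //; last exact: qperc_lin.
  by rewrite (compwise_lin c ts Vf Vg) (Hminf_lin h1_gt0 h2_gt0 c Hw (compwise_V ts Vf) (compwise_V ts Vg)).
have [n [B B0 HB]] := Hminf_tame h1_gt0 h2_gt0 Hw; have [m [C C0 HC]] := tame_sob ts n.
exists m, (B * C); first exact: mulr_ge0.
move=> f Vf; rewrite E' //; apply: le_trans (HB _ (compwise_V ts Vf)) _.
rewrite -[leRHS]mulrA ler_wpM2l // /sobc mulrDr; have [V1 V2] := Vf.
by apply: lerD; exact: HC.
Qed.

Lemma Hminf_scale w c f : Hminf h1 h2 w -> Vc f -> w (fun x => c * f x) = c * w f.
Proof.
move=> Hw Vf; have V0 : Vc (fun=> 0) by split; exact: qper0.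
have w0 : w (fun=> 0) = 0.
  have := Hminf_lin h1_gt0 h2_gt0 (-1) Hw V0 V0; rewrite (_ : (fun x => -1 * 0 + 0) = fun=> 0); last first.
    by apply/funext => x; rewrite mulr0 addr0.
  by rewrite mulN1r addNr.
have := Hminf_lin h1_gt0 h2_gt0 c Hw Vf V0; rewrite w0 addr0 => <-; congr w.
by apply/funext => x; rewrite addr0.
Qed.

(** The transpose of the vector field d/dx_1 + b(x_1) d/dx_2. *)
Definition Dfield (b : R -> R) u : R * R -> R :=
  fun x => -1 * (pD false u x + b x.1 * pD true u x).

Lemma Dfield_tame b : Cinf1 b -> (forall x, b (x + 1) = b x) -> tame_op (Dfield b).
Proof.
move=> sb pb; have Vb u : V u -> V (fun x => b x.1 * u x).
  by move=> Vu; have := qper_mul (qper_fst sb pb) Vu; rewrite !mul1r.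
split=> [u Vu|c u v Vu Vv|n].
- apply: qper_scale; apply: qper_add; first exact: qper_pD.
  by apply: Vb; exact: qper_pD.
- have [[su _] [sv _]] := (Vu, Vv).
  rewrite /Dfield !(pD_add _ (Cinf2_scale c su) sv) !(pD_scale _ c su).
  apply/funext => x; gen_pD; ring.
have [C C0 HC] := sob_mulfst h1_gt0 h2_gt0 n sb.
exists n.+1, (2 * (1 + C)); first by rewrite mulr_ge0 // addr_ge0.
move=> u Vu; have [su _] := Vu.
have s1 := Cinf2_pD false su; have s2 := Cinf2_pD true su; have s3 := Cinf2_mul (Cinf2_fst sb) s2.
rewrite /Dfield (sob_scale h1_gt0 h2_gt0 n (-1) (Cinf2_add s1 s3)) sqrrN expr1n mul1r.
apply: le_trans (sob_add h1_gt0 h2_gt0 n s1 s3) _; rewrite -[leRHS]mulrA ler_wpM2l // mulrDl mul1r.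
apply: lerD; first exact: sob_pD.
by apply: le_trans (HC _ s2) _; rewrite ler_wpM2l // sob_pD.
Qed.

Lemma L2_mul1 b phi : continuous b -> L2O phi -> L2O (fun x => (b x.1)%:C%C * phi x).
Proof.
move=> cb /L2_sq [s1 s2]; have cb1 := cont_fst cb; apply/L2_sq; split.
  rewrite (_ : re _ = fun x => b x.1 * re phi x); first exact: sq_mul.
  by apply/funext => x; rewrite /re; case: (phi x) => p q /=; ring.
rewrite (_ : im _ = fun x => b x.1 * im phi x); first exact: sq_mul.
by apply/funext => x; rewrite /im; case: (phi x) => p q /=; ring.
Qed.

Lemma re_mul1 (b : R -> R) f : re (fun x => (b x.1)%:C%C * f x) = (fun x => b x.1 * re f x) /\
  im (fun x => (b x.1)%:C%C * f x) = (fun x => b x.1 * im f x).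
Proof. by split; apply/funext => x; rewrite /re /im; case: (f x) => p q /=; ring. Qed.

Lemma vfieldE b w phi f : Cinf1 b -> (forall x, b (x + 1) = b x) -> Hminf h1 h2 w ->
  L2O phi -> Vc f -> aeC phi f -> vfield b w phi = w (compwise (Dfield b) f).
Proof.
move=> sb pb Hw Lp Vf pf; have cb : continuous b := dC_cont (Cinf1_Cn sb 0).
have [L1 e1] := wpderiv_smooth false Lp (qperc_smooth Vf) pf.
pose bf x := (b x.1)%:C%C * f x; pose bp x := (b x.1)%:C%C * phi x.
have Vbf : Vc bf.
  have [E1 E2] := re_mul1 b f; have [V1 V2] := Vf; rewrite /qperc E1 E2.
  by split; have := qper_mul (qper_fst sb pb) V1; have := qper_mul (qper_fst sb pb) V2; rewrite !mul1r.
have Lbp : L2O bp := L2_mul1 cb Lp.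
have pbf : aeC bp bf.
  have [E1 E2] := re_mul1 b f; have [E3 E4] := re_mul1 b phi; have [e3 e4] := pf.
  by rewrite /aeC E1 E2 E3 E4; split; apply: aeO_mul => //; exact: aeO_refl.
have [L2 e2] := wpderiv_smooth true Lbp (qperc_smooth Vbf) pbf.
have V1 : Vc (pderiv false f) by rewrite pderivE; split; apply: qper_pD; [exact: Vf.1|exact: Vf.2].
have V2 : Vc (pderiv true bf) by rewrite pderivE; split; apply: qper_pD; [exact: Vbf.1|exact: Vbf.2].
have W1 := Hminf_ae h1_gt0 h2_gt0 Hw L1 V1 e1; have W2 := Hminf_ae h1_gt0 h2_gt0 Hw L2 V2 e2.
apply: (etrans (f_equal2 (fun x y : R[i] => - x - y) W1 W2)).
have -> : compwise (Dfield b) f = fun x => -1 * (1 * pderiv false f x + pderiv true bf x).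
  have [E1 E2] := re_mul1 b f; have [[s1 _] [s2 _]] := Vf.
  have D u : Cinf2 u -> pD true (fun x => b x.1 * u x) = fun x => b x.1 * pD true u x.
    move=> su; rewrite (pD_mul true (Cinf2_fst sb) su) (pderE (pder2_fst b)).
    by apply/funext => x; rewrite mul0r add0r.
  rewrite !pderivE -/(re bf) -/(im bf) E1 E2 (D _ s1) (D _ s2) -/(re f) -/(im f) /compwise /Dfield.
  apply/funext => x; rewrite /cx; move: (pD _ _ x) (pD _ _ x) (pD _ _ x) (pD _ _ x) => k l m n.
  by apply: eq_cplx => /=; ring.
have V3 := qperc_lin 1 V1 V2.
have E3 := Hminf_scale (-1) Hw V3; have E4 := Hminf_lin h1_gt0 h2_gt0 1 Hw V1 V2.
rewrite mulN1r in E3; rewrite mul1r in E4.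
apply: esym; apply: (etrans E3); apply: (etrans (f_equal -%R E4)); exact: opprD.
Qed.

Lemma vfield_op b : Cinf1 b -> (forall x, b (x + 1) = b x) -> operator_on_Hminf h1 h2 (vfield b).
Proof.
move=> sb pb w Hw; apply: (Hminf_comp (Dfield_tame sb pb) Hw) => phi f Lp Vf pf.
exact: vfieldE.
Qed.

Lemma shear_tame A : Cinf1 A -> (forall x, A (x + 1) = A x) -> tame_op (shear A).
Proof.
move=> sA pA; split=> [u Vu|//|n]; first exact: qper_shear.
have [C C0 HC] := sob_shear h1_gt0 h2_gt0 n sA.
by exists n, C.
Qed.

Lemma periodic_Cinf1 (a : R -> R) : smooth_periodic a -> Cinf1 a.
Proof.
move=> [da _]; apply: (@Cinf1_coind R (fun b => exists n, b = derive1n n a)); last by exists 0%N.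
move=> _ [n ->]; exists (derive1n n.+1 a); last by exists n.+1.
by move=> x; rewrite /derive1n iterS -/(derive1n n a) derive1E; exact/derivableP/da.
Qed.

End Operators.

(** * Integrals that depend on a parameter *)

Section Param.
Variable R : realType.
Implicit Types (f u : R * R -> R).

(** The remainder of the first order expansion is bounded by h^2 times a bound
    for the second derivative, uniformly in the variable of integration. *)
Lemma param_derive f (kap : R -> R) : Cinf2 f -> continuous kap -> forall x : R,
  is_derive x (1:R) (fun x => I01 (fun t => f (x, t) * kap t)) (I01 (fun t => pD false f (x, t) * kap t)).
Proof.
move=> sf ck x; have sf1 := Cinf2_pD false sf; have sf2 := Cinf2_pD false sf1.
have d1 := (pder1P _ _).1 (Cinf2_pder false sf); have d2 := (pder1P _ _).1 (Cinf2_pder false sf1).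
have [K K0 HK] := cont1_bounded ck.
(* The interval [x - 1, x + 1] is rescaled to [0, 1] to bound the second
   derivative on it. *)
have cu : continuous (fun p : R * R => x - 1 + 2 * p.1).
  have s : Cinf1 (fun t : R => x - 1 + 2 * t).
    apply: Cinf1_add; first exact: Cinf1_cst.
    apply: (@Cinf1_coind R (fun b => (exists c d : R, b = fun t => c * t + d))); last by exists 2, 0; apply/funext => t; rewrite addr0.
    move=> _ [c [d ->]]; exists (fun=> c); last by exists 0, c; apply/funext => t; rewrite mul0r add0r.
    by move=> y; apply: is_derive_eq (dD (dZ c (did y)) (dcst d y)) _; rewrite mulr1 addr0.
  by have := cont_fst (dC_cont (Cinf1_Cn s 0)).
have cv : continuous (fun p : R * R => p.2) by move=> p; exact: cvg_snd.
have [M M0 HM] := cont2_bounded (cont_pair (Cinf2_cont sf2) cu cv).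
have B (h t : R) : `|h| <= 1 -> 0 <= t <= 1 ->
    `|f (x + h, t) - f (x, t) - h * pD false f (x, t)| <= M * `|h| * `|h|.
  move=> h1 t01; have [c c1 ->] := MVT_incr x h (fun s => d1 s t).
  rewrite -mulrBr normrM mulrC ler_wpM2r //.
  have [c' c1' E] := MVT_incr x (c - x) (fun s => d2 s t); rewrite [x + (c - x)]addrC subrK in E.
  rewrite E normrM mulrC; apply: ler_pM => //.
  have h3 : `|c' - x| <= 1 by apply: le_trans c1' _; apply: le_trans h1.
  have /= := HM ((c' - x + 1) / 2) t _ t01.
  rewrite (_ : x - 1 + 2 * ((c' - x + 1) / 2) = c'); last by field.
  apply; move: h3; rewrite ler_norml => /andP[h3 h4]; apply/andP; split; lra.
apply/is_derive1_epsP => e e0; pose r := Num.min 1 (e / (M * K + 1)).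
have MK : 0 < M * K + 1 by rewrite ltr_wpDl // mulr_ge0.
exists r; first by rewrite lt_min ltr01 divr_gt0.
move=> h; rewrite lt_min => /andP[h1 h2].
have i (g : R * R -> R) y : Cinf2 g -> int01 (fun t => g (y, t) * kap t).
  by move=> sg; apply: cont_int01; apply: cont_mul1 => //; exact: cont_slice2 (Cinf2_cont sg).
have i1 := i f (x + h) sf; have i2 := i f x sf; have i3 := i _ x sf1.
have iB (p q : R -> R) : int01 p -> int01 q -> int01 (fun t => p t - q t) by move=> hp hq; have := integrableB (@m01 R) hp hq.
have E1 := I01B i1 i2; have E2 := I01Z h i3; have E3 := I01B (iB _ _ i1 i2) (int01Z h i3).
cbv beta in E1, E2, E3; rewrite -E1 -E2 -E3.
apply: (@le_trans _ _ (M * K * `|h| * `|h|)).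
  apply: I01_norm; first exact: iB _ _ (iB _ _ i1 i2) (int01Z h i3).
  move=> t /andP[t0 t1]; have tt : 0 <= t <= 1 by rewrite !ltW.
  have -> : f (x + h, t) * kap t - f (x, t) * kap t - h * (pD false f (x, t) * kap t) =
    (f (x + h, t) - f (x, t) - h * pD false f (x, t)) * kap t by gen_pD; ring.
  rewrite normrM; have := B h t (ltW h1) tt; have := HK t tt; have := normr_ge0 (kap t).
  move: (`|_ - _ - _|) (`|kap t|) => p q q0 qK pM.
  apply: le_trans (ler_wpM2r q0 pM) _.
  have -> : M * K * `|h| * `|h| = M * `|h| * `|h| * K by ring.
  by rewrite ler_wpM2l // !mulr_ge0.
rewrite ler_wpM2r //; move: h2; rewrite ltr_pdivlMr // => h2; apply: le_trans (ltW h2).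
by rewrite mulrC ler_wpM2l // lerDl.
Qed.

Lemma param_Cinf1 f (kap : R -> R) : Cinf2 f -> continuous kap -> Cinf1 (fun x => I01 (fun t => f (x, t) * kap t)).
Proof.
move=> sf ck; apply: (@Cinf1_coind R (fun b => exists2 g, Cinf2 g & b = fun x => I01 (fun t => g (x, t) * kap t))); last by exists f.
move=> _ [g sg ->]; exists (fun x => I01 (fun t => pD false g (x, t) * kap t)); first exact: param_derive.
by exists (pD false g) => //; exact: Cinf2_pD.
Qed.

End Param.

(** * Fourier series in the second variable *)

Section PartialFourier.
Variable R : realType.
Variables (h1 h2 : R) (h1_gt0 : 0 < h1) (h2_gt0 : 0 < h2).
Notation V := (qper h1^-1 h2^-1).
Notation l := (ln h2).
Implicit Types (f u : R * R -> R) (b : R -> R).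

Lemma dcos0 (c x : R) : is_derive x (1:R) (fun t => cos (c * t)) (- c * sin (c * x)).
Proof. by have := dcos c 0 x; rewrite addr0 (_ : (fun t => _) = fun t => cos (c * t)) //; apply/funext => t; rewrite addr0. Qed.

Lemma dsin0 (c x : R) : is_derive x (1:R) (fun t => sin (c * t)) (c * cos (c * x)).
Proof. by have := dsin c 0 x; rewrite addr0 (_ : (fun t => _) = fun t => sin (c * t)) //; apply/funext => t; rewrite addr0. Qed.

Lemma cont_cos0 (c : R) : continuous (fun t : R => cos (c * t)).
Proof. exact: derive_continuous (dcos0 c). Qed.

Lemma cont_sin0 (c : R) : continuous (fun t : R => sin (c * t)).
Proof. exact: derive_continuous (dsin0 c). Qed.

Definition om2 (k : int) : R := 2 * pi * k%:~R.
(** Multiplication by h_2^(x_2) makes a function with multipliers 1/h periodic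
    in x_2. *)
Definition U u : R * R -> R := fun x => u x * expR (l * x.2).
Definition cC u k (x : R) : R := I01 (fun t => U u (x, t) * cos (om2 k * t)).
Definition cS u k (x : R) : R := I01 (fun t => U u (x, t) * sin (om2 k * t)).

(** The real part of (b1 - i b2)(x_1) h_2^(-x_2) exp (i om2 x_2). *)
Definition tri b1 b2 (k : int) (x : R * R) : R :=
  expR (- l * x.2) * (b1 x.1 * cos (om2 k * x.2) + b2 x.1 * sin (om2 k * x.2)).
(** For real u, Ck + i Sk is the k-th term of the Fourier series in x_2, of
    the form c(x_1) v_(-k)(x_2). *)
Definition Ck k u := tri (cC u k) (cS u k) k.
Definition Sk k u := tri (cS u k) (fun x => - cC u k x) k.

Lemma U_Cinf2 u : Cinf2 u -> Cinf2 (U u).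
Proof. by move=> su; apply: Cinf2_mul => //; exact: Cinf2_snd (Cinf1_exp l). Qed.

Lemma U_qper u : V u -> qper h1^-1 1 (U u).
Proof.
move=> [su qu]; split; first exact: U_Cinf2.
move=> x y; have [q1 q2] := qu x y; rewrite /U /= q1 q2 mulrDr mulr1 expRD lnK ?posrE //.
split; first by rewrite mulrA.
by field; exact: lt0r_neq0.
Qed.

Lemma U_pD1 u : Cinf2 u -> pD false (U u) = U (pD false u).
Proof.
move=> su; rewrite /U (pD_mul false su (Cinf2_snd (Cinf1_exp l))) (pderE (pder1_snd (fun t => expR (l * t)))).
by apply/funext => x; rewrite mulr0 addr0.
Qed.

Lemma U_pD2 u : Cinf2 u -> pD true (U u) = fun x => U (pD true u) x + l * U u x.
Proof.
move=> su; rewrite /U (pD_mul true su (Cinf2_snd (Cinf1_exp l))) (pderE (pder2_snd (dexp l))).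
by apply/funext => x; gen_pD; ring.
Qed.

Lemma cC_Cinf1 u k : Cinf2 u -> Cinf1 (cC u k).
Proof. by move=> su; apply: param_Cinf1; [exact: U_Cinf2|exact: cont_cos0]. Qed.

Lemma cS_Cinf1 u k : Cinf2 u -> Cinf1 (cS u k).
Proof. by move=> su; apply: param_Cinf1; [exact: U_Cinf2|exact: cont_sin0]. Qed.

Lemma cC_derive u k : Cinf2 u -> forall x : R, is_derive x (1:R) (cC u k) (cC (pD false u) k x).
Proof. by move=> su x; have := param_derive (U_Cinf2 su) (@cont_cos0 (om2 k)) x; rewrite U_pD1. Qed.

Lemma cS_derive u k : Cinf2 u -> forall x : R, is_derive x (1:R) (cS u k) (cS (pD false u) k x).
Proof. by move=> su x; have := param_derive (U_Cinf2 su) (@cont_sin0 (om2 k)) x; rewrite U_pD1. Qed.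

Lemma int_U u b (x : R) : Cinf2 u -> continuous b -> int01 (fun t => U u (x, t) * b t).
Proof.
by move=> su cb; apply: cont_int01; apply: cont_mul1 => //; exact: cont_slice2 (Cinf2_cont (U_Cinf2 su)).
Qed.

Lemma cC_per u k x : V u -> cC u k (x + 1) = h1^-1 * cC u k x.
Proof.
move=> Vu; rewrite /cC -(I01Z h1^-1 (int_U x Vu.1 (@cont_cos0 (om2 k)))); apply: eq_I01 => t _.
by have [_ q] := U_qper Vu; have [-> _] := q x t; rewrite mulrA.
Qed.

Lemma cS_per u k x : V u -> cS u k (x + 1) = h1^-1 * cS u k x.
Proof.
move=> Vu; rewrite /cS -(I01Z h1^-1 (int_U x Vu.1 (@cont_sin0 (om2 k)))); apply: eq_I01 => t _.
by have [_ q] := U_qper Vu; have [-> _] := q x t; rewrite mulrA.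
Qed.

Lemma U_ends u x : V u -> U u (x, 1) = U u (x, 0).
Proof. by move=> /U_qper [_ q]; have [_] := q x 0; rewrite add0r mul1r. Qed.

Lemma cos_om2 k : cos (om2 k * 1) = 1.
Proof. by rewrite mulr1 -[om2 k]add0r cos_perZ cos0. Qed.

Lemma sin_om2 k : sin (om2 k * 1) = 0.
Proof. by rewrite mulr1 -[om2 k]add0r sin_perZ sin0. Qed.

(** Integration by parts; U u is periodic in x_2, so there is no boundary
    term. *)
Lemma cCS_pD2 u k x : V u ->
  cC (pD true u) k x = - l * cC u k x + om2 k * cS u k x /\
  cS (pD true u) k x = - l * cS u k x - om2 k * cC u k x.
Proof.
move=> Vu; have [su _] := Vu; have sU := U_Cinf2 su; have su2 := Cinf2_pD true su.
have dU := (pder2P _ _).1 (Cinf2_pder true sU) x.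
have cdU := cont_slice2 x (Cinf2_cont (Cinf2_pD true sU)).
have cc := @cont_cos0 (om2 k); have cs := @cont_sin0 (om2 k).
have cc' : continuous (fun t => - om2 k * sin (om2 k * t)).
  by apply: cont_mul1 => // y; exact: cvg_cst.
have cs' : continuous (fun t => om2 k * cos (om2 k * t)).
  by apply: cont_mul1 => // y; exact: cvg_cst.
have E1 := I01_parts cdU cc' dU (dcos0 (om2 k)).
have E2 := I01_parts cdU cs' dU (dsin0 (om2 k)).
have D b : continuous b -> I01 (fun t => pD true (U u) (x, t) * b t) =
    I01 (fun t => U (pD true u) (x, t) * b t) + l * I01 (fun t => U u (x, t) * b t).
  move=> cb; rewrite -(I01Z l (int_U x su cb)) -(I01D (int_U x su2 cb) (int01Z l (int_U x su cb))).
  by apply: eq_I01 => t _; rewrite (U_pD2 su) mulrDl mulrA.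
rewrite (D _ cc) cos_om2 mulr0 cos0 !mulr1 (U_ends x Vu) subrr sub0r in E1.
rewrite (D _ cs) sin_om2 !mulr0 sin0 !mulr0 subrr sub0r in E2.
rewrite -/(cC (pD true u) k x) -/(cC u k x) in E1; rewrite -/(cS (pD true u) k x) -/(cS u k x) in E2.
have F1 : I01 (fun t => U u (x, t) * (- om2 k * sin (om2 k * t))) = - om2 k * cS u k x.
  rewrite -(I01Z (- om2 k) (int_U x su cs)); apply: eq_I01 => t _; ring.
have F2 : I01 (fun t => U u (x, t) * (om2 k * cos (om2 k * t))) = om2 k * cC u k x.
  rewrite -(I01Z (om2 k) (int_U x su cc)); apply: eq_I01 => t _; ring.
rewrite F1 in E1; rewrite F2 in E2.
move: E1 E2; move: (cC _ _ _) (cC _ _ _) (cS _ _ _) (cS _ _ _) (om2 k) => p q r s o E1 E2.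
split; lra.
Qed.

Lemma tri_Cinf2 b1 b2 k : Cinf1 b1 -> Cinf1 b2 -> Cinf2 (tri b1 b2 k).
Proof.
move=> s1 s2; apply: Cinf2_mul; first exact: Cinf2_snd (Cinf1_exp (- l)).
have sc : Cinf1 (fun t => cos (om2 k * t)).
  by have := Cinf1_cos (om2 k) 0; rewrite (_ : (fun x => _) = fun t => cos (om2 k * t)) //; apply/funext => t; rewrite addr0.
have ss : Cinf1 (fun t => sin (om2 k * t)).
  by have := Cinf1_sin (om2 k) 0; rewrite (_ : (fun x => _) = fun t => sin (om2 k * t)) //; apply/funext => t; rewrite addr0.
exact: (Cinf2_add (Cinf2_mul (Cinf2_fst s1) (Cinf2_snd sc)) (Cinf2_mul (Cinf2_fst s2) (Cinf2_snd ss))).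
Qed.

Lemma tri_qper b1 b2 k : Cinf1 b1 -> Cinf1 b2 -> (forall x, b1 (x + 1) = h1^-1 * b1 x) ->
  (forall x, b2 (x + 1) = h1^-1 * b2 x) -> V (tri b1 b2 k).
Proof.
move=> s1 s2 p1 p2; split; first exact: tri_Cinf2.
move=> x y; rewrite /tri /= p1 p2; split; first by ring.
rewrite !mulrDr !mulr1 expRD cos_perZ sin_perZ expRN lnK ?posrE //; ring.
Qed.

Lemma Ck_qper k u : V u -> V (Ck k u).
Proof.
move=> Vu; apply: tri_qper; [exact: cC_Cinf1 Vu.1|exact: cS_Cinf1 Vu.1|move=> x; exact: cC_per|move=> x; exact: cS_per].
Qed.

Lemma Sk_qper k u : V u -> V (Sk k u).
Proof.
move=> Vu; apply: tri_qper; [exact: cS_Cinf1 Vu.1|exact: Cinf1_opp (cC_Cinf1 k Vu.1)|move=> x; exact: cS_per|].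
by move=> x; rewrite cC_per // mulrN.
Qed.

Lemma tri_pder1 b1 b2 b1' b2' k : (forall x : R, is_derive x (1:R) b1 (b1' x)) ->
  (forall x : R, is_derive x (1:R) b2 (b2' x)) -> pder false (tri b1 b2 k) (tri b1' b2' k).
Proof.
move=> d1 d2.
apply: (pder_eqr (pder_mul (pder1_snd (fun t => expR (- l * t)))
  (pder_add (pder_mul (pder1_fst d1) (pder1_snd (fun t => cos (om2 k * t))))
            (pder_mul (pder1_fst d2) (pder1_snd (fun t => sin (om2 k * t))))))) => x.
by rewrite /tri; ring.
Qed.

Lemma tri_pder2 b1 b2 k : pder true (tri b1 b2 k)
  (tri (fun x => - l * b1 x + om2 k * b2 x) (fun x => - l * b2 x - om2 k * b1 x) k).
Proof.
apply: (pder_eqr (pder_mul (pder2_snd (dexp (- l)))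
  (pder_add (pder_mul (pder2_fst b1) (pder2_snd (dcos0 (om2 k))))
            (pder_mul (pder2_fst b2) (pder2_snd (dsin0 (om2 k))))))) => x.
by rewrite /tri; ring.
Qed.

Lemma Ck_pD j k u : V u -> pD j (Ck k u) = Ck k (pD j u).
Proof.
move=> Vu; have [su _] := Vu; apply: pderE; case: j.
  apply: (pder_eqr (tri_pder2 _ _ _)) => x; rewrite /Ck /tri.
  by have [-> ->] := cCS_pD2 k x.1 Vu.
exact: tri_pder1 (cC_derive k su) (cS_derive k su).
Qed.

Lemma Sk_pD j k u : V u -> pD j (Sk k u) = Sk k (pD j u).
Proof.
move=> Vu; have [su _] := Vu; apply: pderE; case: j.
  apply: (pder_eqr (tri_pder2 _ _ _)) => x; rewrite /Sk /tri.
  by have [-> ->] := cCS_pD2 k x.1 Vu; ring.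
apply: tri_pder1 (cS_derive k su) _ => x.
have := dZ (-1) (cC_derive k su x); rewrite mulN1r.
by rewrite (_ : (fun t => _) = fun t => - cC u k t) //; apply/funext => t; rewrite mulN1r.
Qed.

Lemma SkN k u x : Cinf2 u -> Sk (- k) u x = - Sk k u x.
Proof.
move=> su; have E1 (y : R) : cC u (- k) y = cC u k y.
  by apply: eq_I01 => t _; rewrite /om2 mulrNz mulrN mulNr cosN.
have E2 (y : R) : cS u (- k) y = -1 * cS u k y.
  rewrite -(I01Z (-1) (int_U y su (@cont_sin0 (om2 k)))); apply: eq_I01 => t _.
  by rewrite /om2 mulrNz mulrN mulNr sinN mulrN mulN1r.
have oN : om2 (- k) = - om2 k by rewrite /om2 mulrNz mulrN.
by rewrite /Sk /tri E1 E2 oN [- om2 k * _]mulNr cosN sinN; ring.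
Qed.

(** Up to the factor h_2^(-x_2) this is a term of the Fourier series of a
    periodic function of one variable. *)
Lemma Ck_fcoef k u x : Cinf2 u -> Ck k u x =
  expR (- l * x.2) * fcoef (fun t => U u (x.1, t)) k (- (2 * pi * k%:~R * x.2)).
Proof.
move=> su; rewrite /Ck /tri (fcoef_split _ _ (cont_slice2 x.1 (Cinf2_cont (U_Cinf2 su)))).
congr (_ * (_ * _ + _)).
by apply: eq_I01 => t _; rewrite addr0.
Qed.

Lemma Sk_fcoef k u x : Cinf2 u -> Sk k u x =
  expR (- l * x.2) * fcoef (fun t => U u (x.1, t)) k (- (om2 k * x.2) - pi / 2).
Proof.
move=> su; rewrite /Sk /tri; congr (_ * _); set y := om2 k * x.2.
have iC := int_U x.1 su (@cont_cos0 (om2 k)); have iS := int_U x.1 su (@cont_sin0 (om2 k)).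
have E1 := I01Z (cos y) iS; have E2 := I01Z (- sin y) iC.
rewrite mulNr [_ * cos y]mulrC [_ * sin y]mulrC -mulNr -[cS u k x.1]/(I01 _) -[cC u k x.1]/(I01 _) -E1 -E2.
rewrite -(I01D (int01Z _ iS) (int01Z _ iC)); apply: eq_I01 => t _.
rewrite -/(om2 k) addrA cosB cos_pihalf sin_pihalf mulr0 add0r mulr1 sinB; ring.
Qed.

Lemma sZ_Ck N u x : Cinf2 u -> sZ N (fun k => Ck k u x) =
  expR (- l * x.2) * fsum (fun t => U u (x.1, t)) N x.2.
Proof.
by move=> su; rewrite /fsum -sZM; apply: eq_sZ => k; rewrite Ck_fcoef.
Qed.

Lemma sup_bounds u : V u -> exists2 D, 0 <= D & forall x, Omega x ->
  [/\ forall k, `|Ck k u x| <= D * wt R k, forall k, `|Sk k u x| <= D * wt R k &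
      forall N, `|u x - sZ N (fun k => Ck k u x)| <= D * (swt R - sZ N (wt R))].
Proof.
move=> Vu; have [su _] := Vu; have VU := U_qper Vu; have [sU _] := VU.
have V1 := qper_pD true VU; have V2 := qper_pD true V1.
have [M0 M00 H0] := cont2_bounded (Cinf2_cont sU).
have [M2 M20 H2] := cont2_bounded (Cinf2_cont V2.1).
have [K K0 HK] := cont1_bounded (dC_cont (Cinf1_Cn (Cinf1_exp (- l)) 0)).
exists (K * (2 * (M0 + M2))); first by rewrite !mulr_ge0 ?addr_ge0.
move=> [x y] /OmegaP [/andP[x0 x1] y01]; have /andP[y0 y1] := y01.
have xx : 0 <= x <= 1 by rewrite !ltW.
have yy : 0 <= y <= 1 by rewrite !ltW.
pose q t := U u (x, t).
have dq := (pder2P _ _).1 (Cinf2_pder true sU) x.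
have dq' := (pder2P _ _).1 (Cinf2_pder true V1.1) x.
have cq := cont_slice2 x (Cinf2_cont V2.1).
have q01 : q 0 = q 1 by rewrite /q U_ends.
have q01' : pD true (U u) (x, 0) = pD true (U u) (x, 1).
  by have [_ qq] := V1; have [_] := qq x 0; rewrite add0r mul1r.
have B0 t : 0 < t < 1 -> `|q t| <= M0 by move=> /andP[t0 t1]; apply: H0 => //; rewrite !ltW.
have B2 t : 0 < t < 1 -> `|pD true (pD true (U u)) (x, t)| <= M2.
  by move=> /andP[t0 t1]; apply: H2 => //; rewrite !ltW.
have e0 : 0 <= expR (- l * y) by exact: expR_ge0.
have eK : expR (- l * y) <= K by apply: le_trans (HK y yy); exact: ler_norm.
have G (z e : R) : `|z| <= e -> `|expR (- l * y) * z| <= K * e.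
  by move=> ze; rewrite normrM (ger0_norm e0); apply: ler_pM.
split=> [k|k|N]; rewrite -!mulrA.
- rewrite Ck_fcoef //; apply: G; rewrite mulrA.
  exact: (fcoef_decay k _ dq dq' cq q01 q01' B0 B2).
- rewrite Sk_fcoef //; apply: G; rewrite mulrA.
  exact: (fcoef_decay k _ dq dq' cq q01 q01' B0 B2).
rewrite sZ_Ck //=.
have -> : u (x, y) = expR (- l * y) * q y.
  rewrite /q /U /= mulNr expRN; field.
  exact: lt0r_neq0 (expR_gt0 _).
rewrite -mulrBr; apply: G; rewrite mulrA.
exact: (fsum_unif y01 dq dq' cq q01 q01' B0 B2).
Qed.

Lemma sZ_pD j N (F : int -> R * R -> R) : (forall k, V (F k)) ->
  pD j (fun x => sZ N (fun k => F k x)) = fun x => sZ N (fun k => pD j (F k) x).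
Proof.
by move=> VF; apply: pderE; apply: pder_sZ => k; exact: Cinf2_pder (VF k).1.
Qed.

Definition Rem N u : R * R -> R := fun x => u x + -1 * sZ N (fun k => Ck k u x).

Lemma Rem_qper N u : V u -> V (Rem N u).
Proof. by move=> Vu; apply: qper_add => //; apply: qper_scale; apply: qper_sZ => k; exact: Ck_qper. Qed.

Lemma Rem_pD j N u : V u -> pD j (Rem N u) = Rem N (pD j u).
Proof.
move=> Vu; have Vs := qper_sZ N (fun k => Ck_qper k Vu).
rewrite /Rem (pD_add j Vu.1 (Cinf2_scale (-1) Vs.1)) (pD_scale j (-1) Vs.1).
rewrite (sZ_pD j N (fun k => Ck_qper k Vu)); apply/funext => x; congr (_ + _ * _).
by apply: eq_sZ => k; rewrite Ck_pD.
Qed.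

(** A bound for sup norms that holds for a family of operators on all of V is
    inherited by the derivatives if the operators commute with them. *)
Lemma sob_family (I : Type) (th : I -> (R * R -> R) -> R * R -> R) (e : I -> R) :
  (forall i u, V u -> V (th i u)) -> (forall i j u, V u -> pD j (th i u) = th i (pD j u)) ->
  (forall u, V u -> exists2 D, 0 <= D & forall i x, Omega x -> `|th i u x| <= D * e i) ->
  forall n u, V u -> exists2 D, 0 <= D & forall i, sob h1 h2 n (th i u) <= D * e i ^+ 2.
Proof.
move=> Vth pth sth; elim=> [|n IH] u Vu.
  have [D D0 HD] := sth u Vu.
  have co := Cinf2_cont (om_qper h1_gt0 h2_gt0).1.
  have Jo : 0 <= J (om h1 h2) by apply: J_ge0 => x _; rewrite ltW // om_gt0.
  exists (J (om h1 h2) * D ^+ 2); first by rewrite mulr_ge0 ?sqr_ge0.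
  move=> i; rewrite -mulrA -exprMn mulrC -(JZ _ (cont_intO co)) /=.
  apply: J_le; [exact: W_int (Cinf2_cont (Vth i u Vu).1)|exact: intO_Z (cont_intO co)|].
  move=> x Ox; rewrite mulrC ler_wpM2r ?(ltW (om_gt0 _ _ _)) //.
  by rewrite -(real_normK (num_real (th i u x))) lerXn2r ?nnegrE // ?HD // (le_trans _ (HD i x Ox)).
have [D D0 HD] := IH u Vu.
have [D1 D10 HD1] := IH _ (qper_pD false Vu).
have [D2 D20 HD2] := IH _ (qper_pD true Vu).
exists (D + D1 + D2); first by rewrite !addr_ge0.
move=> i; rewrite /= !pth // !mulrDl; apply: lerD; last exact: HD2.
by apply: lerD; [exact: HD|exact: HD1].
Qed.

Lemma sob_Ck n u : V u -> exists2 D, 0 <= D & forall k, sob h1 h2 n (Ck k u) <= D * wt R k ^+ 2.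
Proof.
apply: sob_family => [k v|k j v|v Vv]; [exact: Ck_qper|exact: Ck_pD|].
by have [D D0 H] := sup_bounds Vv; exists D => // k x /H [].
Qed.

Lemma sob_Sk n u : V u -> exists2 D, 0 <= D & forall k, sob h1 h2 n (Sk k u) <= D * wt R k ^+ 2.
Proof.
apply: sob_family => [k v|k j v|v Vv]; [exact: Sk_qper|exact: Sk_pD|].
by have [D D0 H] := sup_bounds Vv; exists D => // k x /H [].
Qed.

Lemma sob_Rem n u : V u -> exists2 D, 0 <= D & forall N, sob h1 h2 n (Rem N u) <= D * (swt R - sZ N (wt R)) ^+ 2.
Proof.
apply: sob_family => [k v|k j v|v Vv]; [exact: Rem_qper|exact: Rem_pD|].
by have [D D0 H] := sup_bounds Vv; exists D => // N x /H [_ _ h]; rewrite /Rem mulN1r.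
Qed.

End PartialFourier.

(** * Sums along the finite sets of integers *)

Section Totally.
Variable R : realType.
Implicit Types (F : int -> R).

Lemma eq_sZ_le N F G : (forall k, (`|k| <= N)%N -> F k = G k) -> sZ N F = sZ N G.
Proof.
move=> H; rewrite /sZ H //; congr (_ + _); apply: eq_bigr => i _.
by rewrite !H //= ?abszN //= ltn_ord.
Qed.

Lemma sZ_pt M (a : int) (c : R) : (`|a| <= M)%N -> sZ M (fun k => if k == a then c else 0) = c.
Proof.
have z N : (N < `|a|)%N -> sZ N (fun k => if k == a then c else 0) = 0.
  move=> Na; rewrite (@eq_sZ_le N _ (fun=> 0 * 0)) ?sZM ?mul0r // => k kN.
  by case: eqP => [ka|_]; rewrite ?mul0r //; move: Na; rewrite -ka ltnNge kN.
elim: M => [|M IH].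
  by rewrite leqn0 absz_eq0 => /eqP ->; rewrite sZ0 eqxx.
rewrite leq_eqVlt => /orP[/eqP aM|aM]; last first.
  rewrite sZS IH // !ifN ?addr0 //; apply: contraTneq aM => <-; rewrite ?abszN /= ltnn //.
rewrite sZS z ?aM // add0r; case: a aM {IH z} => n; last first.
  by rewrite NegzE abszN /= => -[->]; rewrite eqxx /= ?add0r.
by rewrite /= => ->; rewrite eqxx /= ?addr0.
Qed.

Lemma sum_seq_sZ F (s : seq int) M : (forall i, i \in s -> (`|i| <= M)%N) ->
  \sum_(i <- s) F i = sZ M (fun k => \sum_(i <- s) if k == i then F i else 0).
Proof.
elim: s => [|a s IH] H.
  rewrite big_nil (@eq_sZ _ M _ (fun=> 0 * 0)) ?sZM ?mul0r // => k.
  by rewrite big_nil ?mulr0.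
rewrite big_cons IH; last by move=> i ins; apply: H; rewrite inE ins orbT.
rewrite [RHS](@eq_sZ _ M _ (fun k => (if k == a then F a else 0) + \sum_(i <- s) if k == i then F i else 0)).
  by rewrite sZD sZ_pt // H // inE eqxx.
by move=> k; rewrite big_cons.
Qed.

Lemma sum_ind F (s : seq int) k : uniq s ->
  \sum_(i <- s) (if k == i then F i else 0) = if k \in s then F k else 0.
Proof.
elim: s => [|a s IH] /=; first by rewrite big_nil.
move=> /andP[nas us]; rewrite big_cons inE IH //.
by case: eqP => [->|_]; rewrite ?add0r //= (negPf nas) addr0.
Qed.

(** A finite set that contains all k with |k| <= N adds to sZ N only terms of
    the tail of the series. *)
Lemma totally_cvg F (L B : R) : (forall k, `|F k| <= B * wt R k) -> tends0 (fun N => L - sZ N F) ->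
  summability.partial_sum F @ summability.totally --> L.
Proof.
move=> HF HL; have B0 : 0 <= B.
  have := le_trans (normr_ge0 _) (HF 0); by rewrite pmulr_lge0 // wt_gt0.
have P : ProperFilter (@summability.totally int) := summability.totally_filter.
apply/cvgrPdist_le => e e0; have e2 : 0 < e / 2 by rewrite divr_gt0.
have [N1 H1] := HL _ e2; have [N2 H2] := tends0_scale B (@tail_tends0 R) e2.
pose N := maxn N1 N2.
pose A0 : {fset int} := seq_fset tt ([seq Posz n | n <- iota 0 N.+1] ++ [seq - Posz n | n <- iota 0 N.+1]).
exists A0 => // A /= A0A; rewrite /summability.partial_sum.
rewrite -(big_seq_fsetE _ _ predT F) /=.
have NA (k : int) : (`|k| <= N)%N -> k \in A.
  move=> kN; apply: (fsubsetP A0A); rewrite seq_fsetE mem_cat; apply/orP.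
  case: k kN => n nN; [left|right]; first by apply: (map_f Posz); rewrite mem_iota.
  by rewrite NegzE; apply: (map_f (fun n : nat => - Posz n) (_ : n.+1 \in _)); rewrite mem_iota.
pose M := maxn N (\max_(i <- (A : seq int)) `|i|)%N.
have AM i : i \in (A : seq int) -> (`|i| <= M)%N.
  by move=> iA; apply: leq_trans (leq_maxr _ _); exact: (@leq_bigmax_seq _ _ predT (fun i : int => `|i|%N)).
rewrite (sum_seq_sZ F AM); have uA : uniq (A : seq int) := fset_uniq A.
rewrite (@eq_sZ _ M _ (fun k => if k \in (A : seq int) then F k else 0)); last by move=> k; exact: sum_ind.
set G := fun k : int => if k \in (A : seq int) then F k else 0.
have GB k : `|G k| <= B * wt R k.
  by rewrite /G; case: ifP => // _; rewrite normr0 mulr_ge0 // ltW // wt_gt0.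
have GN : sZ N G = sZ N F by apply: eq_sZ_le => k kN; rewrite /G NA.
have := sZ_cauchy GB (leq_maxl N _ : (N <= M)%N); rewrite GN => h1.
have h2 := H1 N (leq_maxl _ _); have h3 := H2 N (leq_maxr _ _).
have -> : L - sZ M G = (L - sZ N F) - (sZ M G - sZ N F) by ring.
apply: le_trans (ler_normB _ _) _; have -> : e = e / 2 + e / 2 by field.
by apply: lerD => //; apply: le_trans h1 (le_trans (ler_norm _) h3).
Qed.

Lemma csum_cvg (F : int -> R[i]) (L : R[i]) (B : R) : (forall k, ComplexField.Normc.normc (F k) <= B * wt R k) ->
  tends0 (fun N => complex.Re L - sZ N (fun k => complex.Re (F k))) ->
  tends0 (fun N => complex.Im L - sZ N (fun k => complex.Im (F k))) ->
  csummableZ F /\ csumZ F = L.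
Proof.
move=> HF H1 H2.
have n1 (z : R[i]) : `|complex.Re z| <= ComplexField.Normc.normc z.
  case: z => a b /=; rewrite -sqrtr_sqr ler_sqrt ?addr_ge0 ?sqr_ge0 // lerDl sqr_ge0 //.
have n2 (z : R[i]) : `|complex.Im z| <= ComplexField.Normc.normc z.
  case: z => a b /=; rewrite -sqrtr_sqr ler_sqrt ?addr_ge0 ?sqr_ge0 // lerDr sqr_ge0 //.
have c1 := totally_cvg (fun k => le_trans (n1 (F k)) (HF k)) H1.
have c2 := totally_cvg (fun k => le_trans (n2 (F k)) (HF k)) H2.
split; first by split; apply/cvg_ex; [exists (complex.Re L)|exists (complex.Im L)].
have P : ProperFilter (@summability.totally int) := summability.totally_filter.
by rewrite /csumZ /summability.sum (cvg_lim (@Rhausdorff R) c1) (cvg_lim (@Rhausdorff R) c2); case: L {H1 H2 c1 c2}.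
Qed.

End Totally.

(** * Slices of functions on the square *)

Section Slices.
Variable R : realType.
Notation mu := (@lebesgue_measure R).
Notation T := (measurableTypeR R).
Notation Om := (@Omega R : set (T * T)).
Implicit Types (F G : R * R -> R).

Lemma mO_slice F (x : R) : mO F -> 0 < x < 1 -> measurable_fun (`]0, 1[%classic : set T) ((fun t => F (x, t)) : T -> T).
Proof.
move=> mF x01.
apply: (@measurable_comp _ _ _ T (T * T)%type T Om F _ (fun t : T => (x, t) : T * T)) => //.
- exact: measurable_Omega.
- move=> _ [t /= + <-]; rewrite in_itv /= => t01; exact/OmegaP.
exact: measurable_funTS (pair1_measurable x).
Qed.

(** Almost every slice of a null set is a null set. *)
Lemma slice_ae F G : mO F -> mO G -> aeO F G ->
  {ae mu, forall x : T, 0 < x < 1 -> slice_int F x = slice_int G x}.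
Proof.
move=> mF mG [N [mN N0 FG]].
have E0 : (\int[mu]_x (mu \o xsection N) x = 0)%E by exact: N0.
have mX : measurable_fun setT (mu \o xsection N : T -> \bar R).
  exact: (@measurable_fun_xsection _ _ T T R mu N mN).
have := (ae_eq_integral_abs mu (@measurableT _ T) mX).1.
rewrite (eq_integral (mu \o xsection N)); last by move=> x _; rewrite gee0_abs.
move=> /(_ E0); apply: filterS => x /= /(_ I) x0 x01.
rewrite /slice_int /I01 /Rintegral; congr (fine _); apply: ae_eq_integral.
- exact: m01.
- by apply/measurable_EFinP; exact: mO_slice.
- by apply/measurable_EFinP; exact: mO_slice.
exists (xsection N x); split => //; first exact: measurable_xsection.
move=> t /= h; apply/xsectionP; apply: FG => /= h'; apply: h; rewrite /= in_itv /= => t01.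
by apply: h'; apply/OmegaP.
Qed.

Lemma ae_fst (P : R -> Prop) : {ae mu, forall x : T, 0 < x < 1 -> P x} ->
  {ae leb2 R, forall x : T * T, Omega x -> P x.1}.
Proof.
move=> [N [mN N0 PN]]; exists (N `*` setT); split.
- exact: measurableX.
- have E := @product_measure1E _ _ T T R mu mu N setT mN measurableT.
  by apply: (etrans E); apply: (etrans (f_equal (fun u => (u * _)%E) N0)); exact: mul0e.
move=> [x y] /= h; split => //=; apply: PN => /= h'; apply: h => /OmegaP [x01 _]; exact: h'.
Qed.

Lemma mO_fst (b : R -> R) : measurable_fun (`]0, 1[%classic : set T) (b : T -> T) -> mO (fun x => b x.1).
Proof.
move=> mb; apply: (@measurable_comp _ _ _ (T * T)%type T T `]0, 1[ b _ (fun x : T * T => x.1)) => //.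
- move=> z [[x y] Oxy] <- /=; have /OmegaP [x01 _] := Oxy; by rewrite in_itv.
exact: measurable_funTS measurable_fst.
Qed.

Lemma mO_ext F G : (forall x, Omega x -> F x = G x) -> mO F -> mO G.
Proof.
by move=> H; apply: eq_measurable_fun => x; rewrite inE => Ox; exact: H.
Qed.

Lemma sq_ae F G : mO F -> continuous G -> aeO F G -> sq F.
Proof.
move=> mF cG FG; split=> //; have [mG iG] := sq_cont cG.
have mF2 := mO_mul mF mF; have mG2 := mO_mul mG mG.
apply/integrableP; split; first exact/measurable_EFinP.
have /integrableP [_] := iG; congr (_ < _)%E; apply: ae_eq_integral.
- exact: measurable_Omega.
- by apply: measurableT_comp => //; exact/measurable_EFinP.
- by apply: measurableT_comp => //; exact/measurable_EFinP.
apply: filterS FG => x /= + Ox => /(_ Ox) [E]; by rewrite E.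
Qed.

End Slices.

(** * The periodic primitive *)

Section Primitive.
Variable R : realType.

(** The integral of a - mean a over a period is 0. *)
Lemma primitive_periodic (a : R -> R) : smooth_periodic a -> exists A, [/\ Cinf1 A,
  (forall x, A (x + 1) = A x), (forall x : R, is_derive x (1:R) A (a x - mean a)) &
  forall x, 0 < x < 1 -> primA a x = A x].
Proof.
move=> sa; have s := periodic_Cinf1 sa; have [_ pa] := sa.
have ca : continuous a := dC_cont (Cinf1_Cn s 0).
have Em : mean a = I01 a by rewrite (I01_cc ca).
have sb : Cinf1 (fun x => a x - mean a) by apply: Cinf1_add => //; exact: (@Cinf1_cst R (- mean a)).
have cb : continuous (fun x => a x - mean a) := dC_cont (Cinf1_Cn sb 0).
have [F dF] := primitive_exists cb.
have cF : continuous F := derive_continuous dF.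
have i1 : I01 (fun x => a x - mean a) = 0.
  rewrite (I01B (cont_int01 ca) (cont_int01 (fun x => cvg_cst (mean a)))) I01_cst Em subrr //.
exists (fun x => F x - F 0); split.
- apply: Cinf1_add; last exact: (@Cinf1_cst R (- F 0)).
  split; case=> [|n]; first exact: cF.
  exact: dCS dF (Cinf1_Cn sb n).
- move=> x; congr (_ - _).
  have d x' : is_derive x' (1:R) (fun t => F (t + 1) - F t) 0.
    apply: is_derive_eq (dB (derive_shift 1 dF x') (dF x')) _.
    by rewrite pa subrr.
  have := derive0_cst d x 0; rewrite add0r -(I01E cb dF) i1 => /eqP.
  by rewrite subr_eq0 => /eqP.
- move=> x; apply: is_derive_eq (dB (dF x) (dcst (F 0) x)) _.
  by rewrite subr0.
move=> x /andP[x0 x1]; rewrite /primA.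
have dG (t : R) : is_derive t (1:R) (fun t => F t + mean a * t) (a t).
  by apply: is_derive_eq (dD (dF t) (dZ (mean a) (did t))) _; rewrite mulr1 subrK.
by rewrite [\int[_]_(_ in _) _](int_seg_FTC x0 ca dG) mulr0 addr0; ring.
Qed.

End Primitive.

(** * The terms of the series of Psi *)

Section PsiTerm.
Variable R : realType.
Variables (h1 h2 : R) (h1_gt0 : 0 < h1) (h2_gt0 : 0 < h2).
Notation Om := (@Omega R : set (measurableTypeR R * measurableTypeR R)).
Notation L2O := (L2 (leb2 R) Om).
Notation V := (qper h1^-1 h2^-1).
Notation Vc := (qperc h1^-1 h2^-1).
Notation l := (ln h2).
Notation normc := (@ComplexField.Normc.normc R).
Implicit Types (f g phi : R * R -> R[i]) (u v : R * R -> R) (b : R -> R) (w : functional R).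

Definition ecos (k : int) (x : R * R) : R := expR (l * x.2) * cos (om2 R k * x.2).
Definition esin (k : int) (x : R * R) : R := expR (l * x.2) * sin (om2 R k * x.2).
Definition G1 phi k : R * R -> R := fun x => re phi x * ecos k x + -1 * (im phi x * esin k x).
Definition G2 phi k : R * R -> R := fun x => re phi x * esin k x + im phi x * ecos k x.

Lemma cont_ecos k : continuous (ecos k).
Proof.
by apply: cont_mul2; [exact: cont_snd (dC_cont (Cinf1_Cn (Cinf1_exp l) 0))|exact: cont_snd (@cont_cos0 R (om2 R k))].
Qed.

Lemma cont_esin k : continuous (esin k).
Proof.
by apply: cont_mul2; [exact: cont_snd (dC_cont (Cinf1_Cn (Cinf1_exp l) 0))|exact: cont_snd (@cont_sin0 R (om2 R k))].
Qed.

Lemma sq_mulr u v : sq u -> continuous v -> sq (fun x => u x * v x).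
Proof.
move=> su cv; have := sq_mul su cv; rewrite (_ : (fun x => v x * u x) = fun x => u x * v x) //.
by apply/funext => x; rewrite mulrC.
Qed.

Lemma sq_G phi k : L2O phi -> sq (G1 phi k) /\ sq (G2 phi k).
Proof.
move=> /L2_sq [s1 s2]; have cc := @cont_ecos k; have cs := @cont_esin k.
split; apply: sq_add; try apply: sq_scale; exact: sq_mulr.
Qed.

Lemma G_ae phi f k : aeC phi f -> aeO (G1 phi k) (G1 f k) /\ aeO (G2 phi k) (G2 f k).
Proof.
move=> [e1 e2]; have r u : aeO u u := aeO_refl u.
by split; apply: aeO_add; try apply: aeO_scale; apply: aeO_mul.
Qed.

Definition coefR phi k := slice_int (G1 phi k).
Definition coefI phi k := slice_int (G2 phi k).

Lemma re_cexp (z : R[i]) : complex.Re (cexp z) = expR (complex.Re z) * cos (complex.Im z).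
Proof. by rewrite /cexp; case: z => p q /=; ring. Qed.

Lemma im_cexp (z : R[i]) : complex.Im (cexp z) = expR (complex.Re z) * sin (complex.Im z).
Proof. by rewrite /cexp; case: z => p q /=; ring. Qed.

Lemma cexp_i (p q : R) : q = p -> cexp (q *i)%C = (cos p +i* sin p)%C.
Proof. by move=> ->; apply: eq_cplx; rewrite ?re_cexp ?im_cexp /= expR0 mul1r. Qed.

Lemma scale_cplx (p c s : R) : (p%:C * (c +i* s))%C = ((p * c) +i* (p * s))%C.
Proof. by apply: eq_cplx => /=; ring. Qed.

Lemma powR_expR (p q : R) : q = l * p -> h2 `^ p = expR q.
Proof. by move=> ->; rewrite /powR (gt_eqF h2_gt0) mulrC. Qed.

Lemma u1E k (t : R) : u1 h2 k t = ((expR (l * t) * cos (om2 R k * t)) +i* (expR (l * t) * sin (om2 R k * t)))%C.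
Proof.
have E1 : 2 * pi * t * k%:~R = om2 R k * t by rewrite /om2; ring.
by rewrite /u1 (powR_expR erefl) (cexp_i E1); exact: scale_cplx.
Qed.

Lemma v1E k (t : R) : v1 h2 (- k) t = ((expR (- l * t) * cos (om2 R k * t)) +i* - (expR (- l * t) * sin (om2 R k * t)))%C.
Proof.
have E1 : 2 * pi * t * (- k)%:~R = - (om2 R k * t) by rewrite /om2 mulrNz; ring.
have E2 : - l * t = l * - t by ring.
rewrite /v1 (powR_expR E2) (cexp_i E1); apply: (etrans (scale_cplx _ _ _)).
by rewrite cosN sinN mulrN.
Qed.

Lemma coef_cint phi k (x : R) :
  cint (@leb1 R) `]0, 1[ (fun t => phi (x, t) * u1 h2 k t) = (coefR phi k x +i* coefI phi k x)%C.
Proof.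
rewrite /cint; congr (_ +i* _)%C; apply: eq_Rintegral => t _; rewrite u1E /G1 /G2 /ecos /esin /re /im /=.
  by case: (phi (x, t)) => p q /=; ring.
by case: (phi (x, t)) => p q /=; ring.
Qed.

Lemma cexp_mulr (k : int) (p : R) : cexp ((l +i* (2 * pi * k%:~R)) * p%:C)%C =
  ((expR (l * p) * cos (om2 R k * p)) +i* (expR (l * p) * sin (om2 R k * p)))%C.
Proof.
have -> : ((l +i* (2 * pi * k%:~R)) * p%:C)%C = ((l * p) +i* (om2 R k * p))%C.
  by apply: eq_cplx; rewrite /om2 /=; ring.
by apply: eq_cplx; rewrite ?re_cexp ?im_cexp.
Qed.

(** The k-th term of the series of Psi is w applied to this function. *)
Definition Phi (a : R -> R) phi k : R * R -> R[i] := fun x =>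
  (cexp ((l +i* (2 * pi * k%:~R)) * (primA a x.1)%:C) *
    cint (@leb1 R) `]0, 1[ (fun t => phi (x.1, t) * u1 h2 k t) * v1 h2 (- k) x.2)%C.

Lemma Psi_term_Phi a w phi k : Psi_term h2 a w k phi = w (Phi a phi k).
Proof. by []. Qed.

(** The factor exp ((log h_2 + 2 pi i k) A(x_1)) replaces x_2 by x_2 - A(x_1)
    in the function (b1 + i b2)(x_1) v_(-k)(x_2). *)
Definition sterm (A : R -> R) (b1 b2 : R -> R) k : R * R -> R[i] :=
  cx (shear (fun t => - A t) (tri h2 b1 b2 k)) (shear (fun t => - A t) (tri h2 b2 (fun t => - b1 t) k)).

Lemma mul3 (p c s coefR coefI q d t : R) :
  (((p * c) +i* (p * s)) * (coefR +i* coefI) * ((q * d) +i* - (q * t)))%C =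
  ((p * q * (coefR * (d * c + t * s) + coefI * (t * c - d * s))) +i*
   (p * q * (coefI * (d * c + t * s) - coefR * (t * c - d * s))))%C.
Proof. by apply: eq_cplx => /=; ring. Qed.

Lemma PhiE a A phi k x : (forall y, 0 < y < 1 -> primA a y = A y) -> Omega x ->
  Phi a phi k x = sterm A (coefR phi k) (coefI phi k) k x.
Proof.
case: x => x y pA /OmegaP [x01 _]; rewrite /Phi /= coef_cint cexp_mulr v1E pA //.
apply: (etrans (mul3 _ _ _ _ _ _ _ _)); rewrite /sterm /cx /shear /tri /=.
have -> : - l * (y + - A x) = l * A x + - l * y by ring.
have -> : om2 R k * (y + - A x) = om2 R k * y - om2 R k * A x by ring.
rewrite expRD cosB sinB; apply: eq_cplx => /=; ring.
Qed.

Lemma mO_cst (c : R) : mO (fun=> c).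
Proof. exact: measurable_cst. Qed.

Lemma sterm_mO A b1 b2 k : continuous A -> mO (fun x : R * R => b1 x.1) -> mO (fun x : R * R => b2 x.1) ->
  mO (re (sterm A b1 b2 k)) /\ mO (im (sterm A b1 b2 k)).
Proof.
move=> cA m1 m2.
have H (c : R -> R) : continuous c -> continuous (shear (fun t => - A t) (fun x => c x.2)).
  move=> cc; apply: cont_shear; last exact: cont_snd.
  by move=> t; apply: continuousN; exact: cA.
have He := mO_cont (H _ (dC_cont (Cinf1_Cn (Cinf1_exp (- l)) 0))).
have Hc := mO_cont (H _ (@cont_cos0 R (om2 R k))).
have Hs := mO_cont (H _ (@cont_sin0 R (om2 R k))).
have m1' : mO (fun x : R * R => - b1 x.1).
  by apply: (mO_ext _ (mO_mul (mO_cst (-1)) m1)) => x _; rewrite mulN1r.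
split; apply: mO_mul => //; apply: mO_add; exact: mO_mul.
Qed.

Definition fproj k f := cx (fun x => Ck h2 k (re f) x + -1 * Sk h2 k (im f) x)
  (fun x => Sk h2 k (re f) x + Ck h2 k (im f) x).

Lemma fproj_V k f : Vc f -> Vc (fproj k f).
Proof.
move=> [V1 V2]; split; apply: qper_add; try apply: qper_scale.
- exact: Ck_qper.
- exact: Sk_qper.
- exact: Sk_qper.
- exact: Ck_qper.
Qed.

Lemma coef_smooth f k x : Vc f -> coefR f k x = cC h2 (re f) k x - cS h2 (im f) k x /\
  coefI f k x = cS h2 (re f) k x + cC h2 (im f) k x.
Proof.
move=> [[s1 _] [s2 _]]; have cc := @cont_cos0 R (om2 R k); have cs := @cont_sin0 R (om2 R k).
have i1 := int_U h2 x s1 cc; have i2 := int_U h2 x s1 cs; have i3 := int_U h2 x s2 cc; have i4 := int_U h2 x s2 cs.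
split; rewrite /cC /cS.
  apply: etrans (I01B i1 i4); apply: eq_I01 => t _.
  by rewrite /G1 /ecos /esin /U /=; ring.
apply: etrans (I01D i2 i3); apply: eq_I01 => t _.
by rewrite /G2 /ecos /esin /U /=; ring.
Qed.

Lemma sterm_smooth A f k : Vc f -> sterm A (coefR f k) (coefI f k) k = compwise (shear (fun t => - A t)) (fproj k f).
Proof.
move=> Vf; apply/funext => x; rewrite /sterm /compwise /cx /shear /fproj /re /im /Ck /Sk /tri /=.
have [-> ->] := coef_smooth k x.1 Vf.
by apply: eq_cplx => /=; rewrite /re /im; ring.
Qed.

(** The coefficient of phi agrees with that of its smooth representative only
    for almost every x_1; it is measurable by Fubini. *)
Lemma Psi_termE a A w phi f k : continuous A -> tame_op h1 h2 (shear (fun t => - A t)) ->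
  (forall y, 0 < y < 1 -> primA a y = A y) ->
  Hminf h1 h2 w -> L2O phi -> Vc f -> aeC phi f ->
  Psi_term h2 a w k phi = w (compwise (shear (fun t => - A t)) (fproj k f)).
Proof.
move=> cA tA pA Hw Lp Vf pf; rewrite Psi_term_Phi.
have VP := compwise_V tA (fproj_V k Vf).
have [sp1 sp2] := sq_G k Lp; have [sf1 sf2] := sq_G k (qperc_L2 Vf).
have [e1 e2] := G_ae k pf.
have m1 : mO (fun x : R * R => coefR phi k x.1).
  by apply: mO_fst; apply/measurable_EFinP; have [i _] := J_fubini (sq_int sp1); exact: measurable_int i.
have m2 : mO (fun x : R * R => coefI phi k x.1).
  by apply: mO_fst; apply/measurable_EFinP; have [i _] := J_fubini (sq_int sp2); exact: measurable_int i.
have [M1 M2] := sterm_mO k cA m1 m2.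
have E x : Omega x -> Phi a phi k x = sterm A (coefR phi k) (coefI phi k) k x by exact: PhiE.
have ae1 := ae_fst (slice_ae sp1.1 sf1.1 e1); have ae2 := ae_fst (slice_ae sp2.1 sf2.1 e2).
have S : {ae leb2 R, forall x : measurableTypeR R * measurableTypeR R, Omega x -> Phi a phi k x = compwise (shear (fun t => - A t)) (fproj k f) x}.
  move: ae1 ae2; apply: filterS2 => x /= h1' h2' Ox; rewrite (E x Ox) -sterm_smooth //.
  by rewrite /sterm /cx /shear /tri /= /coefR /coefI (h1' Ox) (h2' Ox).
have aeP : aeC (Phi a phi k) (compwise (shear (fun t => - A t)) (fproj k f)).
  by split; apply: filterS S => x /= h Ox; rewrite /re /im (h Ox).
apply: (Hminf_ae h1_gt0 h2_gt0 Hw _ VP aeP); apply/L2_sq; split.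
  apply: (sq_ae _ (Cinf2_cont VP.1.1) aeP.1); apply: (mO_ext _ M1) => x Ox.
  by rewrite /re (E x Ox).
apply: (sq_ae _ (Cinf2_cont VP.2.1) aeP.2); apply: (mO_ext _ M2) => x Ox.
by rewrite /im (E x Ox).
Qed.

End PsiTerm.

(** * The sum of the series of Psi *)

Section PsiSum.
Variable R : realType.
Variables (h1 h2 : R) (h1_gt0 : 0 < h1) (h2_gt0 : 0 < h2).
Notation Om := (@Omega R : set (measurableTypeR R * measurableTypeR R)).
Notation L2O := (L2 (leb2 R) Om).
Notation V := (qper h1^-1 h2^-1).
Notation Vc := (qperc h1^-1 h2^-1).
Notation normc := (@ComplexField.Normc.normc R).
Implicit Types (f g phi : R * R -> R[i]) (u v : R * R -> R) (w : functional R).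

Definition csZ N (F : int -> R[i]) : R[i] :=
  (sZ N (fun k => complex.Re (F k)) +i* sZ N (fun k => complex.Im (F k)))%C.

Lemma csZS N F : csZ N.+1 F = csZ N F + (F (Posz N.+1) + F (- Posz N.+1)).
Proof.
rewrite /csZ !sZS; case: (F (Posz N.+1)) (F (- Posz N.+1)) => p q [r s].
exact: eq_cplx.
Qed.

Lemma csZ0 F : csZ 0 F = F 0.
Proof. by rewrite /csZ !sZ0; case: (F 0). Qed.

Lemma csZ_V N (F : int -> R * R -> R[i]) : (forall k, Vc (F k)) -> Vc (fun x => csZ N (fun k => F k x)).
Proof. by move=> VF; split; apply: qper_sZ => k; have [] := VF k. Qed.

Variables (s : (R * R -> R) -> R * R -> R) (ts : tame_op h1 h2 s) (w : functional R) (Hw : Hminf h1 h2 w).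
Let ws f := w (compwise s f).

Lemma ws_lin c f g : Vc f -> Vc g -> ws (fun x => c * f x + g x) = c * ws f + ws g.
Proof.
move=> Vf Vg; rewrite /ws (compwise_lin c ts Vf Vg).
exact: (Hminf_lin h1_gt0 h2_gt0 c Hw (compwise_V ts Vf) (compwise_V ts Vg)).
Qed.

Lemma ws_add f g : Vc f -> Vc g -> ws (fun x => f x + g x) = ws f + ws g.
Proof.
move=> Vf Vg; have := ws_lin 1 Vf Vg; rewrite mul1r => <-; congr ws.
by apply/funext => x; rewrite mul1r.
Qed.

Lemma Vc_add f g : Vc f -> Vc g -> Vc (fun x => f x + g x).
Proof.
move=> Vf Vg; have := qperc_lin 1 Vf Vg; rewrite (_ : (fun x => _) = fun x => f x + g x) //.
by apply/funext => x; rewrite mul1r.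
Qed.

Lemma ws_csZ N (F : int -> R * R -> R[i]) : (forall k, Vc (F k)) ->
  ws (fun x => csZ N (fun k => F k x)) = csZ N (fun k => ws (F k)).
Proof.
move=> VF; elim: N => [|N IH].
  by rewrite csZ0; congr ws; apply/funext => x; rewrite csZ0.
rewrite csZS -IH -(ws_add (VF (Posz N.+1)) (VF (- Posz N.+1))).
rewrite -(ws_add (csZ_V N VF) (Vc_add (VF (Posz N.+1)) (VF (- Posz N.+1)))).
by congr ws; apply/funext => x; rewrite csZS.
Qed.

Lemma ws_bound : exists n, exists2 B, 0 <= B & forall f, Vc f -> normc (ws f) ^+ 2 <= B * sobc h1 h2 n f.
Proof.
have [n [B B0 HB]] := Hminf_tame h1_gt0 h2_gt0 Hw; have [m [C C0 HC]] := tame_sob ts n.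
exists m, (B * C); first exact: mulr_ge0.
move=> f Vf; apply: le_trans (HB _ (compwise_V ts Vf)) _.
rewrite -[leRHS]mulrA ler_wpM2l // /sobc mulrDr; have [V1 V2] := Vf.
by apply: lerD; exact: HC.
Qed.

Lemma normc_ge0 (z : R[i]) : 0 <= normc z.
Proof. by case: z => p q; exact: sqrtr_ge0. Qed.

Lemma sq_bound (z : R[i]) (K e : R) : 0 <= K -> 0 <= e -> normc z ^+ 2 <= K * e ^+ 2 -> normc z <= (1 + K) * e.
Proof.
move=> K0 e0 H; rewrite -(@ler_sqr _ (normc z)) ?nnegrE ?normc_ge0 //; last by rewrite mulr_ge0 // addr_ge0.
apply: le_trans H _; rewrite exprMn ler_wpM2r ?sqr_ge0 //; nra.
Qed.

Lemma fproj_bound f : Vc f -> exists K, forall k, normc (ws (fproj h2 k f)) <= K * wt R k.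
Proof.
move=> Vf; have [V1 V2] := Vf; have [n [B B0 HB]] := ws_bound.
have [D1 D10 H1] := sob_Ck h1_gt0 h2_gt0 n V1; have [D2 D20 H2] := sob_Ck h1_gt0 h2_gt0 n V2.
have [D3 D30 H3] := sob_Sk h1_gt0 h2_gt0 n V1; have [D4 D40 H4] := sob_Sk h1_gt0 h2_gt0 n V2.
pose K := B * (2 * (D1 + D4) + 2 * (D3 + D2)).
exists (1 + K) => k; apply: sq_bound; rewrite ?(ltW (wt_gt0 _ _)) //.
  by rewrite /K !mulr_ge0 // addr_ge0 // mulr_ge0 // addr_ge0.
apply: le_trans (HB _ (fproj_V h2_gt0 k Vf)) _; rewrite /K -[leRHS]mulrA ler_wpM2l //.
have r1 := (Ck_qper h2_gt0 k V1).1; have r2 := (Sk_qper h2_gt0 k V2).1.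
have r3 := (Sk_qper h2_gt0 k V1).1; have r4 := (Ck_qper h2_gt0 k V2).1.
rewrite mulrDl /sobc; apply: lerD.
  change (re (fproj h2 k f)) with (fun x => Ck h2 k (re f) x + -1 * Sk h2 k (im f) x).
  apply: le_trans (sob_add h1_gt0 h2_gt0 n r1 (Cinf2_scale (-1) r2)) _.
  rewrite (sob_scale h1_gt0 h2_gt0 n (-1) r2) sqrrN expr1n mul1r -mulrA ler_wpM2l // mulrDl.
  by apply: lerD.
change (im (fproj h2 k f)) with (fun x => Sk h2 k (re f) x + Ck h2 k (im f) x).
apply: le_trans (sob_add h1_gt0 h2_gt0 n r3 r4) _; rewrite -mulrA ler_wpM2l // mulrDl.
by apply: lerD.
Qed.

Lemma csZ_fproj N f x : Vc f -> csZ N (fun k => fproj h2 k f x) = cx (fun x => sZ N (fun k => Ck h2 k (re f) x)) (fun x => sZ N (fun k => Ck h2 k (im f) x)) x.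
Proof.
move=> [[s1 _] [s2 _]].
have z (u : R * R -> R) : Cinf2 u -> sZ N (fun k => Sk h2 k u x) = 0.
  by move=> su; apply: sZ_odd => k; exact: SkN.
have E1 : sZ N (fun k => Ck h2 k (re f) x + -1 * Sk h2 k (im f) x) = sZ N (fun k => Ck h2 k (re f) x).
  by rewrite sZD (@sZM R N (-1) (fun k => Sk h2 k (im f) x)) (z _ s2) mulr0 addr0.
have E2 : sZ N (fun k => Sk h2 k (re f) x + Ck h2 k (im f) x) = sZ N (fun k => Ck h2 k (im f) x).
  by rewrite sZD (z _ s1) add0r.
exact: (f_equal2 (@Complex R) E1 E2).
Qed.

Lemma fproj_lim f : Vc f -> exists K, forall N, normc (ws f - csZ N (fun k => ws (fproj h2 k f))) <= K * (swt R - sZ N (wt R)).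
Proof.
move=> Vf; have [V1 V2] := Vf; have [n [B B0 HB]] := ws_bound.
have [D1 D10 H1] := sob_Rem h1_gt0 h2_gt0 n V1; have [D2 D20 H2] := sob_Rem h1_gt0 h2_gt0 n V2.
exists (1 + B * (D1 + D2)) => N.
have VP k := fproj_V h2_gt0 k Vf.
pose r := cx (Rem h2 N (re f)) (Rem h2 N (im f)).
have Vr : Vc r by split; exact: (Rem_qper h2_gt0).
have E : f = fun x => r x + csZ N (fun k => fproj h2 k f x).
  apply/funext => x; rewrite csZ_fproj // /r /cx /Rem /re /im; case: (f x) => p q.
  by apply: eq_cplx => /=; ring.
have -> : ws f - csZ N (fun k => ws (fproj h2 k f)) = ws r.
  by rewrite {1}E (ws_add Vr (csZ_V N VP)) (ws_csZ N VP) addrK.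
apply: sq_bound; rewrite ?subr_ge0 ?sZ_wt_lim ?mulr_ge0 ?addr_ge0 //.
apply: le_trans (HB _ Vr) _; rewrite -[leRHS]mulrA ler_wpM2l // mulrDl.
by apply: lerD; [exact: H1|exact: H2].
Qed.

(** The terms are bounded by a multiple of wt k, and the remainder after N
    terms tends to 0 in each Sobolev norm. *)
Lemma sum_fproj f : Vc f -> csummableZ (fun k => ws (fproj h2 k f)) /\ csumZ (fun k => ws (fproj h2 k f)) = ws f.
Proof.
move=> Vf; have [K HK] := fproj_bound Vf; have [K' HK'] := fproj_lim Vf.
apply: (csum_cvg HK).
  apply: (@tends0_le R _ (fun N => K' * (swt R - sZ N (wt R)))); last exact: tends0_scale (@tail_tends0 R).
  move=> N; apply: le_trans (HK' N); rewrite -[sZ N _]/(complex.Re (csZ N (fun k => ws (fproj h2 k f)))).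
  case: (ws f) (csZ _ _) => p q [t z] /=.
  by rewrite -sqrtr_sqr ler_sqrt ?addr_ge0 ?sqr_ge0 // lerDl sqr_ge0.
apply: (@tends0_le R _ (fun N => K' * (swt R - sZ N (wt R)))); last exact: tends0_scale (@tail_tends0 R).
move=> N; apply: le_trans (HK' N); rewrite -[sZ N _]/(complex.Im (csZ N (fun k => ws (fproj h2 k f)))).
case: (ws f) (csZ _ _) => p q [t z] /=.
by rewrite -sqrtr_sqr ler_sqrt ?addr_ge0 ?sqr_ge0 // lerDr sqr_ge0.
Qed.

End PsiSum.

(** * Conjugation by Psi *)

Section Conjugation.
Variable R : realType.
Variables (h1 h2 : R) (h1_gt0 : 0 < h1) (h2_gt0 : 0 < h2).
Notation Om := (@Omega R : set (measurableTypeR R * measurableTypeR R)).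
Notation L2O := (L2 (leb2 R) Om).
Notation V := (qper h1^-1 h2^-1).
Notation Vc := (qperc h1^-1 h2^-1).
Implicit Types (f g phi : R * R -> R[i]) (u v : R * R -> R) (w : functional R).

(** A is the smooth periodic function on the line that primA a represents on
    (0,1). *)
Record prim (a A : R -> R) : Prop := Prim {
  prim_sm : Cinf1 A; prim_per : forall x, A (x + 1) = A x;
  prim_der : forall x : R, is_derive x (1:R) A (a x - mean a);
  prim_eq : forall x, 0 < x < 1 -> primA a x = A x }.

(** Its transpose is Psi a when A is the primitive of a. *)
Definition unshear (A : R -> R) := shear (fun t : R => - A t).

Lemma unshear_tame A : Cinf1 A -> (forall x, A (x + 1) = A x) -> tame_op h1 h2 (unshear A).
Proof.
by move=> sA pA; apply: (shear_tame h1_gt0 h2_gt0); [exact: Cinf1_opp|move=> x; rewrite pA].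
Qed.

Lemma PsiE a A w phi f : prim a A -> Hminf h1 h2 w -> L2O phi -> Vc f -> aeC phi f ->
  csummableZ (fun k => Psi_term h2 a w k phi) /\ Psi h2 a w phi = w (compwise (unshear A) f).
Proof.
move=> [sA pA dA eA] Hw Lp Vf pf; have tA := unshear_tame sA pA.
have cA : continuous A := dC_cont (Cinf1_Cn sA 0).
have E : (fun k => Psi_term h2 a w k phi) = fun k => w (compwise (unshear A) (fproj h2 k f)).
  by apply/funext => k; exact: (Psi_termE h1_gt0 h2_gt0 k cA tA eA Hw Lp Vf pf).
by rewrite /Psi E; exact: (sum_fproj h1_gt0 h2_gt0 tA Hw Vf).
Qed.

Lemma Psi_op a A : prim a A -> operator_on_Hminf h1 h2 (Psi h2 a).
Proof.
move=> pA w Hw; apply: (Hminf_comp h1_gt0 h2_gt0 (unshear_tame (prim_sm pA) (prim_per pA)) Hw) => phi f Lp Vf pf.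
by have [_] := PsiE pA Hw Lp Vf pf.
Qed.

(** The chain rule with A' = a - mean a: the shear straightens the vector
    field. *)
Lemma Dfield_unshear a A u : prim a A -> Cinf2 u ->
  Dfield a (unshear A u) = unshear A (Dfield (fun=> mean a) u).
Proof.
move=> [sA pA dA eA] su; have s1 := Cinf2_pD false su.
have dN (x : R) : is_derive x (1:R) (fun t => - A t) (- (a x - mean a)) by exact: is_deriveN.
have P1 := pder1_shear (Cinf2_cont s1) (Cinf2_pder false su) (Cinf2_pder true su) dN.
have P2 := pder2_shear (fun t => - A t) (Cinf2_pder true su).
rewrite /Dfield /unshear (pderE P1) (pderE P2); apply/funext => x; rewrite /shear /=.
by gen_pD; ring.
Qed.

Lemma unshearK A u : unshear A (unshear (fun t => - A t) u) = u /\ unshear (fun t => - A t) (unshear A u) = u.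
Proof.
split; apply/funext => -[x y]; rewrite /unshear /shear /=; congr (u (_, _)); ring.
Qed.

Lemma Dfield_unshearN a A u : prim a A -> Cinf2 u ->
  unshear (fun t => - A t) (Dfield a u) = Dfield (fun=> mean a) (unshear (fun t => - A t) u).
Proof.
move=> pA su; have [sA _ _ _] := pA.
have su' : Cinf2 (unshear (fun t => - A t) u) by apply: Cinf2_shear => //; apply: Cinf1_opp; exact: Cinf1_opp.
have := Dfield_unshear pA su'; rewrite (unshearK A u).1 => ->.
by rewrite (unshearK A _).2.
Qed.

(** On (0,1) the function primA a is A - A 0. *)
Lemma prim0 (a A : R -> R) : continuous a -> prim a A -> A 0 = 0.
Proof.
move=> ca [sA pA dA eA].
have dG (t : R) : is_derive t (1:R) (fun t => A t + mean a * t) (a t).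
  by apply: is_derive_eq (dD (dA t) (dZ (mean a) (did t))) _; rewrite mulr1 subrK.
have x0 : 0 < 2^-1 :> R by rewrite invr_gt0.
have x1 : 0 < (2^-1 : R) < 1 by rewrite x0 invf_lt1 // ltr1n.
have := eA _ x1; rewrite /primA [\int[_]_(_ in _) _](int_seg_FTC x0 ca dG); lra.
Qed.

Lemma primN (a A : R -> R) : continuous a -> prim a A -> prim (fun t => - a t) (fun t => - A t).
Proof.
move=> ca pA; have A0 := prim0 ca pA; have [sA perA dA eA] := pA.
have cN : continuous (fun t => - a t) by move=> t; apply: continuousN; exact: ca.
have dG (t : R) : is_derive t (1:R) (fun t => - (A t + mean a * t)) (- a t).
  apply: is_deriveN; apply: is_derive_eq (dD (dA t) (dZ (mean a) (did t))) _; by rewrite mulr1 subrK.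
have mN : mean (fun t => - a t) = - mean a.
  rewrite {1}/mean [LHS](int_seg_FTC ltr01 cN dG) mulr0 addr0 A0 mulr1.
  by have := perA 0; rewrite add0r A0 => ->; ring.
split=> [||x|x x01].
- exact: Cinf1_opp.
- by move=> x; rewrite perA.
- by rewrite mN; apply: is_derive_eq (is_deriveN (dA x)) _; ring.
have /andP[x0 _] := x01.
by rewrite /primA mN [\int[_]_(_ in _) _](int_seg_FTC x0 cN dG) mulr0 addr0 A0; ring.
Qed.

Lemma PsiK a A w phi : continuous a -> prim a A -> Hminf h1 h2 w -> Hinf_adj h1 h2 phi ->
  Psi h2 a (Psi h2 (fun t => - a t) w) phi = w phi /\ Psi h2 (fun t => - a t) (Psi h2 a w) phi = w phi.
Proof.
move=> ca pA Hw /(Hinf_adjP h1_gt0 h2_gt0) [Lp [f Vf pf]].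
have pN := primN ca pA; have T1 := unshear_tame (prim_sm pA) (prim_per pA).
have T2 := unshear_tame (prim_sm pN) (prim_per pN).
have Hw1 := Psi_op pA Hw; have Hw2 := Psi_op pN Hw.
have r g : aeC g g := aeC_refl g.
have V1 := compwise_V T1 Vf; have V2 := compwise_V T2 Vf.
have [_ E1] := PsiE pA Hw2 Lp Vf pf; have [_ E2] := PsiE pN Hw (qperc_L2 V1) V1 (r _).
have [_ E3] := PsiE pN Hw1 Lp Vf pf; have [_ E4] := PsiE pA Hw (qperc_L2 V2) V2 (r _).
have E5 := Hminf_ae h1_gt0 h2_gt0 Hw Lp Vf pf.
have K1 : compwise (unshear (fun t => - A t)) (compwise (unshear A) f) = f.
  by rewrite /compwise -![re (cx _ _)]/(unshear A _) -![im (cx _ _)]/(unshear A _) !(unshearK A _).2 cxK.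
have K2 : compwise (unshear A) (compwise (unshear (fun t => - A t)) f) = f.
  by rewrite /compwise -![re (cx _ _)]/(unshear (fun t => - A t) _) -![im (cx _ _)]/(unshear (fun t => - A t) _) !(unshearK A _).1 cxK.
by rewrite E1 E2 E3 E4 K1 K2 E5.
Qed.

Lemma in_Hinf_eq w w' : eqHminf h1 h2 w w' -> in_Hinf h1 h2 w -> in_Hinf h1 h2 w'.
Proof. by move=> E [psi Hp H]; exists psi => // phi Ap; rewrite -E // H. Qed.

Lemma J_unshear A u v : Cinf1 A -> (forall x, A (x + 1) = A x) -> qper h1 h2 u -> V v ->
  J (fun x => u x * unshear A v x) = J (fun x => shear A u x * v x).
Proof.
move=> sA pA Vu Vv; have cA : continuous A := dC_cont (Cinf1_Cn sA 0).
have := qper_mul (qper_shear sA pA Vu) Vv; rewrite (divff (lt0r_neq0 h1_gt0)) (divff (lt0r_neq0 h2_gt0)).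
move=> [sF qF]; have cN : continuous (fun t => - A t) by move=> t; apply: continuousN; exact: cA.
have q x y : (fun x => shear A u x * v x) (x, y + 1) = (fun x => shear A u x * v x) (x, y).
  by have [_ ->] := qF x y; rewrite mul1r.
rewrite -(J_shear cN (Cinf2_cont sF) q); apply: eq_J => -[x y] _.
by rewrite /unshear /shear /=; congr (u (_, _) * _); ring.
Qed.

(** The shear preserves the integral of periodic functions, so it may be moved
    to the other factor. *)
Lemma Psi_Hinf a A w : prim a A -> Hminf h1 h2 w -> in_Hinf h1 h2 w -> in_Hinf h1 h2 (Psi h2 a w).
Proof.
move=> pA Hw [psi /(Hinf_P h1_gt0 h2_gt0) [Lpsi [g Vg pg]] E].
have [sA perA _ _] := pA; have [g1 g2] := Vg.
have V' : qperc h1 h2 (compwise (shear A) g) by split; exact: qper_shear.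
exists (compwise (shear A) g).
  apply/(Hinf_P h1_gt0 h2_gt0); split; first exact: qperc_L2 V'.
  by exists (compwise (shear A) g) => //; exact: aeC_refl.
move=> phi /(Hinf_adjP h1_gt0 h2_gt0) [Lp [f Vf pf]].
have [_ ->] := PsiE pA Hw Lp Vf pf.
have Vs := compwise_V (unshear_tame sA perA) Vf; have [f1 f2] := Vf.
rewrite E; last exact: Vc_Hinf.
rewrite /embed (int_ae Lpsi (qperc_L2 Vg) (qperc_L2 Vs) pg).
have C (p q : R * R -> R[i]) : int_Omega (fun x => p x * q x) = int_Omega (fun x => q x * p x).
  by congr (int_Omega _); apply/funext => x; rewrite mulrC.
rewrite [RHS]C (int_ae Lp (qperc_L2 Vf) (qperc_L2 V') pf) [RHS]C.
apply: (etrans (int_cmul (qperc_L2 Vg) (qperc_L2 Vs))); apply: esym.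
apply: (etrans (int_cmul (qperc_L2 V') (qperc_L2 Vf))); apply: esym.
have H u v := @J_unshear A u v sA perA.
exact: (f_equal2 (@Complex R) (f_equal2 (fun u v : R => u - v) (H _ _ g1 f1) (H _ _ g2 f2))
  (f_equal2 (fun u v : R => u + v) (H _ _ g1 f2) (H _ _ g2 f1))).
Qed.

End Conjugation.

(** * Hypoellipticity *)

Section Main.
Variable R : realType.
Variables (h1 h2 : R) (h1_gt0 : 0 < h1) (h2_gt0 : 0 < h2).
Variables (a A : R -> R) (sa : Cinf1 a) (pa : forall x, a (x + 1) = a x) (pA : prim a A).
Notation P := (vfield a).
Notation P0 := (vfield (fun=> mean a)).
Notation na := (fun t : R => - a t).

Let ca : continuous a := dC_cont (Cinf1_Cn sa 0).
Let s0 : Cinf1 (fun _ : R => mean a) := Cinf1_cst (mean a).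
Let T1 := unshear_tame h1_gt0 h2_gt0 (prim_sm pA) (prim_per pA).
Let pN := primN ca pA.
Let T2 := unshear_tame h1_gt0 h2_gt0 (prim_sm pN) (prim_per pN).

Lemma P_op : operator_on_Hminf h1 h2 P.
Proof. exact: (vfield_op h1_gt0 h2_gt0 sa pa). Qed.

Lemma P0_op : operator_on_Hminf h1 h2 P0.
Proof. exact: (vfield_op h1_gt0 h2_gt0 s0 (fun _ => erefl)). Qed.

Lemma P_E w phi f : Hminf h1 h2 w -> L2 (leb2 R) (@Omega R) phi -> qperc h1^-1 h2^-1 f -> aeC phi f ->
  P w phi = w (compwise (Dfield a) f).
Proof. exact: (vfieldE h1_gt0 h2_gt0 sa pa). Qed.

Lemma P0_E w phi f : Hminf h1 h2 w -> L2 (leb2 R) (@Omega R) phi -> qperc h1^-1 h2^-1 f -> aeC phi f ->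
  P0 w phi = w (compwise (Dfield (fun=> mean a)) f).
Proof. exact: (vfieldE h1_gt0 h2_gt0 s0 (fun _ => erefl)). Qed.

Lemma Psi_P w : Hminf h1 h2 w -> eqHminf h1 h2 (Psi h2 a (P w)) (P0 (Psi h2 a w)).
Proof.
move=> Hw phi /(Hinf_adjP h1_gt0 h2_gt0) [Lp [f Vf pf]].
have V1 := compwise_V T1 Vf; have V2 := compwise_V (Dfield_tame h1_gt0 h2_gt0 s0 (fun _ => erefl)) Vf.
have [_ E1] := PsiE h1_gt0 h2_gt0 pA (P_op Hw) Lp Vf pf.
have E2 := P_E Hw (qperc_L2 V1) V1 (aeC_refl _).
have E3 := P0_E (Psi_op h1_gt0 h2_gt0 pA Hw) Lp Vf pf.
have [_ E4] := PsiE h1_gt0 h2_gt0 pA Hw (qperc_L2 V2) V2 (aeC_refl _).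
rewrite E1 E2 E3 E4; congr w; have [[s1 _] [s2 _]] := Vf.
exact: (f_equal2 (@cx R) (Dfield_unshear pA s1) (Dfield_unshear pA s2)).
Qed.

Lemma P_PsiN w : Hminf h1 h2 w -> eqHminf h1 h2 (Psi h2 na (P0 w)) (P (Psi h2 na w)).
Proof.
move=> Hw phi /(Hinf_adjP h1_gt0 h2_gt0) [Lp [f Vf pf]].
have V1 := compwise_V T2 Vf; have V2 := compwise_V (Dfield_tame h1_gt0 h2_gt0 sa pa) Vf.
have [_ E1] := PsiE h1_gt0 h2_gt0 pN (P0_op Hw) Lp Vf pf.
have E2 := P0_E Hw (qperc_L2 V1) V1 (aeC_refl _).
have E3 := P_E (Psi_op h1_gt0 h2_gt0 pN Hw) Lp Vf pf.
have [_ E4] := PsiE h1_gt0 h2_gt0 pN Hw (qperc_L2 V2) V2 (aeC_refl _).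
rewrite E1 E2 E3 E4; congr w; have [[s1 _] [s2 _]] := Vf.
exact: esym (f_equal2 (@cx R) (Dfield_unshearN pA s1) (Dfield_unshearN pA s2)).
Qed.

(** Psi and its inverse preserve smoothness and exchange P and P_0. *)
Lemma hypo_iff : globally_hypoelliptic h1 h2 P <-> globally_hypoelliptic h1 h2 P0.
Proof.
split=> GH w Hw Qw.
  have Hv := Psi_op h1_gt0 h2_gt0 pN Hw.
  have Pv : in_Hinf h1 h2 (P (Psi h2 na w)).
    exact: in_Hinf_eq (P_PsiN Hw) (Psi_Hinf h1_gt0 h2_gt0 pN (P0_op Hw) Qw).
  apply: in_Hinf_eq (Psi_Hinf h1_gt0 h2_gt0 pA Hv (GH _ Hv Pv)) => phi Hp.
  by have [] := PsiK h1_gt0 h2_gt0 ca pA Hw Hp.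
have Hv := Psi_op h1_gt0 h2_gt0 pA Hw.
have Pv : in_Hinf h1 h2 (P0 (Psi h2 a w)).
  exact: in_Hinf_eq (Psi_P Hw) (Psi_Hinf h1_gt0 h2_gt0 pA (P_op Hw) Qw).
apply: in_Hinf_eq (Psi_Hinf h1_gt0 h2_gt0 pN Hv (GH _ Hv Pv)) => phi Hp.
by have [] := PsiK h1_gt0 h2_gt0 ca pA Hw Hp.
Qed.

End Main.

Theorem theorem4p18 (R : realType) (h1 h2 : R) (h1_gt0 : 0 < h1)
    (h2_gt0 : 0 < h2) (a : R -> R) (a_smooth : smooth_periodic a) :
  let P := vfield a in
  let P0 := vfield (fun=> mean a) in
  ([/\ operator_on_Hminf h1 h2 P,
       operator_on_Hminf h1 h2 P0,
       (forall w, Hminf h1 h2 w -> Psi_converges h1 h2 a w) &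
       operator_on_Hminf h1 h2 (Psi h2 a)] /\
   (forall w, Hminf h1 h2 w ->
      eqHminf h1 h2 (Psi h2 a (P w)) (P0 (Psi h2 a w)))) /\
  (globally_hypoelliptic h1 h2 P <-> globally_hypoelliptic h1 h2 P0).
Proof.
have sa := periodic_Cinf1 a_smooth; have [_ pa] := a_smooth.
have [A [sA perA dA eA]] := primitive_periodic a_smooth; have pA := Prim sA perA dA eA.
split; last exact: (hypo_iff h1_gt0 h2_gt0 sa pa pA).
split; last by move=> w; exact: (Psi_P h1_gt0 h2_gt0 sa pa pA).
split.
- exact: (P_op h1_gt0 h2_gt0 sa pa).
- exact: (P0_op h1_gt0 h2_gt0).
- move=> w Hw phi /(Hinf_adjP h1_gt0 h2_gt0) [Lp [f Vf pf]].
  by have [] := PsiE h1_gt0 h2_gt0 pA Hw Lp Vf pf.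
exact: (Psi_op h1_gt0 h2_gt0 pA).
Qed.
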